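(* Let $\Omega\subset\mathbb R^d$ be open and bounded with $\mathscr L^d(\partial\Omega)=0$, let $\mathcal A$ be a constant rank homogeneous operator from $W$ to $X$, and let $L$ be a non-trivial subspace of $W_{\mathcal A}$ with no non-trivial $\Lambda_{\mathcal A}$-connections, i.e. $$L\cap\ker\mathbb A(\xi)=\{0\}\qquad\text{for all }\xi\in\mathbb R^d\setminus\{0\}.$$ Then there exists a sequence $\{w_j\}\subset C^\infty(\Omega;W)$ with $\mathcal Aw_j=0$ on $\Omega$ such that $$w_j\,\mathscr L^d\overset{*}{\rightharpoonup}0\ \text{in }\mathcal M(\Omega;W),\qquad\operatorname{dist}(w_j,L)\to0\ \text{in }L^1(\Omega),$$ but $w_j$ does not converge weakly to $0$ in $L^1(\Omega;W)$, and $\{|w_j|\}$ is not locally equi-integrable on any sub-domain of $\Omega$.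
   Context: $W,X$ are finite-dimensional real inner product spaces; $\mathscr L^d$ is Lebesgue measure; weak-* convergence in $\mathcal M(\Omega;W)$ (the $W$-valued Radon measures) is tested against $C_c(\Omega;W)$. Operator: $\mathcal A=\sum_{|\alpha|=k}A_\alpha\partial^\alpha$, $A_\alpha\in\mathrm{Lin}(W,X)$, symbol $\mathbb A(\xi)=(2\pi\mathrm i)^k\sum_{|\alpha|=k}\xi^\alpha A_\alpha$ (the scalar factor is immaterial for kernels and ranks). Constant rank: $\operatorname{rank}\mathbb A(\xi)$ is a fixed positive integer for all $\xi\in\mathbb R^d\setminus\{0\}$. $\Lambda_{\mathcal A}=\bigcup_{\xi\ne0}\ker\mathbb A(\xi)$, $W_{\mathcal A}=\operatorname{span}\Lambda_{\mathcal A}$. A family $\{g_j\}\subset L^1$ is equi-integrable on a set $O$ if for every $\varepsilon>0$ there is $\delta>0$ such that $\sup_j\int_E|g_j|\le\varepsilon$ for every Borel $E\subset O$ with $\mathscr L^d(E)\le\delta$; locally equi-integrable on an open set means equi-integrable on each of its compact subsets. *)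

(* Defs.v *)
From HB Require Import structures.
From mathcomp Require Import all_boot all_order all_algebra.
From mathcomp Require Import all_classical all_reals all_analysis.

Set Implicit Arguments.
Unset Strict Implicit.
Unset Printing Implicit Defensive.

Import Order.TTheory GRing.Theory Num.Theory.
Import VectorInternalTheory.
Import numFieldNormedType.Exports.

Local Open Scope classical_set_scope.
Local Open Scope ring_scope.

Section borel_rV.
Variables (R : realType) (n : nat).

Definition borel_rV : set (set 'rV[R]_n) := <<s (@open 'rV[R]_n) >>.

Lemma borel_rVC (A : set 'rV[R]_n) : borel_rV A -> borel_rV (~` A).
Proof. by move=> bA; rewrite /borel_rV -setTD; exact: sigma_algebraCD. Qed.

HB.instance Definition _ :=
  @isMeasurable.Build (sigma_display (@open 'rV[R]_n)) 'rV[R]_n borel_rV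
    (@sigma_algebra0 _ setT _) borel_rVC (@sigma_algebra_bigcup _ setT _).

End borel_rV.

Section borel_rV_theory.
Context {R : realType}.

Lemma open_measurable_rV n (U : set 'rV[R]_n) : open U -> measurable U.
Proof. by move=> oU; exact: sub_sigma_algebra. Qed.

Lemma measurable_coord n (i : 'I_n) :
  measurable_fun [set: 'rV[R]_n] (fun x : 'rV[R]_n => x ord0 i).
Proof.
apply: (measurability _ (measurable_realfun.RGenOpens.measurableE R)) => _ [_ [a [b ->]] <-].
rewrite setTI; apply: open_measurable_rV.
by apply: open_comp; [move=> x _; exact: coord_continuous | exact: interval_open].
Qed.

Lemma open_rV_boxes n (U : set 'rV[R]_n) : open U ->
  U = \bigcup_(q in [set q : 'rV[rat]_n * nat |
        [set x : 'rV[R]_n | forall i,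
           `|x ord0 i - ratr (q.1 ord0 i)| < q.2.+1%:R^-1] `<=` U])
      [set x : 'rV[R]_n | forall i,
           `|x ord0 i - ratr (q.1 ord0 i)| < q.2.+1%:R^-1].
Proof.
move=> oU; apply/seteqP; split=> [x Ux|x [q /= qU xq]]; last exact: qU.
have /nbhs_ballP[e /= e0 eU] : nbhs x U by exact: open_nbhs_nbhs.
have [N _ /(_ N (leqnn N)) /= Ne] := near_infty_natSinv_lt (PosNum (divr_gt0 e0 (ltr0n R 2))).
have r0 : 0 < N.+1%:R^-1 :> R by rewrite invr_gt0.
have q_ex (i : 'I_n) : exists q : rat, `|x ord0 i - ratr q| < N.+1%:R^-1 :> R.
  have [q] : exists q, ratr q \in `]x ord0 i - N.+1%:R^-1, x ord0 i + N.+1%:R^-1[.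
    by apply: rat_in_itvoo; rewrite ltrBlDr -addrA ltrDl addr_gt0.
  by rewrite in_itv /= => /andP[q1 q2]; exists q; rewrite distrC ltr_distl q1 q2.
pose q := \row_i sval (cid (q_ex i)).
have xq i : `|x ord0 i - ratr (q ord0 i)| < N.+1%:R^-1 :> R.
  by rewrite mxE; case: cid.
exists (q, N) => //= y yq; apply: eU; split=> // i0 j; rewrite ord1.
rewrite /ball /= -(subrK (ratr (q ord0 j)) (x ord0 j)) -addrA.
rewrite (le_lt_trans (ler_normD _ _)) // (splitr e) ltrD //.
  exact: lt_trans (xq j) Ne.
by rewrite distrC; exact: lt_trans (yq j) Ne.
Qed.

Lemma measurable_fun_rVP d (T : measurableType d) n (f : T -> 'rV[R]_n) :
  (forall i, measurable_fun setT (fun t => f t ord0 i)) ->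
  measurable_fun setT f.
Proof.
move=> mf; apply: (measurability (@open 'rV[R]_n)) => // _ [U oU <-].
rewrite setTI (open_rV_boxes oU) preimage_bigcup bigcup_mkcond.
apply: countable_bigcupT_measurable; first exact: countableP.
move=> q; case: ifP => _ //.
have -> : f @^-1` [set x : 'rV[R]_n | forall i,
      `|x ord0 i - ratr (q.1 ord0 i)| < q.2.+1%:R^-1] =
   \bigcap_(i in [set: 'I_n]) ((fun t => f t ord0 i) @^-1`
      [set` `]ratr (q.1 ord0 i) - q.2.+1%:R^-1,
              ratr (q.1 ord0 i) + q.2.+1%:R^-1[%R]).
  apply/seteqP; split=> [t ft i _|t ft i] /=.
    by have := ft i; rewrite ltr_distl in_itv.
  by have := ft i I; rewrite /= in_itv ltr_distl.
apply: fin_bigcap_measurable => // i _.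
by rewrite -[X in measurable X]setTI; exact: mf.
Qed.

End borel_rV_theory.

Section lebesgue_rV_step.
Context {R : realType} {n : nat}.
Variable m : {sigma_finite_measure set 'rV[R]_n -> \bar R}.

Definition rV_cons (p : R * 'rV[R]_n) : 'rV[R]_n.+1 :=
  row_mx (const_mx p.1 : 'rV[R]_1) p.2.

Definition rV_uncons (x : 'rV[R]_n.+1) : R * 'rV[R]_n :=
  (x ord0 ord0, rsubmx (x : 'rV[R]_(1 + n))).

Lemma rV_consK : cancel rV_cons rV_uncons.
Proof.
move=> [a y]; rewrite /rV_uncons /rV_cons /= row_mxKr; congr pair.
by rewrite mxE; case: splitP => // j _; rewrite mxE.
Qed.

Lemma rV_unconsK : cancel rV_uncons rV_cons.
Proof.
move=> x; apply/rowP => i; rewrite mxE; case: splitP => j ij; rewrite mxE /=;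
  by congr (x _ _); apply/val_inj; rewrite /= ij ?ord1.
Qed.

Lemma measurable_rV_cons : measurable_fun setT rV_cons.
Proof.
apply: measurable_fun_rVP => i.
case: (@splitP 1 n i) => j ij.
  have -> : (fun p => rV_cons p ord0 i) = fst.
    apply/funext => p; rewrite mxE; case: splitP => k; first by rewrite mxE.
    by rewrite ij ord1.
  exact: measurable_fst.
have -> : (fun p => rV_cons p ord0 i) = (fun x : 'rV[R]_n => x ord0 j) \o snd.
  apply/funext => p; rewrite mxE; case: splitP => k; first by rewrite ij ord1.
  by rewrite ij => /addnI jk; congr (_ _ _); exact/val_inj.
exact: (measurableT_comp (measurable_coord j) measurable_snd).
Qed.

Lemma measurable_rV_uncons : measurable_fun setT rV_uncons.
Proof.
apply/measurable_fun_pairP; split => /=; first exact: measurable_coord.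
apply: measurable_fun_rVP => i /=.
have -> : (fun x : 'rV[R]_n.+1 => (rV_uncons x).2 ord0 i) =
          (fun x => x ord0 (rshift 1 i)) by apply/funext => x; rewrite mxE.
exact: measurable_coord.
Qed.

Definition lebesgue_rV_step : set 'rV[R]_n.+1 -> \bar R :=
  pushforward (lebesgue_measure \x m)%E rV_cons.

Let lebesgue_rV_step0 : lebesgue_rV_step set0 = 0%E.
Proof. by rewrite /lebesgue_rV_step /pushforward preimage_set0 measure0. Qed.

Let lebesgue_rV_step_ge0 A : (0 <= lebesgue_rV_step A)%E.
Proof. by apply: integral_ge0 => x _; exact: measure_ge0. Qed.

Let lebesgue_rV_step_sigma_additive : semi_sigma_additive lebesgue_rV_step.
Proof.
rewrite /lebesgue_rV_step => F mF tF mUF.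
apply: measure_semi_sigma_additive => //. exact: measurable_rV_cons.
Qed.

HB.instance Definition _ := isMeasure.Build _ _ _ lebesgue_rV_step
  lebesgue_rV_step0 lebesgue_rV_step_ge0 lebesgue_rV_step_sigma_additive.

Let lebesgue_rV_step_sigma_finite : sigma_finite setT lebesgue_rV_step.
Proof.
have /sigma_finiteP[F [FT ndF Foo]] := sigma_finiteT (@lebesgue_measure R).
have /sigma_finiteP[G [GT ndG Goo]] := sigma_finiteT m.
exists (fun k => rV_uncons @^-1` (F k `*` G k)).
  rewrite -preimage_bigcup; apply/esym; rewrite -subTset => x _ /=.
  have [i _ Fi] : (\bigcup_k F k) (rV_uncons x).1 by rewrite -FT.
  have [j _ Gj] : (\bigcup_k G k) (rV_uncons x).2 by rewrite -GT.
  exists (maxn i j) => //; split.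
    by move: Fi; exact/subsetPset/ndF/leq_maxl.
  by move: Gj; exact/subsetPset/ndG/leq_maxr.
move=> k; have [mF Fk] := Foo k; have [mG Gk] := Goo k; split.
  rewrite -[X in measurable X]setTI; apply: measurable_rV_uncons => //.
  exact: measurableX.
rewrite /lebesgue_rV_step /pushforward -comp_preimage.
rewrite (_ : _ \o _ = id); last by apply/funext => p /=; rewrite rV_consK.
by rewrite preimage_id product_measure1E// lte_mul_pinfty// ge0_fin_numE.
Qed.

HB.instance Definition _ := Measure_isSigmaFinite.Build _ _ _ lebesgue_rV_step
  lebesgue_rV_step_sigma_finite.

End lebesgue_rV_step.

(* n-fold product of one-dimensional Lebesgue measure on the Borel sets *)
Fixpoint lebesgue_rV (R : realType) (n : nat) :
    {sigma_finite_measure set 'rV[R]_n -> \bar R} :=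
  if n is n'.+1 then lebesgue_rV_step (lebesgue_rV R n')
  else \d_(0 : 'rV[R]_0).

Lemma lebesgue_rV_box (R : realType) n (a b : 'rV[R]_n) :
  (forall i, a ord0 i <= b ord0 i) ->
  lebesgue_rV R n [set x : 'rV[R]_n | forall i, a ord0 i < x ord0 i <= b ord0 i] =
  (\prod_(i < n) (b ord0 i - a ord0 i))%:E.
Proof.
elim: n a b => [|n IHn] a b ab.
  by rewrite big_ord0 /= diracE mem_set //= => -[].
pose a' : 'rV[R]_n := rsubmx (a : 'rV[R]_(1 + n)).
pose b' : 'rV[R]_n := rsubmx (b : 'rV[R]_(1 + n)).
have rV_cons0 (p : R * 'rV[R]_n) : rV_cons p ord0 ord0 = p.1.
  by rewrite mxE; case: splitP => // j _; rewrite mxE.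
have shiftE (x : 'rV[R]_n.+1) i :
    rsubmx (x : 'rV[R]_(1 + n)) ord0 i = x ord0 (lift ord0 i).
  by rewrite mxE; congr (x _ _); exact/val_inj.
have rV_consS (p : R * 'rV[R]_n) (i : 'I_n) :
    rV_cons p ord0 (lift ord0 i) = p.2 ord0 i.
  by rewrite -shiftE row_mxKr.
transitivity ((lebesgue_measure \x lebesgue_rV R n)%E
    (`]a ord0 ord0, b ord0 ord0]%classic `*`
      [set y : 'rV[R]_n | forall i, a' ord0 i < y ord0 i <= b' ord0 i])).
  congr ((lebesgue_measure \x lebesgue_rV R n)%E _).
  apply/seteqP; split=> [p pab|p [/= p1 p2] i].
    split; first by have := pab ord0; rewrite rV_cons0 /= in_itv.
    by move=> i; have := pab (lift ord0 i); rewrite rV_consS !shiftE.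
  have [j ->|->] := unliftP ord0 i.
    by have := p2 j; rewrite !shiftE rV_consS.
  by rewrite rV_cons0; move: p1; rewrite in_itv.
have mbox : measurable [set y : 'rV[R]_n |
    forall i, a' ord0 i < y ord0 i <= b' ord0 i].
  rewrite (_ : [set y | _] = \bigcap_(i in [set: 'I_n])
      ((fun y : 'rV[R]_n => y ord0 i) @^-1` `]a' ord0 i, b' ord0 i])); last first.
    apply/seteqP; split=> [y yab i _|y yab i] /=.
      by have := yab i; rewrite in_itv.
    by have := yab i I; rewrite /= in_itv.
  apply: fin_bigcap_measurable => // i _.
  by rewrite -[X in measurable X]setTI; exact: measurable_coord.
rewrite product_measure1E // IHn; last by move=> i; rewrite !shiftE.
rewrite big_ord_recl EFinM; congr (_ * _)%E; last first.
  by congr _%:E; apply: eq_bigr => i _; rewrite !shiftE.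
apply: eq_trans (lebesgue_measure_itv `]a ord0 ord0, b ord0 ord0]) _.
rewrite /= lte_fin.
have := ab ord0; rewrite le_eqVlt => /predU1P[->|->]; last by rewrite EFinB.
by rewrite ltxx subrr.
Qed.

Section smooth.
Variables (R : realType) (d : nat) (V : vectType R).
Implicit Types (f : 'rV[R]_d -> V) (U : set 'rV[R]_d).

(* A [vectType] carries no topology: limits in V are taken through the linear
   isomorphism [v2r] onto the row vectors (all norms on V are equivalent). *)
Definition V_continuous_at f (x : 'rV[R]_d) : Prop :=
  {for x, continuous (v2r \o f)}.

Definition V_measurable_on U f : Prop := measurable_fun U (v2r \o f).

Definition basis_rV (i : 'I_d) : 'rV[R]_d := delta_mx ord0 i.

Definition has_partial (i : 'I_d) f (x : 'rV[R]_d) : Prop :=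
  derivable (v2r \o f) x (basis_rV i).

Definition partial (i : 'I_d) f (x : 'rV[R]_d) : V :=
  r2v ('D_(basis_rV i) (v2r \o f) x).

Definition mpartial (alpha : 'I_d -> nat) f : 'rV[R]_d -> V :=
  foldr (fun i => iter (alpha i) (partial i)) f (enum 'I_d).

(* Meant for open U: values of f outside U are then irrelevant. *)
Fixpoint class_C (n : nat) U f : Prop :=
  (forall x, U x -> V_continuous_at f x) /\
  (if n is n'.+1 then
     forall i, (forall x, U x -> has_partial i f x) /\ class_C n' U (partial i f)
   else True).

Definition smooth_on U f : Prop := forall n, class_C n U f.

(* C_c(U; V), each function being extended by zero to R^d *)
Definition compactly_supported_in U f : Prop :=
  (forall x, V_continuous_at f x) /\
  exists K, [/\ compact K, K `<=` U & forall x, ~ K x -> f x = 0].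

End smooth.

(* Every multi-index of length k has entries at most k; among the functions of
   type [multiindex d k] only those of length k are used. *)
Definition multiindex (d k : nat) := {ffun 'I_d -> 'I_k.+1}.

Definition mi_length (d k : nat) (alpha : multiindex d k) : nat :=
  (\sum_(i < d) alpha i)%N.

Section operator.
Variables (R : realType) (d k : nat) (W X : vectType R).
Variable A : multiindex d k -> 'Hom(W, X).

Definition diff_op (w : 'rV[R]_d -> W) (x : 'rV[R]_d) : X :=
  \sum_(alpha | mi_length alpha == k) A alpha (mpartial (fun i => alpha i : nat) w x).

(* The factor (2 pi i)^k of the symbol is dropped: it is a nonzero scalar, so
   neither kernels (in W) nor ranks see it. *)
Definition symbol (xi : 'rV[R]_d) : 'Hom(W, X) :=
  \sum_(alpha | mi_length alpha == k)
     (\prod_(i < d) xi ord0 i ^+ alpha i) *: A alpha.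

Definition constant_rank : Prop :=
  exists2 r, (0 < r)%N &
    forall xi : 'rV[R]_d, xi != 0 -> \dim (limg (symbol xi)) = r.

Definition wave_cone : set W :=
  [set v | exists2 xi : 'rV[R]_d, xi != 0 & v \in lker (symbol xi)].

End operator.

Definition span_of (R : realType) (W : vectType R) (S : set W) : set W :=
  [set v | exists2 s : seq W, {in s, forall u, S u} & v \in span s].

Section convergence.
Variables (R : realType) (d : nat) (W : vectType R).
Variable dotW : {dot W for idfun}.
Implicit Types (U K : set 'rV[R]_d) (w : nat -> 'rV[R]_d -> W)
  (g : nat -> 'rV[R]_d -> R).

Local Notation mu := (lebesgue_rV R d).

Definition dnorm (v : W) : R := Num.sqrt (dotW v v).

Definition dist_to (L : {vspace W}) (v : W) : R :=
  inf [set dnorm (v - u) | u in [set` L]].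

Definition in_L1 U (f : 'rV[R]_d -> W) : Prop :=
  V_measurable_on U f /\ mu.-integrable U (fun x => (dnorm (f x))%:E).

Definition in_Linfty U (f : 'rV[R]_d -> W) : Prop :=
  V_measurable_on U f /\
  exists M : R, {ae mu, forall x, U x -> dnorm (f x) <= M}.

(* Weak-* convergence to 0 of the W-valued Radon measures w_j mu on U. *)
Definition density_weakstar_cvg0 U w : Prop :=
  forall phi, compactly_supported_in U phi ->
    (fun j => \int[mu]_(x in U) dotW (phi x) (w j x)) @ \oo --> (0 : R).

(* Weak convergence in L^1, tested against its dual L^infty. *)
Definition weakL1_cvg0 U w : Prop :=
  forall phi, in_Linfty U phi ->
    (fun j => \int[mu]_(x in U) dotW (phi x) (w j x)) @ \oo --> (0 : R).

Definition L1_cvg0 U g : Prop :=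
  (forall j, mu.-integrable U (EFin \o g j)) /\
  (fun j => \int[mu]_(x in U) `|g j x|) @ \oo --> (0 : R).

Definition equi_integrable U g : Prop :=
  forall e : R, 0 < e -> exists2 delta : R, 0 < delta &
    forall E, measurable E -> E `<=` U -> (mu E <= delta%:E)%E ->
      forall j, (\int[mu]_(x in E) `|g j x|%:E <= e%:E)%E.

Definition locally_equi_integrable U g : Prop :=
  forall K, compact K -> K `<=` U -> equi_integrable K g.

End convergence.

(* Main.v *)
(* Trigonometric fields whose frequencies are nonzero integer vectors q and whose
   amplitudes lie in the kernels of the symbol at q are smooth, periodic, A-free
   and have mean zero ([osc] below).  For [f = dist_to L - c * dnorm], minimize
   the mean of [f (y + w)] over such [w].  If the means at [y = 0] were all
   nonnegative, this envelope would be finite, Lipschitz, positively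
   1-homogeneous and, by lamination, midpoint convex along the wave cone, hence
   nonnegative on average at [v] and [- v] for [v] in the span of the cone
   (Kirchheim and Kristensen); but at [v] and [- v] in [L] it is at most
   [- c * dnorm v].  So some field has a mean distance to [L] smaller than [c]
   times its mean norm.  Multiplying it by a highly concentrated scalar amplitude,
   and correcting the frequencies by constant rank, gives fields [G j] of mean
   norm 1, living mostly on small sets where they are large, at small mean
   distance from [L].  The sequence is [w j x = G j (2 ^ j x)]: it averages to
   zero on dyadic cells but keeps a fixed amount of mass, in every cell, on sets
   of vanishing measure. *)

Require Import Defs.
From HB Require Import structures.
From mathcomp Require Import all_boot all_order all_algebra.
From mathcomp Require Import all_classical all_reals all_analysis.
From mathcomp Require Import measurable_realfun.
From mathcomp Require Import ring lra.

Set Implicit Arguments.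
Unset Strict Implicit.
Unset Printing Implicit Defensive.

Import Order.TTheory GRing.Theory Num.Theory.
Import VectorInternalTheory.
Import numFieldNormedType.Exports.

Local Open Scope classical_set_scope.
Local Open Scope ring_scope.

(** * Boxes and periodic functions *)

(** A product of a scalar and an [A]-free field is not [A]-free, so products are first formed with a
    slow variable [x] and a fast variable [z]. Constant rank makes the kernels move continuously
    with the frequency, which repairs the product once the fast frequency is large, and averaging
    over the fast phase shows that some phase does no worse than the two-scale mean. Concentration
    is free because the gap function is positively homogeneous: a nonnegative amplitude of mean one
    preserves its negative mean. Adding [Num.min (dn u) lam] to the gap function packs both
    requirements, small distance and little mass at moderate values, into the sign of one mean.
    Failure of weak convergence needs a single bounded test function that detects the fields [w j]
    for all large [j]. Hence [eps l] is chosen after the sup norms of the earlier [G j]: all later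
    peaks together then carry little mass of [w j], and the test function may follow the last peak
    at each point. *)

Section boxes.
Variables (R : realType) (d : nat).
Local Notation E := 'rV[R]_d.
Local Notation mu := (lebesgue_rV R d).

Lemma le_coord_norm (x : E) i : `|x ord0 i| <= `|x|.
Proof.
rewrite [leRHS]/Num.norm /= mx_normrE.
exact: (le_bigmax _ (fun ij : 'I_1 * 'I_d => `|x ij.1 ij.2|) (ord0, i)).
Qed.

(** Half-open boxes tile space without overlap and are stable under intersection, so they serve both
    for cutting integrals and as a pi-system. *)
Definition rbox (a b : E) : set E :=
  [set x | forall i, a ord0 i < x ord0 i <= b ord0 i].

Definition cube (a : E) (l : R) : set E := rbox a (a + const_mx l).

Lemma measurable_rbox a b : measurable (rbox a b).
Proof.
rewrite (_ : rbox a b = \bigcap_(i in [set: 'I_d])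
    ((fun y : E => y ord0 i) @^-1` `]a ord0 i, b ord0 i])); last first.
  apply/seteqP; split=> [y yab i _|y yab i] /=; first by have := yab i; rewrite in_itv.
  by have := yab i I; rewrite /= in_itv.
apply: fin_bigcap_measurable => // i _.
by rewrite -[X in measurable X]setTI; exact: measurable_coord.
Qed.

Lemma measurable_cube a l : measurable (cube a l).
Proof. exact: measurable_rbox. Qed.

Lemma measure_cube a l : 0 <= l -> mu (cube a l) = (l ^+ d)%:E.
Proof.
move=> l0; rewrite lebesgue_rV_box => [|i]; last by rewrite !mxE lerDl.
congr EFin; rewrite (eq_bigr (fun=> l)) => [|i _].
  by rewrite prodr_const card_ord.
by rewrite !mxE addrAC subrr add0r.
Qed.

Lemma rboxI a b a' b' : rbox a b `&` rbox a' b' =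
  rbox (\row_i Num.max (a ord0 i) (a' ord0 i)) (\row_i Num.min (b ord0 i) (b' ord0 i)).
Proof.
apply/seteqP; split=> [x [xab xab'] i|x xab].
  rewrite !mxE gt_max le_min.
  by have /andP[-> ->] := xab i; have /andP[-> ->] := xab' i.
split=> i; have := xab i; rewrite !mxE gt_max le_min => /andP[/andP[? ?] /andP[? ?]];
  by apply/andP.
Qed.

Definition rboxes : set (set E) := [set A | exists a b, A = rbox a b].

(** Each point of an open set lies in a half-open cube contained in it, with rational centre and
    half side [N.+1%:R^-1], and there are only countably many such cubes. *)
Lemma open_rV_rboxes (U : set E) : open U -> <<s rboxes >> U.
Proof.
move=> oU.
pose B (q : 'rV[rat]_d * nat) := rbox (\row_i (ratr (q.1 ord0 i) - q.2.+1%:R^-1))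
  (\row_i (ratr (q.1 ord0 i) + q.2.+1%:R^-1)).
have -> : U = \bigcup_(q in [set q | B q `<=` U]) B q.
  apply/seteqP; split=> [x Ux|x [q /= qU xq]]; last exact: qU.
  have /nbhs_ballP[e /= e0 eU] : nbhs x U by exact: open_nbhs_nbhs.
  have [N _ /(_ N (leqnn N)) /= Ne] :=
    near_infty_natSinv_lt (PosNum (divr_gt0 e0 (ltr0n R 2))).
  have r0 : 0 < N.+1%:R^-1 :> R by rewrite invr_gt0.
  have q_ex (i : 'I_d) : exists q : rat, `|x ord0 i - ratr q| < N.+1%:R^-1 :> R.
    have [q] : exists q, ratr q \in `]x ord0 i - N.+1%:R^-1, x ord0 i + N.+1%:R^-1[.
      by apply: rat_in_itvoo; rewrite ltrBlDr -addrA ltrDl addr_gt0.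
    by rewrite in_itv /= => /andP[q1 q2]; exists q; rewrite distrC ltr_distl q1 q2.
  have [q xq] : exists q : 'rV[rat]_d,
      forall i, `|x ord0 i - ratr (q ord0 i)| < N.+1%:R^-1 :> R.
    by exists (\row_i sval (cid (q_ex i))) => i; rewrite mxE; case: cid.
  exists (q, N) => /= [y yq|i]; last first.
    rewrite !mxE /=; by have := xq i; rewrite ltr_distl => /andP[-> /ltW ->].
  apply: eU; split=> // i0 j; rewrite ord1.
  rewrite /ball /= -(subrK (ratr (q ord0 j)) (x ord0 j)) -addrA.
  rewrite (le_lt_trans (ler_normD _ _)) // (splitr e) ltrD //.
    exact: lt_trans (xq j) Ne.
  have := yq j; rewrite 2!mxE /= => /andP[y1 y2].
  rewrite distrC; apply: le_lt_trans Ne; rewrite ler_distl y2 andbT.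
  exact: ltW.
(* [X] carries the generated sigma-algebra, so that countable unions can be taken in it. *)
rewrite bigcup_mkcond; pose X := g_sigma_algebraType rboxes.
apply: (@countable_bigcupT_measurable _ X); first exact: countableP.
move=> q; case: ifP => _; last exact: measurable0.
by apply: sub_sigma_algebra; eexists; eexists.
Qed.

Lemma measurable_rboxes : @measurable _ E = <<s rboxes >>.
Proof.
apply/seteqP; split; last first.
  apply: smallest_sub; first exact: sigma_algebra_measurable.
  by move=> _ [a [b ->]]; exact: measurable_rbox.
apply: smallest_sub; first exact: smallest_sigma_algebra.
exact: open_rV_rboxes.
Qed.

(** Uniqueness of measures on a pi-system; a box with some [b] coordinate below the [a] coordinate
    is empty, so only ordered corners are tested. *)
Lemma lebesgue_rV_unique (m : {measure set E -> \bar R}) :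
  (forall a b : E, (forall i, a ord0 i <= b ord0 i) -> m (rbox a b) = mu (rbox a b)) ->
  forall A, measurable A -> m A = mu A.
Proof.
move=> mE A mA.
have mE' B : rboxes B -> mu B = m B.
  move=> [a [b ->]].
  have [ab|/existsNP[i /negP]] := pselect (forall i, a ord0 i <= b ord0 i).
    by rewrite mE.
  rewrite -ltNge => bai; suff -> : rbox a b = set0 by rewrite !measure0.
  apply/seteqP; split=> // x /(_ i) /andP[ax xb].
  by have := lt_trans (lt_le_trans ax xb) bai; rewrite ltxx.
(* The cubes of side [2k] centred at the origin exhaust space and have finite measure. *)
apply/esym; pose g k : set E := cube (const_mx (- k%:R)) (k%:R *+ 2).
apply: (@measure_unique _ R E rboxes g _ _ _ _ mu m) mA => //.
- exact: measurable_rboxes.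
- by move=> _ _ [a [b ->]] [a' [b' ->]]; rewrite rboxI; eexists; eexists.
- by move=> k; eexists; eexists.
- apply/seteqP; split=> // x _.
  have [N xN] : exists N : nat, forall i, `|x ord0 i| < N%:R.
    exists (Num.trunc `|x|).+1 => i.
    exact: le_lt_trans (le_coord_norm x i) (truncnS_gt _).
  exists N => // i; rewrite !mxE.
  have := xN i; rewrite ltr_norml => /andP[-> /ltW]; lra.
- by move=> k; rewrite /g /= measure_cube ?ltry.
Qed.

(** This class is stable under the algebra used below and integrable on every set of finite measure,
    which settles all integrability side conditions. *)
Definition bdd_measurable (F : E -> R) :=
  measurable_fun setT F /\ exists B, forall x, `|F x| <= B.

Lemma integrable_bdd F D : bdd_measurable F -> measurable D -> (mu D < +oo)%E ->
  mu.-integrable D (EFin \o F).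
Proof.
move=> [mF [B FB]] mD Doo; apply: measurable_bounded_integrable => //.
  exact: measurable_funTS.
exists B; split; first exact: num_real.
by move=> M BM x _; apply: le_trans (FB x) (ltW BM).
Qed.

Lemma integrable_cube F a l : bdd_measurable F -> 0 <= l ->
  mu.-integrable (cube a l) (EFin \o F).
Proof.
move=> bF l0; apply: integrable_bdd => //; first exact: measurable_cube.
by rewrite measure_cube // ltry.
Qed.

Lemma measurable_affine (K : R) (s : E) :
  measurable_fun setT (fun x : E => K *: x + s).
Proof.
apply: measurable_fun_rVP => i.
rewrite (_ : (fun t => _) = (fun x : E => K * x ord0 i + s ord0 i)); last first.
  by apply/funext => x; rewrite !mxE.
by apply: measurable_funD => //; apply: measurable_funM => //; exact: measurable_coord.
Qed.

(** [K ^+ d] times the image measure agrees with [mu] on boxes, where it is a product of side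
    lengths; uniqueness does the rest. *)
Lemma measure_affine (K : R) (s : E) A : 0 < K -> measurable A ->
  mu ((fun x => K *: x + s) @^-1` A) = ((K ^+ d)^-1%:E * mu A)%E.
Proof.
move=> K0 mA.
pose phi (x : E) := K *: x + s.
have Kd : 0 < K ^+ d by exact: exprn_gt0.
unshelve epose (p := pushforward mu phi : {measure set E -> \bar R}).
  exact: measurable_affine.
pose m : {measure set E -> \bar R} := mscale (NngNum (ltW Kd)) p.
suff mE (a b : E) : (forall i, a ord0 i <= b ord0 i) -> m (rbox a b) = mu (rbox a b).
  rewrite -(lebesgue_rV_unique (m := m) mE mA) /m /= /mscale /= /pushforward.
  by rewrite muleA -EFinM mulVf ?mul1e // gt_eqF.
move=> ab; rewrite /m /= /mscale /= /pushforward.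
have -> : phi @^-1` (rbox a b) = rbox (K^-1 *: (a - s)) (K^-1 *: (b - s)).
  apply/seteqP; split=> x /= xab i; have := xab i; rewrite !mxE /=.
    by rewrite ler_pdivlMl // ltr_pdivrMl // ltrBlDr lerBrDr.
  by rewrite ler_pdivlMl // ltr_pdivrMl // ltrBlDr lerBrDr.
rewrite !lebesgue_rV_box // => [|i]; last first.
  by rewrite !mxE ler_pM2l ?invr_gt0 // lerB.
rewrite -EFinM; congr EFin.
rewrite (eq_bigr (fun i => K^-1 * (b ord0 i - a ord0 i))) => [|i _]; last first.
  by rewrite !mxE; ring.
rewrite big_split /= prodr_const card_ord mulrA exprVn divff ?mul1r //.
by rewrite gt_eqF.
Qed.

Lemma Rintegral_affine (K : R) (s : E) F D : 0 < K -> bdd_measurable F ->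
  measurable D -> (mu D < +oo)%E ->
  \int[mu]_(x in (fun x => K *: x + s) @^-1` D) F (K *: x + s) =
  (K ^+ d)^-1 * \int[mu]_(x in D) F x.
Proof.
move=> K0 bF mD Doo.
have mphi := measurable_affine K s.
have mpre A : measurable A -> measurable ((fun x => K *: x + s) @^-1` A).
  by move=> mA; rewrite -[X in measurable X]setTI; exact: mphi.
have Kd : 0 < (K ^+ d)^-1 by rewrite invr_gt0 exprn_gt0.
have preoo : (mu ((fun x => (K *: x + s)%R) @^-1` D) < +oo)%E.
  by rewrite measure_affine // lte_mul_pinfty // lee_fin ltW.
have bF' : bdd_measurable (fun x => F (K *: x + s)).
  case: bF => mF [B FB]; split; last by exists B.
  exact: (measurableT_comp mF mphi).
(* The image-measure formula is for nonnegative functions: it is applied to [F + B], and the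
   contribution of the constant [B], known from [measure_affine], is subtracted. *)
suff ge0E (G : E -> R) : (forall x, 0 <= G x) -> bdd_measurable G ->
    \int[mu]_(x in (fun x => K *: x + s) @^-1` D) G (K *: x + s) =
    (K ^+ d)^-1 * \int[mu]_(x in D) G x.
  have [mF [B FB]] := bF.
  have B0 x : 0 <= F x + B.
    by have := FB x; rewrite ler_norml -lerBlDr sub0r => /andP[].
  have bc : bdd_measurable (fun=> B).
    by split; [exact: measurable_cst|exists `|B|].
  have bG : bdd_measurable (fun x => F x + B).
    split; first by apply: measurable_funD => //.
    exists (B + `|B|) => x; apply: le_trans (ler_normD _ _) _.
    by rewrite lerD.
  have := ge0E _ B0 bG.
  rewrite RintegralD; [|exact: mpre|exact: integrable_bdd (mpre _ mD) preoo|
    exact: integrable_bdd bc (mpre _ mD) preoo].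
  rewrite RintegralD; [|by []|exact: integrable_bdd|exact: integrable_bdd].
  rewrite !Rintegral_cst //; last exact: mpre.
  have -> : fine ((mu : {measure set E -> \bar R})
      ((fun x => (K *: x + s)%R) @^-1` D)) = (K ^+ d)^-1 * fine (mu D).
    transitivity (fine ((K ^+ d)^-1%:E * mu D)%E).
      exact: (congr1 fine (measure_affine s K0 mD)).
    by rewrite fineM // ge0_fin_numE.
  by rewrite mulrDr /= [B * (_ * _)]mulrCA => /addIr.
move=> G0 bG; have [mG _] := bG.
have mEG : measurable_fun D (EFin \o G).
  by apply/measurable_EFinP; exact: measurable_funTS.
rewrite /Rintegral.
rewrite -(@ge0_integral_pushforward _ _ E E R _ mphi mu D (EFin \o G)) //; last first.
  by move=> y _; rewrite lee_fin.
rewrite [X in fine X = _](eq_measure_integral (mscale (NngNum (ltW Kd)) mu)) => [|A mA _]; last first.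
  exact: (measure_affine s K0 mA).
rewrite ge0_integral_mscale //= => [|x _]; last by rewrite lee_fin.
rewrite fineM //.
by apply: integrable_fin_num => //; exact: integrable_bdd.
Qed.

Lemma preimage_affine_cube (K : R) (s a : E) l : 0 < K ->
  (fun x => K *: x + s) @^-1` cube (K *: a + s) (K * l) = cube a l.
Proof.
move=> K0; apply/seteqP; split=> x /= xa i; have := xa i; rewrite !mxE.
  by rewrite ltrD2r ltr_pM2l // addrAC lerD2r -mulrDr ler_pM2l.
by rewrite ltrD2r ltr_pM2l // addrAC lerD2r -mulrDr ler_pM2l.
Qed.

Lemma Rintegral_cube_affine (K : R) (s a : E) l F : 0 < K -> 0 <= l ->
  bdd_measurable F ->
  \int[mu]_(x in cube a l) F (K *: x + s) =
  (K ^+ d)^-1 * \int[mu]_(x in cube (K *: a + s) (K * l)) F x.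
Proof.
move=> K0 l0 bF; rewrite -(preimage_affine_cube s a l K0) Rintegral_affine //.
  exact: measurable_cube.
by rewrite measure_cube ?ltry // mulr_ge0 // ltW.
Qed.

Definition grid (l : R) n (f : {ffun 'I_d -> 'I_n}) : E :=
  \row_i (l * (f i)%:R).

Lemma grid_cell (l t : R) n : 0 < t <= l * n%:R ->
  exists k : 'I_n, l * k%:R < t <= l * k%:R + l.
Proof.
elim: n => [|n IHn]; first by rewrite mulr0 => /andP[/lt_le_trans h /h]; rewrite ltxx.
move=> /andP[t0 tn]; have [tln|tln] := leP t (l * n%:R).
  have [|k ?] := IHn; first by rewrite t0.
  by exists (widen_ord (leqnSn n) k).
by exists ord_max; rewrite tln /=; move: tn; rewrite -natr1 mulrDr mulr1.
Qed.

Lemma cube_grid (a : E) l n :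
  cube a (l * n%:R) =
  \big[setU/set0]_(f : {ffun 'I_d -> 'I_n}) cube (a + grid l f) l.
Proof.
apply/seteqP; split=> [x xa|x].
  have /choice[f fP] : forall i : 'I_d, exists k : 'I_n,
      l * k%:R < x ord0 i - a ord0 i <= l * k%:R + l.
    move=> i; apply: grid_cell; have := xa i; rewrite !mxE.
    by rewrite subr_gt0 lerBlDl.
  rewrite -bigcup_seq /=.
  exists (finfun f); first by rewrite /= mem_index_enum.
  move=> i; rewrite !mxE ffunE; have := fP i.
  by rewrite ltrBrDl lerBlDl addrA.
rewrite -bigcup_seq /= => -[f _ xf] i.
have := xf i; rewrite !mxE => /andP[x1 x2].
(* A half-open cell that contains a point has positive side, which replaces a sign assumption on
   [l]. *)
have l0 : 0 < l by have := lt_le_trans x1 x2; rewrite ltrDl.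
have f0 : l * (f i)%:R + l <= l * n%:R.
  by rewrite -[X in _ + X]mulr1 -mulrDr ler_pM2l // natr1 ler_nat.
apply/andP; split.
  by apply: le_lt_trans x1; rewrite lerDl mulr_ge0 // ltW.
by apply: le_trans x2 _; rewrite -addrA lerD2l.
Qed.

Lemma trivIset_grid (a : E) l n D : 0 < l ->
  trivIset D (fun f : {ffun 'I_d -> 'I_n} => cube (a + grid l f) l).
Proof.
move=> l0; apply/trivIsetP => f g _ _ /eqP fg; apply/seteqP; split=> // x [xf xg].
apply: fg; apply/ffunP => i; apply/val_inj => /=.
have lt_fg (u v : 'I_n) : l * u%:R < l * v%:R + l -> (u <= v)%N.
  by rewrite -[X in _ + X]mulr1 -mulrDr ltr_pM2l // natr1 ltr_nat ltnS.
have := xf i; have := xg i; rewrite !mxE => /andP[g1 g2] /andP[f1 f2].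
apply/eqP; rewrite eqn_leq; apply/andP; split; apply: lt_fg.
  by rewrite -(ltrD2l (a ord0 i)) addrA; apply: lt_le_trans f1 g2.
by rewrite -(ltrD2l (a ord0 i)) addrA; apply: lt_le_trans g1 f2.
Qed.

Lemma Rintegral_grid F (a : E) l n : 0 < l -> bdd_measurable F ->
  \int[mu]_(x in cube a (l * n%:R)) F x =
  \sum_(f : {ffun 'I_d -> 'I_n}) \int[mu]_(x in cube (a + grid l f) l) F x.
Proof.
move=> l0 bF; rewrite /Rintegral cube_grid integral_bigsetU_EFin //=.
- rewrite sum_fine // => f _.
  apply: integrable_fin_num; first exact: measurable_cube.
  by apply: integrable_cube => //; exact: ltW.
- by move=> f; exact: measurable_cube.
- exact: index_enum_uniq.
- exact: trivIset_grid.
- by apply/measurable_EFinP; apply: measurable_funTS; case: bF.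
Qed.

Definition zvec (z : 'rV[int]_d) : E := map_mx intr z.

Definition zperiodic T (F : E -> T) := forall z x, F (x + zvec z) = F x.

Definition mean F := \int[mu]_(x in cube 0 1) F x.

Lemma Rintegral_cube_zvec F s z : bdd_measurable F -> zperiodic F ->
  \int[mu]_(x in cube (s + zvec z) 1) F x = \int[mu]_(x in cube s 1) F x.
Proof.
move=> bF pF; have := Rintegral_cube_affine (zvec z) s ltr01 ler01 bF.
rewrite scale1r mul1r expr1n invr1 mul1r => <-.
by apply: eq_Rintegral => x _; rewrite scale1r pF.
Qed.

Lemma Rintegral_cube_nat F s n : bdd_measurable F -> zperiodic F ->
  \int[mu]_(x in cube s n%:R) F x = n%:R ^+ d * \int[mu]_(x in cube s 1) F x.
Proof.
move=> bF pF; rewrite -[n%:R]mul1r Rintegral_grid //.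
rewrite (eq_bigr (fun=> \int[mu]_(x in cube s 1) F x)) => [|f _].
  by rewrite sumr_const card_ffun !card_ord mul1r -natrX mulr_natl.
rewrite (_ : grid 1 f = zvec (\row_i (f i : nat)%:Z)); last first.
  by apply/rowP => i; rewrite !mxE mul1r.
exact: Rintegral_cube_zvec.
Qed.

Lemma subset_cubeS s n : exists z, cube s n%:R `<=` cube (zvec z) n.+1%:R.
Proof.
exists (\row_i Num.floor (s ord0 i)) => x xs i; have := xs i; rewrite !mxE.
move=> /andP[x1 x2]; apply/andP; split.
  by apply: le_lt_trans x1; exact: floor_le.
apply: le_trans x2 _; rewrite -natr1 [leRHS]addrCA [leLHS]addrC lerD2l ltW //.
by have := floorD1_gt (s ord0 i); rewrite intrD.
Qed.

(** A cube of side [n] with arbitrary corner fits in one of side [n + 1] with integer corner.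
    Counting periods on both gives a factor [(1 + 1/n) ^ d], which tends to 1; no cutting and
    reassembling of the cube is involved. *)
Lemma le_Rintegral_cube F s : (forall x, 0 <= F x) -> bdd_measurable F ->
  zperiodic F -> \int[mu]_(x in cube s 1) F x <= mean F.
Proof.
move=> F0 bF pF; set I := \int[mu]_(x in _) _.
pose u (n : nat) := (1 + n.+1%:R^-1) ^+ d * mean F.
have u_cvg : u @ \oo --> (1 + 0) ^+ d * mean F.
  apply: cvgM; last exact: cvg_cst.
  have h : (fun n => 1 + n.+1%:R^-1 : R) @ \oo --> (1 + 0 : R).
    by apply: cvgD; [exact: cvg_cst|exact: cvg_harmonic].
  exact: (cvg_comp _ _ h (@exprn_continuous R d (1 + 0))).
have Iu n : I <= u n.
  have [z sz] := subset_cubeS s n.+1.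
  have n0 : 0 < n.+1%:R ^+ d :> R by rewrite exprn_gt0.
  rewrite -(ler_pM2l n0) -Rintegral_cube_nat // /u mulrA -exprMn.
  rewrite mulrDr mulr1 divff // natr1.
  have -> : mean F = \int[mu]_(x in cube (zvec z) 1) F x.
    by rewrite -(add0r (zvec z)) Rintegral_cube_zvec.
  rewrite -Rintegral_cube_nat //; apply: fine_le.
  - by apply: integrable_fin_num; [exact: measurable_cube|exact: integrable_cube].
  - by apply: integrable_fin_num; [exact: measurable_cube|exact: integrable_cube].
  - apply: ge0_subset_integral => //; [exact: measurable_cube|exact: measurable_cube| |].
      by apply/measurable_EFinP; apply: measurable_funTS; case: bF.
    by move=> x _; rewrite lee_fin.
rewrite -[leRHS]mul1r -[X in X * _](expr1n _ d) -{1}(addr0 (1 : R)).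
rewrite -(cvg_lim _ u_cvg) //; apply: limr_ge; first by apply/cvg_ex; eexists; exact: u_cvg.
by apply: nearW.
Qed.

Lemma bdd_measurable_cst c : bdd_measurable (fun=> c).
Proof. by split; [exact: measurable_cst|exists `|c|]. Qed.

Lemma bdd_measurable_indic (D : set E) : measurable D -> bdd_measurable (\1_D : E -> R).
Proof.
move=> mD; split; first exact: measurable_indic.
by exists 1 => x; rewrite indicE; case: (_ \in _); rewrite ?normr1 ?normr0.
Qed.

Lemma bdd_measurable_normr (F : E -> R) : bdd_measurable F ->
  bdd_measurable (fun x => `|F x|).
Proof.
move=> [mF [M FM]]; split; first exact: measurableT_comp.
by exists M => x; rewrite normr_id.
Qed.

Lemma bdd_measurableB F G : bdd_measurable F -> bdd_measurable G ->
  bdd_measurable (fun x => F x - G x).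
Proof.
move=> [mF [B FB]] [mG [C GC]]; split; first exact: measurable_funB.
by exists (B + C) => x; apply: le_trans (ler_normB _ _) _; exact: lerD.
Qed.

Lemma bdd_measurableD F G : bdd_measurable F -> bdd_measurable G ->
  bdd_measurable (fun x => F x + G x).
Proof.
move=> [mF [B FB]] [mG [C GC]]; split; first exact: measurable_funD.
by exists (B + C) => x; apply: le_trans (ler_normD _ _) _; exact: lerD.
Qed.

Lemma bdd_measurableM F G : bdd_measurable F -> bdd_measurable G ->
  bdd_measurable (fun x => F x * G x).
Proof.
move=> [mF [B FB]] [mG [C GC]]; split; first exact: measurable_funM.
exists (B * C) => x; rewrite normrM ler_pM //.
Qed.

Lemma Rintegral_cube_cst a (l c : R) : 0 <= l ->
  \int[mu]_(x in cube a l) c = c * l ^+ d.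
Proof.
move=> l0; rewrite Rintegral_cst; last exact: measurable_cube.
by congr (_ * _); rewrite [X in fine X](measure_cube a l0).
Qed.

(** The one-sided bound applied to [F + B] and to [B - F] gives both inequalities. *)
Lemma Rintegral_cube_periodic F s : bdd_measurable F -> zperiodic F ->
  \int[mu]_(x in cube s 1) F x = mean F.
Proof.
move=> bF pF; have [mF [B FB]] := bF.
have bc := bdd_measurable_cst B.
have le1 : \int[mu]_(x in cube s 1) (F x + B) <= mean (fun x => F x + B).
  apply: le_Rintegral_cube; [|exact: bdd_measurableD|by move=> z x; rewrite pF].
  by move=> x; have := FB x; rewrite ler_norml -lerBlDr sub0r => /andP[].
have le2 : \int[mu]_(x in cube s 1) (B - F x) <= mean (fun x => B - F x).
  apply: le_Rintegral_cube; [|exact: bdd_measurableB|by move=> z x; rewrite pF].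
  by move=> x; have := FB x; rewrite ler_norml subr_ge0 => /andP[].
have splitD a : \int[mu]_(x in cube a 1) (F x + B) =
    \int[mu]_(x in cube a 1) F x + B.
  rewrite RintegralD ?Rintegral_cube_cst ?expr1n ?mulr1 //;
    by [exact: measurable_cube|exact: integrable_cube].
have splitB a : \int[mu]_(x in cube a 1) (B - F x) =
    B - \int[mu]_(x in cube a 1) F x.
  rewrite RintegralB ?Rintegral_cube_cst ?expr1n ?mulr1 //;
    by [exact: measurable_cube|exact: integrable_cube].
move: le1 le2; rewrite /mean !splitD !splitB => h1 h2.
by apply/eqP; rewrite eq_le -(lerD2r B) h1 -(lerN2 (\int[mu]_(x in cube s 1) F x)) -(lerD2l B) h2.
Qed.

(** When [K * l] is an integer the rescaled function runs through whole periods on the cube, so its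
    average there is exactly the mean. *)
Lemma Rintegral_cube_scale F (K l : R) n a s : 0 < K -> K * l = n%:R ->
  bdd_measurable F -> zperiodic F ->
  \int[mu]_(x in cube a l) F (K *: x + s) = l ^+ d * mean F.
Proof.
move=> K0 Kl bF pF.
have l0 : 0 <= l by rewrite -(pmulr_rge0 _ K0) Kl.
rewrite (Rintegral_cube_affine s a K0 l0 bF) Kl Rintegral_cube_nat //.
rewrite Rintegral_cube_periodic // mulrA -Kl exprMn mulrA mulVf ?mul1r //.
by rewrite gt_eqF // exprn_gt0.
Qed.

Lemma mean_affine F n s : (0 < n)%N -> bdd_measurable F -> zperiodic F ->
  mean (fun x => F (n%:R *: x + s)) = mean F.
Proof.
move=> n0 bF pF; rewrite /mean (@Rintegral_cube_scale F n%:R 1 n) ?ltr0n ?mulr1 //.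
by rewrite expr1n mul1r.
Qed.

Lemma mean_translate F s : bdd_measurable F -> zperiodic F ->
  mean (fun x => F (x + s)) = mean F.
Proof.
move=> bF pF; rewrite -(mean_affine s (ltn0Sn 0) bF pF).
by congr mean; apply/funext => x; rewrite scale1r.
Qed.

End boxes.

(** * Trigonometric fields *)

Section modes.
Variables (R : realType) (d : nat).
Local Notation E := 'rV[R]_d.
Implicit Types (p q : 'rV[int]_d) (x s : E).

Definition dotz q x : R := \sum_i (q ord0 i)%:~R * x ord0 i.

(** The phase makes real cosines as convenient as complex exponentials: translations act on it
    alone, and a derivative also multiplies by a constant. *)
Definition mode q (c : R) x : R := cos (pi *+ 2 * dotz q x + c).

Lemma dotzDl p q x : dotz (p + q) x = dotz p x + dotz q x.
Proof.
rewrite /dotz -big_split /=; apply: eq_bigr => i _.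
by rewrite mxE intrD mulrDl.
Qed.

Lemma dotzNl q x : dotz (- q) x = - dotz q x.
Proof.
rewrite /dotz -sumrN; apply: eq_bigr => i _.
by rewrite mxE mulrNz mulNr.
Qed.

Lemma dotzMnl q n x : dotz (q *+ n) x = n%:R * dotz q x.
Proof.
rewrite /dotz mulr_sumr; apply: eq_bigr => i _.
by rewrite mulmxnE rmorphMn /= mulrnAl mulr_natl.
Qed.

Lemma dotz0l x : dotz 0 x = 0.
Proof. by rewrite /dotz big1 // => i _; rewrite mxE mul0r. Qed.

Lemma dotzDr q x s : dotz q (x + s) = dotz q x + dotz q s.
Proof.
rewrite /dotz -big_split /=; apply: eq_bigr => i _.
by rewrite mxE mulrDr.
Qed.

Lemma dotzZr q a x : dotz q (a *: x) = a * dotz q x.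
Proof.
rewrite /dotz mulr_sumr; apply: eq_bigr => i _.
by rewrite mxE mulrCA.
Qed.

Lemma dotz_zvec q (z : 'rV[int]_d) :
  dotz q (zvec R z) = (\sum_i q ord0 i * z ord0 i)%:~R.
Proof.
rewrite /dotz raddf_sum /=; apply: eq_bigr => i _.
by rewrite mxE intrM.
Qed.

Lemma cosDz (a : R) (z : int) : cos (a + pi *+ 2 * z%:~R) = cos a.
Proof.
have cosDn (b : R) n : cos (b + pi *+ 2 * n%:R) = cos b.
  elim: n => [|n IHn]; first by rewrite mulr0 addr0.
  by rewrite -natr1 mulrDr mulr1 addrA cosD2pi.
case: z => n; first exact: cosDn.
by rewrite NegzE mulrNz -(cosDn _ n.+1) mulrN addrNK.
Qed.

Lemma mode_zperiodic q c : zperiodic (mode q c).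
Proof.
move=> z x; rewrite /mode dotzDr dotz_zvec mulrDr addrAC.
exact: cosDz.
Qed.

Lemma mode_affine q c n x s :
  mode q c (n%:R *: x + s) = mode (q *+ n) (c + pi *+ 2 * dotz q s) x.
Proof.
rewrite /mode; congr cos; rewrite dotzDr dotzZr dotzMnl; ring.
Qed.

Lemma modeM p q a b x : mode p a x * mode q b x =
  2^-1 * (mode (q + p) (b + a) x + mode (q - p) (b - a) x).
Proof.
rewrite /mode !dotzDl dotzNl.
set u := pi *+ 2 * dotz p x; set v := pi *+ 2 * dotz q x.
have -> : pi *+ 2 * (dotz q x + dotz p x) + (b + a) = (v + b) + (u + a).
  by rewrite /u /v; ring.
have -> : pi *+ 2 * (dotz q x - dotz p x) + (b - a) = (v + b) - (u + a).
  by rewrite /u /v; ring.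
move: (v + b) (u + a) => A B.
by rewrite cosD cosB; field.
Qed.

Lemma normr_mode q c x : `|mode q c x| <= 1.
Proof. exact: cos_max. Qed.

Lemma is_derive_along (V W : normedModType R) (f : V -> W) (x v : V) (df : W) :
  is_derive (0 : R) 1 (fun h => f (h *: v + x)) df -> is_derive x v f df.
Proof.
move=> [fd1 fd2]; have fd := (derivable1P f x v).2 fd1.
apply: DeriveDef => //.
rewrite -fd2 /derive.
suff -> : (fun h : R => h^-1 *: ((f \o shift x) (h *: v) - f x)) =
    (fun h : R => h^-1 *: (((fun h => f (h *: v + x)) \o shift 0) (h *: (1 : R^o)) -
       f ((0 : R) *: v + x))) by [].
by apply/funext => h /=; rewrite scale0r add0r addr0 [h *: (1 : R^o)]mulr1.
Qed.

Lemma is_derive_mode q c x v : is_derive x v (mode q c)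
  (pi *+ 2 * dotz q v * mode q (c + pi / 2) x).
Proof.
apply: is_derive_along.
have -> : (fun h : R => mode q c (h *: v + x)) =
    cos \o (fun h => h * (pi *+ 2 * dotz q v) + (pi *+ 2 * dotz q x + c)).
  by apply/funext => h /=; rewrite /mode dotzDr dotzZr; congr cos; ring.
have -> : pi *+ 2 * dotz q v * mode q (c + pi / 2) x =
    - sin (0 * (pi *+ 2 * dotz q v) + (pi *+ 2 * dotz q x + c)) *
    (pi *+ 2 * dotz q v).
  by rewrite /mode addrA cosDpihalf mul0r add0r; ring.
apply: is_derive1_comp.
apply: is_derive_eq.
by rewrite addr0 scaler0 add0r [LHS]mulr1.
Qed.

Lemma is_derive_scale_cst (V W : normedModType R) (f : V -> R) (b : W) (x v : V) (df : R) :
  is_derive x v f df -> is_derive x v (fun y => f y *: b) (df *: b).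
Proof.
move=> [fd <-].
have h : (fun h : R => h^-1 *: (((fun y => f y *: b) \o shift x) (h *: v) - f x *: b))
    @ 0^' --> 'D_v f x *: b.
  have -> : (fun h : R => h^-1 *: (((fun y => f y *: b) \o shift x) (h *: v) - f x *: b)) =
      (fun h => (h^-1 *: ((f \o shift x) (h *: v) - f x)) *: b).
    by apply/funext => h /=; rewrite -scalerBl scalerA.
  by apply: cvgZl; exact: fd.
apply: DeriveDef; first by apply/cvg_ex; eexists; exact: h.
exact: cvg_lim h.
Qed.

Lemma continuous_mode q c : continuous (mode q c).
Proof.
move=> x.
have hi i : continuous (fun z : E => (q ord0 i)%:~R * z ord0 i : R).
  move=> y; apply: (@continuousM R E (fun=> (q ord0 i)%:~R) (fun z => z ord0 i)).
    exact: cst_continuous.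
  exact: coord_continuous.
have hd : continuous (fun y : E => dotz q y).
  apply: continuous_big => [|i _]; last exact: hi.
  exact: pseudometric_normed_Zmodule.add_continuous.
apply: (@continuous_comp _ _ _ (fun x => pi *+ 2 * dotz q x + c) cos); last first.
  exact: continuous_cos.
apply: (@continuousD R R^o E (fun x => pi *+ 2 * dotz q x) (fun=> c)); last first.
  exact: cst_continuous.
apply: (@continuousM R E (fun=> pi *+ 2) (dotz q)); last exact: hd.
exact: cst_continuous.
Qed.

End modes.

Section teval.
Variables (R : realType) (d : nat) (V : lmodType R).
Local Notation E := 'rV[R]_d.

(** Triples of frequency, phase and amplitude. Conditions on the spectrum become conditions on the
    members of the list. *)
Definition trig := seq ('rV[int]_d * R * V)%type.

Definition teval (s : trig) (x : E) : V :=
  \sum_(m <- s) mode m.1.1 m.1.2 x *: m.2.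

Lemma teval_cat s t x : teval (s ++ t) x = teval s x + teval t x.
Proof. by rewrite /teval big_cat. Qed.

Lemma teval_cons m s x : teval (m :: s) x = mode m.1.1 m.1.2 x *: m.2 + teval s x.
Proof. by rewrite /teval big_cons. Qed.

Lemma teval_nil x : teval [::] x = 0.
Proof. by rewrite /teval big_nil. Qed.

Definition tscale (a : R) (s : trig) : trig := [seq (m.1, a *: m.2) | m <- s].

Lemma teval_scale a s x : teval (tscale a s) x = a *: teval s x.
Proof.
rewrite /teval /tscale big_map scaler_sumr; apply: eq_bigr => m _ /=.
by rewrite !scalerA mulrC.
Qed.

Definition taffine (n : nat) (y : E) (s : trig) : trig :=
  [seq (m.1.1 *+ n, m.1.2 + pi *+ 2 * dotz m.1.1 y, m.2) | m <- s].

Lemma teval_affine n y s x : teval (taffine n y s) x = teval s (n%:R *: x + y).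
Proof.
rewrite /teval /taffine big_map; apply: eq_bigr => m _ /=.
by rewrite mode_affine.
Qed.

Lemma teval_zperiodic s : zperiodic (teval s).
Proof. by move=> z x; apply: eq_bigr => m _; rewrite mode_zperiodic. Qed.

End teval.

Section trig_field.
Variables (R : realType) (d : nat) (W : vectType R).
Local Notation E := 'rV[R]_d.
Implicit Types s : trig d W.

Lemma continuous_teval s : continuous (v2r \o teval s).
Proof.
elim: s => [|m s IHs].
  rewrite (_ : v2r \o _ = fun=> 0); last first.
    by apply/funext => x /=; rewrite teval_nil linear0.
  exact: cst_continuous.
have -> : v2r \o teval (m :: s) =
    (fun x => mode m.1.1 m.1.2 x *: v2r m.2 + (v2r \o teval s) x).
  by apply/funext => x /=; rewrite teval_cons linearD linearZ.
move=> x; apply: (@continuousD R _ E (fun x => mode m.1.1 m.1.2 x *: v2r m.2)).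
  apply: (@continuousZr_tmp R _ E (mode m.1.1 m.1.2) (v2r m.2)).
  exact: continuous_mode.
exact: IHs.
Qed.

(** The shift by [pi / 2] comes from [- sin t = cos (t + pi / 2)]. *)
Definition tpartial (i : 'I_d) s : trig d W :=
  [seq (m.1.1, m.1.2 + pi / 2, (pi *+ 2 * ((m.1.1 : 'rV[int]_d) ord0 i)%:~R) *: m.2) | m <- s].

Lemma dotz_basis q (i : 'I_d) : dotz q (basis_rV R i) = (q ord0 i)%:~R.
Proof.
rewrite /dotz (bigD1 i) //= mxE !eqxx mulr1 big1 ?addr0 // => j ji.
by rewrite mxE (negbTE ji) andbF mulr0.
Qed.

Lemma is_derive_teval i s x :
  is_derive x (basis_rV R i) (v2r \o teval s) (v2r (teval (tpartial i s) x)).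
Proof.
elim: s => [|m s IHs].
  rewrite (_ : v2r \o _ = fun=> 0); last first.
    by apply/funext => y /=; rewrite teval_nil linear0.
  by rewrite /= teval_nil linear0; exact: is_derive_cst.
have -> : v2r \o teval (m :: s) =
    (fun x => mode m.1.1 m.1.2 x *: v2r m.2) + (v2r \o teval s).
  by apply/funext => y /=; rewrite teval_cons linearD linearZ.
rewrite /= teval_cons linearD linearZ /= linearZ scalerA.
apply: is_deriveD; rewrite mulrC -dotz_basis.
by apply: is_derive_scale_cst; exact: is_derive_mode.
Qed.

Lemma partial_teval i s : partial i (teval s) = teval (tpartial i s).
Proof.
apply/funext => x; rewrite /partial.
by have [_ ->] := is_derive_teval i s x; rewrite v2rK.
Qed.

Lemma smooth_teval U s : smooth_on U (teval s).
Proof.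
move=> n; elim: n s => [|n IHn] s /=; split => //.
- by move=> x _; exact: continuous_teval.
- by move=> x _; exact: continuous_teval.
move=> i; split; last by rewrite partial_teval.
by move=> x _; have [] := is_derive_teval i s x.
Qed.

(** A Fourier multiplier with constant phase shift; this shape is stable under composition, which
    lets iterated derivatives be handled by induction. *)
Definition tmul (e : R) (t : 'rV[int]_d -> R) s : trig d W :=
  [seq (m.1.1, m.1.2 + e, t m.1.1 *: m.2) | m <- s].

Lemma iter_partial_teval i n s : iter n (partial i) (teval s) =
  teval (tmul (n%:R * (pi / 2)) (fun q => (pi *+ 2 * (q ord0 i)%:~R) ^+ n) s).
Proof.
elim: n => [|n IHn] /=.
  congr teval; rewrite /tmul -[LHS]map_id; apply: eq_map => -[[q c] a] /=.
  by rewrite mul0r addr0 expr0 scale1r.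
rewrite IHn partial_teval; congr teval; rewrite /tpartial /tmul -map_comp.
apply: eq_map => -[[q c] a] /=.
by rewrite scalerA -exprS -[n.+1%:R]natr1 [(_ + 1) * _]mulrDl mul1r addrA.
Qed.

Lemma mpartial_teval (alpha : 'I_d -> nat) s : mpartial alpha (teval s) =
  teval (tmul ((\sum_i alpha i)%:R * (pi / 2))
    (fun q => \prod_i (pi *+ 2 * (q ord0 i)%:~R) ^+ alpha i) s).
Proof.
rewrite /mpartial.
have -> : (\sum_i alpha i = \sum_(i <- enum 'I_d) alpha i)%N.
  by rewrite big_enum.
have -> : (fun q : 'rV[int]_d => \prod_i (pi *+ 2 * (q ord0 i)%:~R) ^+ alpha i) =
    (fun q => \prod_(i <- enum 'I_d) (pi *+ 2 * (q ord0 i)%:~R) ^+ alpha i) :> (_ -> R).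
  by apply/funext => q; rewrite big_enum.
elim: (enum 'I_d) => [|i r IHr] /=.
  congr teval; rewrite /tmul -[LHS]map_id; apply: eq_map => -[[q c] a] /=.
  by rewrite !big_nil mul0r addr0 scale1r.
rewrite IHr iter_partial_teval; congr teval; rewrite /tmul -map_comp.
apply: eq_map => -[[q c] a] /=.
rewrite !big_cons scalerA natrD [(_ + _) * (pi / 2)]mulrDl; congr (_, _, _).
by rewrite -addrA [_ * _ + _]addrC.
Qed.

Variables (k : nat) (X : vectType R) (A : multiindex d k -> 'Hom(W, X)).

(** All multi-indices have length [k], hence produce the same phase shift [k * (pi / 2)] and the
    same factor [(2 pi) ^ k]; what remains on each mode is the symbol applied to its amplitude. *)
Lemma diff_op_teval s x : {in s, forall m, m.2 \in lker (symbol A (zvec R m.1.1))} ->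
  diff_op A (teval s) x = 0.
Proof.
move=> sA; rewrite /diff_op.
transitivity (\sum_(m <- s) (mode m.1.1 (m.1.2 + k%:R * (pi / 2)) x * (pi *+ 2) ^+ k) *:
    symbol A (zvec R m.1.1) m.2); last first.
  rewrite big_seq big1 // => m ms.
  by have := sA m ms; rewrite memv_ker => /eqP ->; rewrite scaler0.
under [RHS]eq_bigr do rewrite /symbol sum_lfunE scaler_sumr.
rewrite exchange_big /=; apply: eq_bigr => alpha /eqP lenk.
rewrite mpartial_teval /teval /tmul big_map linear_sum; apply: eq_bigr => m _ /=.
rewrite scale_lfunE !linearZ /= !scalerA -/(mi_length alpha) lenk.
congr (_ *: _); rewrite mulrC [RHS]mulrC -mulrA [LHS]mulrC; congr (_ * _).
rewrite (eq_bigr (fun i => (pi *+ 2) ^+ alpha i * ((m.1.1 ord0 i)%:~R ^+ alpha i))); last first.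
  by move=> i _; rewrite exprMn.
rewrite big_split /= -expr_sum -/(mi_length alpha) lenk; congr (_ * _).
by apply: eq_bigr => i _; rewrite mxE.
Qed.

End trig_field.

(** * The norm, the distance to a subspace, and kernels of the symbol *)

Section dnorm.
Variables (R : realType) (W : vectType R) (dotW : {dot W for idfun}).
Local Notation dn := (dnorm dotW).
Implicit Types (u v w : W).

Lemma dotC u v : dotW u v = dotW v u.
Proof. by rewrite (@hermitian_subproof _ _ _ _ dotW) expr0 mul1r. Qed.

Lemma dotZr a u v : dotW u (a *: v) = a * dotW u v.
Proof. by rewrite linearZr_LR. Qed.

Lemma dotZl a u v : dotW (a *: u) v = a * dotW u v.
Proof. by rewrite dotC dotZr dotC. Qed.

Lemma dotDr u v w : dotW u (v + w) = dotW u v + dotW u w.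
Proof. by rewrite linearDr. Qed.

Lemma dotDl u v w : dotW (u + v) w = dotW u w + dotW v w.
Proof. by rewrite dotC dotDr !(dotC w). Qed.

Lemma dot_gt0 u : u != 0 -> 0 < dotW u u.
Proof. exact: neq0_dnorm_gt0. Qed.

Lemma dot0r u : dotW u 0 = 0.
Proof. by rewrite -(scale0r 0) dotZr mul0r. Qed.

Lemma dot_ge0 u : 0 <= dotW u u.
Proof. by have [->|/dot_gt0/ltW //] := eqVneq u 0; rewrite dot0r. Qed.

Lemma dnorm_ge0 u : 0 <= dn u.
Proof. exact: sqrtr_ge0. Qed.

Lemma sqr_dnorm u : dn u ^+ 2 = dotW u u.
Proof. by rewrite sqr_sqrtr // dot_ge0. Qed.

Lemma dnorm_gt0 u : u != 0 -> 0 < dn u.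
Proof. by move=> u0; rewrite sqrtr_gt0 dot_gt0. Qed.

Lemma dnormZ a u : dn (a *: u) = `|a| * dn u.
Proof.
by rewrite /dnorm dotZl dotZr mulrA -expr2 sqrtrM ?sqr_ge0 // sqrtr_sqr.
Qed.

Lemma dnorm0 : dn 0 = 0.
Proof. by rewrite -(scale0r 0) dnormZ normr0 mul0r. Qed.

Lemma dnormN u : dn (- u) = dn u.
Proof. by rewrite -scaleN1r dnormZ normrN1 mul1r. Qed.

Lemma dnorm_sym u v : dn (u - v) = dn (v - u).
Proof. by rewrite -dnormN opprB. Qed.

Lemma dot_le_dnorm u v : dotW u v <= dn u * dn v.
Proof.
have [->|u0] := eqVneq u 0; first by rewrite dotC dot0r dnorm0 mul0r.
have [->|v0] := eqVneq v 0; first by rewrite dot0r dnorm0 mulr0.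
have a0 := dnorm_gt0 u0; have b0 := dnorm_gt0 v0.
(* With [a = dn u], [b = dn v], [c = dotW u v] this square equals [2 a b (a b - c)]. *)
have := dot_ge0 (dn v *: u - dn u *: v).
rewrite -scaleN1r !(dotDl, dotDr, dotZl, dotZr) (dotC v u) -!sqr_dnorm.
set a := dn u; set b := dn v; set c := dotW u v => h.
have : 0 <= (a * b) * (2 * (a * b - c)).
  by apply: le_trans h _; rewrite le_eqVlt; apply/orP; left; apply/eqP; ring.
by rewrite pmulr_rge0 ?mulr_gt0 // pmulr_rge0 // subr_ge0.
Qed.

Lemma normr_dot_le u v : `|dotW u v| <= dn u * dn v.
Proof.
rewrite ler_norml dot_le_dnorm andbT lerNl -(dnormN u).
by apply: le_trans (dot_le_dnorm _ _); rewrite -[- u]scaleN1r dotZl mulN1r.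
Qed.

Lemma dnormD u v : dn (u + v) <= dn u + dn v.
Proof.
rewrite -(@ler_pXn2r _ 2) ?nnegrE ?addr_ge0 ?dnorm_ge0 //.
rewrite sqr_dnorm !(dotDl, dotDr) (dotC v u) -!sqr_dnorm.
by have := dot_le_dnorm u v; nra.
Qed.

Lemma dnorm_sum (I : Type) (r : seq I) (F : I -> W) :
  dn (\sum_(i <- r) F i) <= \sum_(i <- r) dn (F i).
Proof.
elim: r => [|i r IHr]; first by rewrite !big_nil dnorm0.
by rewrite !big_cons; apply: le_trans (dnormD _ _) _; rewrite lerD2l.
Qed.

Lemma dnorm_le_coord v : dn v <=
  \sum_i `|v2r v ord0 i| * dn (r2v (delta_mx ord0 i) : W).
Proof.
have vE : v = \sum_i v2r v ord0 i *: (r2v (delta_mx ord0 i) : W).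
  rewrite -[LHS]v2rK [X in r2v X = _]row_sum_delta linear_sum.
  by apply: eq_bigr => i _; rewrite linearZ.
rewrite [X in dn X <= _]vE; apply: le_trans (dnorm_sum _ _) _.
by apply: ler_sum => i _; rewrite dnormZ.
Qed.

Definition dconst := \sum_i dn (r2v (delta_mx ord0 i) : W).

Lemma dconst_ge0 : 0 <= dconst.
Proof. by apply: sumr_ge0 => i _; exact: dnorm_ge0. Qed.

Lemma dnorm_le_v2r v : dn v <= dconst * `|v2r v|.
Proof.
apply: le_trans (dnorm_le_coord v) _; rewrite /dconst mulr_suml.
apply: ler_sum => i _; rewrite mulrC ler_wpM2l ?dnorm_ge0 //.
exact: le_coord_norm.
Qed.

(** A global Lipschitz bound makes the composition with a bounded measurable field bounded and
    measurable, and controls the effect of small corrections of the field. *)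
Definition lip (F : W -> R) := exists2 C, 0 <= C & forall u v, `|F u - F v| <= C * dn (u - v).

Lemma lip_dnorm : lip dn.
Proof.
exists 1 => // u v; rewrite mul1r ler_norml lerNl opprB; apply/andP; split.
  by rewrite lerBlDr dnorm_sym -{1}(subrK u v) dnormD.
by rewrite lerBlDr -{1}(subrK v u) dnormD.
Qed.

Lemma lip_shift F y : lip F -> lip (fun v => F (y + v)).
Proof.
move=> [C C0 FC]; exists C => // u v; apply: le_trans (FC _ _) _.
by rewrite opprD addrACA subrr add0r.
Qed.

Lemma lipD F G : lip F -> lip G -> lip (fun v => F v + G v).
Proof.
move=> [C C0 FC] [D D0 GD]; exists (C + D) => [|u v]; first exact: addr_ge0.
rewrite opprD addrACA mulrDl; apply: le_trans (ler_normD _ _) _; exact: lerD.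
Qed.

Lemma lipZ a F : lip F -> lip (fun v => a * F v).
Proof.
move=> [C C0 FC]; exists (`|a| * C) => [|u v]; first exact: mulr_ge0.
by rewrite -mulrBr normrM -mulrA ler_wpM2l.
Qed.

Lemma lip_min F l : lip F -> lip (fun v => Num.min (F v) l).
Proof.
move=> [C C0 FC]; exists C => // u v; apply: le_trans (FC u v).
have := ler_norm (F u - F v); have := ler_norm (F v - F u); rewrite distrC.
by rewrite ler_norml /Num.min; do 2 case: ltP => ?; move=> ? ?; apply/andP; split; lra.
Qed.

End dnorm.

Section dist_to.
Variables (R : realType) (W : vectType R) (dotW : {dot W for idfun}).
Variable L : {vspace W}.
Local Notation dn := (dnorm dotW).
Local Notation dist := (dist_to dotW L).

Lemma dist_has_inf v : has_inf [set dn (v - u) | u in [set` L]].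
Proof.
split; first by exists (dn (v - 0)), 0 => //=; rewrite mem0v.
by exists 0 => _ [u _ <-]; exact: dnorm_ge0.
Qed.

Lemma dist_le v u : u \in L -> dist v <= dn (v - u).
Proof. by move=> uL; apply: ge_inf; [have [] := dist_has_inf v|exists u]. Qed.

Lemma dist_ge v c : (forall u, u \in L -> c <= dn (v - u)) -> c <= dist v.
Proof.
move=> h; apply: lb_le_inf; first by have [] := dist_has_inf v.
by move=> _ [u uL <-]; exact: h.
Qed.

Lemma dist_ge0 v : 0 <= dist v.
Proof. by apply: dist_ge => u _; exact: dnorm_ge0. Qed.

Lemma dist_eq0 v : v \in L -> dist v = 0.
Proof.
move=> vL; apply/eqP; rewrite eq_le dist_ge0 andbT.
by rewrite -(dnorm0 dotW) -(subrr v) dist_le.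
Qed.

(** This half gives equality when it is applied again with the factor [a^-1]. *)
Lemma distZ_le a v : 0 < a -> dist (a *: v) <= a * dist v.
Proof.
move=> a0; rewrite -ler_pdivrMl //; apply: dist_ge => u uL.
rewrite ler_pdivrMl //.
have -> : a * dn (v - u) = dn (a *: (v - u)) by rewrite dnormZ gtr0_norm.
rewrite scalerBr.
by apply: dist_le; rewrite rpredZ.
Qed.

Lemma distZ a v : 0 < a -> dist (a *: v) = a * dist v.
Proof.
move=> a0; apply/eqP; rewrite eq_le distZ_le //=.
rewrite -ler_pdivlMl // -{1}[v](scalerK (lt0r_neq0 a0)).
by rewrite distZ_le // invr_gt0.
Qed.

Lemma lip_dist : lip dotW dist.
Proof.
have h u v : dist u - dist v <= dn (u - v).
  rewrite lerBlDl -lerBlDr; apply: dist_ge => w wL; rewrite lerBlDr.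
  apply: le_trans (dist_le _ wL) _.
  by rewrite -{1}(subrK v u) -addrA addrC dnormD.
exists 1 => // u v; rewrite mul1r ler_norml lerNl opprB h andbT.
by rewrite dnorm_sym h.
Qed.

End dist_to.

(** * Continuity of the kernels of the symbol *)

Section kernel_continuity.
Variables (R : realType) (d : nat).
Local Notation E := 'rV[R]_d.

Definition mx_continuous a b (G : E -> 'M[R]_(a, b)) :=
  forall i j, continuous (fun x => G x i j : R).

Lemma continuous_sumR (I : Type) (r : seq I) (P : pred I) (F : I -> E -> R) :
  (forall i, P i -> continuous (F i)) -> continuous (fun x => \sum_(i <- r | P i) F i x).
Proof.
move=> FC; apply: continuous_big; last exact: FC.
exact: pseudometric_normed_Zmodule.add_continuous.
Qed.

Lemma continuous_mulR (F G : E -> R) : continuous F -> continuous G ->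
  continuous (fun x => F x * G x).
Proof. by move=> FC GC x; exact: (continuousM (FC x) (GC x)). Qed.

Lemma continuous_addR (F G : E -> R) : continuous F -> continuous G ->
  continuous (fun x => F x + G x).
Proof. by move=> FC GC x; exact: (@continuousD R R^o E F G x (FC x) (GC x)). Qed.

Lemma continuous_oppR (F : E -> R) : continuous F -> continuous (fun x => - F x).
Proof. by move=> FC x; exact: (@continuousN R R^o E F x (FC x)). Qed.

Lemma continuous_cstR (c : R) : continuous (fun _ : E => c).
Proof. exact: cst_continuous. Qed.

Lemma continuous_prodR (I : Type) (r : seq I) (P : pred I) (F : I -> E -> R) :
  (forall i, P i -> continuous (F i)) -> continuous (fun x => \prod_(i <- r | P i) F i x).
Proof.
move=> FC; apply: continuous_big; last exact: FC.
exact: (@mul_continuous R).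
Qed.

Lemma mx_continuous_cst a b (M : 'M[R]_(a, b)) : mx_continuous (fun=> M).
Proof. by move=> i j; exact: continuous_cstR. Qed.

Lemma mx_continuousM a b c (F : E -> 'M[R]_(a, b)) (G : E -> 'M[R]_(b, c)) :
  mx_continuous F -> mx_continuous G -> mx_continuous (fun x => F x *m G x).
Proof.
move=> FC GC i j; under eq_fun do rewrite mxE.
by apply: continuous_sumR => l _; exact: continuous_mulR.
Qed.

Lemma continuous_det n (F : E -> 'M[R]_n) : mx_continuous F ->
  continuous (fun x => \det (F x)).
Proof.
move=> FC; rewrite /determinant; apply: continuous_sumR => s _.
apply: continuous_mulR; first exact: continuous_cstR.
by apply: continuous_prodR => i _; exact: FC.
Qed.

Lemma mx_continuous_adj n (F : E -> 'M[R]_n) : mx_continuous F ->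
  mx_continuous (fun x => \adj (F x)).
Proof.
move=> FC i j; under eq_fun do rewrite mxE /cofactor.
apply: continuous_mulR; first exact: continuous_cstR.
apply: continuous_det => u v; under eq_fun do rewrite !mxE.
exact: FC.
Qed.

Variables (k : nat) (W X : vectType R) (A : multiindex d k -> 'Hom(W, X)).
Variable dotW : {dot W for idfun}.

Lemma v2r_lfun (f : 'Hom(W, X)) u : v2r (f u) = v2r u *m f2mx f.
Proof. by rewrite [in LHS]unlock /= r2vK. Qed.

Lemma dim_limg (f : 'Hom(W, X)) : \dim (limg f) = \rank (f2mx f).
Proof.
rewrite unlock /dimv /= mxrank_gen.
by rewrite (eqmxMfull _ _) // /row_full mxrank_gen mxrank1.
Qed.

Lemma mx_continuous_symbol : mx_continuous (fun xi => f2mx (symbol A xi)).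
Proof.
move=> i j.
have -> : (fun xi => f2mx (symbol A xi) i j) =
    (fun xi : E => \sum_(alpha | mi_length alpha == k)
       (\prod_(l < d) xi ord0 l ^+ alpha l) * f2mx (A alpha) i j).
  apply/funext => xi.
  have -> : f2mx (symbol A xi) i j =
      v2r (symbol A xi (r2v (delta_mx ord0 i))) ord0 j.
    by rewrite v2r_lfun r2vK -rowE mxE.
  rewrite /symbol sum_lfunE linear_sum summxE; apply: eq_bigr => alpha _.
  by rewrite scale_lfunE linearZ mxE /= v2r_lfun r2vK -rowE mxE.
apply: continuous_sumR => alpha _.
apply: continuous_mulR; last exact: continuous_cstR.
apply: continuous_prodR => l _.
have -> : (fun x : E => x ord0 l ^+ alpha l) = (fun x => \prod_(t < alpha l) (fun=> x ord0 l) t).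
  by apply/funext => x; rewrite prodr_const card_ord.
by apply: continuous_prodR => _ _; exact: coord_continuous.
Qed.

(* Near [xi0] a constant-rank family has the same [r]-minor invertible, and
   Cramer's rule moves a kernel vector of the symbol at [xi0] continuously. *)
Lemma ker_symbol_near (xi0 : E) (e : W) (eps : R) : constant_rank A -> xi0 != 0 ->
  e \in lker (symbol A xi0) -> 0 < eps ->
  \forall xi \near xi0, xi != 0 ->
    exists2 e', e' \in lker (symbol A xi) & dnorm dotW (e' - e) <= eps.
Proof.
move=> [r _ rk] xi00; rewrite memv_ker => /eqP e0 eps0.
pose M xi := f2mx (symbol A xi).
have rkM xi : xi != 0 -> \rank (M xi) = r by move=> /rk; rewrite dim_limg.
have MC : mx_continuous M by exact: mx_continuous_symbol.
pose v := v2r e.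
have vM0 : v *m M xi0 = 0 by rewrite -v2r_lfun e0 linear0.
(* [C] and [P] come from the rank factorization of [M xi0]; they cut out an [r] by [r] block [N xi]
   which is the identity at [xi0], hence invertible nearby. *)
pose C : 'M[R]_(r, dim W) := pid_mx r *m invmx (col_ebase (M xi0)).
pose P : 'M[R]_(dim X, r) := invmx (row_ebase (M xi0)) *m pid_mx r.
have r_leW : (r <= dim W)%N by rewrite -(rkM _ xi00) rank_leq_row.
have r_leX : (r <= dim X)%N by rewrite -(rkM _ xi00) rank_leq_col.
pose N xi := C *m M xi *m P.
have N0 : N xi0 = 1%:M.
  rewrite /N /C /P -{2}(mulmx_ebase (M xi0)) rkM // !mulmxA.
  rewrite mulmxKV ?col_ebase_unit // mulmxK ?row_ebase_unit //.
  by rewrite !pid_mx_id // pid_mx_1.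
have NC : mx_continuous N.
  by apply: mx_continuousM; last exact: mx_continuous_cst;
     apply: mx_continuousM => //; exact: mx_continuous_cst.
(* The adjugate in place of the inverse keeps [v'] continuous everywhere. Since [N = C M P],
   multiplying by [M P] gives [det N] times [v M P] minus itself. *)
pose v' xi := \det (N xi) *: v - v *m M xi *m P *m \adj (N xi) *m C.
have v'C i : continuous (fun xi => v' xi ord0 i).
  rewrite /v'; under eq_fun do rewrite !mxE.
  apply: continuous_addR.
    apply: continuous_mulR; last exact: continuous_cstR.
    exact: continuous_det.
  apply: continuous_oppR.
  have : mx_continuous (fun xi => v *m M xi *m P *m \adj (N xi) *m C).
    apply: mx_continuousM; last exact: mx_continuous_cst.
    apply: mx_continuousM; last exact: mx_continuous_adj.
    apply: mx_continuousM; last exact: mx_continuous_cst.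
    by apply: mx_continuousM => //; exact: mx_continuous_cst.
  move=> /(_ ord0 i); under eq_fun do rewrite mxE.
  exact.
have v'0 : v' xi0 = v by rewrite /v' N0 det1 vM0 !mul0mx subr0 scale1r.
pose err xi := \sum_i `|v' xi ord0 i - v ord0 i| * dnorm dotW (r2v (delta_mx ord0 i)).
have errC : continuous err.
  apply: continuous_sumR => i _.
  apply: continuous_mulR; last exact: continuous_cstR.
  move=> x; apply: (@continuous_comp _ _ _ (fun x => v' x ord0 i - v ord0 i) Num.norm).
    apply: continuous_addR; first exact: v'C.
    exact: continuous_cstR.
  exact: norm_continuous.
have err0 : err xi0 = 0.
  by rewrite /err big1 // => i _; rewrite v'0 subrr normr0 mul0r.
have det0 : \det (N xi0) = 1 by rewrite N0 det1.
have near_err : \forall xi \near xi0, err xi < eps.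
  have := errC xi0; rewrite /continuous_at err0 => /cvgr_lt; exact.
have near_det : \forall xi \near xi0, 0 < \det (N xi).
  have detC : continuous (fun xi => \det (N xi)) by exact: continuous_det.
  have := detC xi0; rewrite /continuous_at det0 => /cvgr_gt; apply.
  exact: ltr01.
near=> xi => xin0.
exists (r2v (v' xi)); last first.
  apply: le_trans (dnorm_le_coord _ _) _; apply: ltW.
  apply: le_lt_trans (_ : err xi < _); last by near: xi.
  rewrite le_eqVlt; apply/orP; left; apply/eqP; apply: eq_bigr => i _.
  by rewrite linearB /= r2vK !mxE.
rewrite memv_ker -(inj_eq (can_inj v2rK)) linear0 v2r_lfun r2vK -/(M xi).
have v'MP : v' xi *m (M xi *m P) = 0.
  rewrite /v' mulmxBl -scalemxAl.
  have -> : v *m M xi *m P *m \adj (N xi) *m C *m (M xi *m P) =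
      v *m M xi *m P *m (\adj (N xi) *m N xi) by rewrite /N !mulmxA.
  by rewrite mul_adj_mx mul_mx_scalar mulmxA subrr.
have Nunit : N xi \in unitmx.
  by rewrite unitmxE unitfE gt_eqF //; near: xi.
have rkMP : \rank (M xi *m P) = r.
  apply/eqP; rewrite eqn_leq; apply/andP; split.
    by apply: leq_trans (mxrankM_maxl _ _) _; rewrite rkM.
  have := mxrank_unit Nunit; rewrite /N -mulmxA => rkN.
  by apply: leq_trans (mxrankM_maxr C _); rewrite rkN.
(* One kernel contains the other and both ranks are [r]; this is where constancy of the rank away
   from [xi0] enters. *)
have kerE : (kermx (M xi) :=: kermx (M xi *m P))%MS.
  apply/eqmxP; rewrite -(geq_leqif (mxrank_leqif_eq _)).
    by rewrite !mxrank_ker rkMP rkM.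
  by apply/sub_kermxP; rewrite mulmxA mulmx_ker mul0mx.
apply/eqP/sub_kermxP; rewrite kerE; exact/sub_kermxP.
Unshelve. all: by end_near. Qed.

End kernel_continuity.

(** * Homogeneous functions convex along a cone *)

Section kirchheim_kristensen.
Variables (R : realType) (W : vectType R) (dotW : {dot W for idfun}).
Local Notation dn := (dnorm dotW).
Variable D : set W.
Hypothesis DZ : forall t e, D e -> D (t *: e).

Record cone_convex (q : W -> R) : Prop := ConeConvex {
  cone_lip : lip dotW q;
  cone_homog : forall t y, 0 < t -> q (t *: y) = t * q y;
  cone_mid : forall y e, D e -> q y *+ 2 <= q (y + e) + q (y - e) }.

Lemma le0_geometric (a K : R) : (forall n, a <= K / 2 ^+ n) -> a <= 0.
Proof.
move=> aK; rewrite leNgt; apply/negP => a0.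
have K0 : 0 < K by have := lt_le_trans a0 (aK 0); rewrite expr0 divr1.
pose n := Num.bound (K / a).
have := aK n; rewrite ler_pdivlMr ?exprn_gt0 // leNgt => /negP; apply.
have : K / a < n%:R by apply: archi_boundP; rewrite divr_ge0 // ltW.
rewrite ltr_pdivrMr // mulrC => /lt_le_trans; apply.
by rewrite ler_pM2l // -natrX ler_nat ltnW // ltn_expl.
Qed.

Section one.
Variable q : W -> R.
Hypothesis qC : cone_convex q.

Lemma cone0 : q 0 = 0.
Proof. by have := cone_homog qC 0 (ltr0n _ 2); rewrite scaler0; lra. Qed.

Lemma cone_homog0 t y : 0 <= t -> q (t *: y) = t * q y.
Proof.
rewrite le_eqVlt => /predU1P[<-|]; last exact: cone_homog.
by rewrite scale0r cone0 mul0r.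
Qed.

(** Midpoint convexity with doubled steps bounds [q (x + e)] by the chord from [x] to [x + 2^n e].
    By homogeneity and the Lipschitz bound, [2^-n q (x + 2^n e)] tends to [q e]. *)
Lemma cone_subadd x e : D e -> q (x + e) <= q x + q e.
Proof.
move=> De; have [C C0 qlip] := cone_lip qC.
have dyadic n : q (x + e) <= (1 - (2 ^+ n)^-1) * q x + (2 ^+ n)^-1 * q (x + 2 ^+ n *: e).
  elim: n => [|n IHn]; first by rewrite expr0 invr1 subrr mul0r add0r mul1r scale1r.
  apply: le_trans IHn _.
  have := cone_mid qC (x + 2 ^+ n *: e) (DZ (2 ^+ n) De).
  rewrite addrK -addrA -scalerDl (_ : 2 ^+ n + 2 ^+ n = 2 ^+ n.+1) => [mid|]; last first.
    by rewrite exprS; ring.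
  have n0 : 0 < (2 ^+ n)^-1 :> R by rewrite invr_gt0 exprn_gt0.
  have -> : (2 ^+ n.+1)^-1 = 2^-1 * (2 ^+ n)^-1 :> R by rewrite exprS invfM.
  move: (_^-1) n0 mid => c; nra.
rewrite -subr_le0; apply: (@le0_geometric _ (`|q x| + C * dn x)) => n.
have n0 : 0 < (2 ^+ n)^-1 :> R by rewrite invr_gt0 exprn_gt0.
have qe : (2 ^+ n)^-1 * q (x + 2 ^+ n *: e) <= q e + C * dn x * (2 ^+ n)^-1.
  rewrite -(cone_homog qC) // scalerDr scalerA mulVf ?scale1r ?lt0r_neq0 ?exprn_gt0 //.
  have := qlip ((2 ^+ n)^-1 *: x + e) e.
  rewrite addrK dnormZ (gtr0_norm n0) => /(le_trans (ler_norm _)); lra.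
have := dyadic n; have := ler_norm (- q x); rewrite normrN.
move: (_^-1) n0 qe => c; nra.
Qed.

Variable e : W.
Hypothesis De : D e.

(** By [cone_subadd] these values do not increase with [t], so their infimum is the limit at
    infinity: a recession-type function in the direction [e]. *)
Definition asym_set x := [set q (x + t *: e) - t * q e | t in [set t | 0 <= t]].

Definition asym x := inf (asym_set x).

Lemma asym_has_inf x : has_inf (asym_set x).
Proof.
have [C C0 qlip] := cone_lip qC.
split; first by exists (q (x + 0 *: e) - 0 * q e), 0 => /=.
exists (- (C * dn x)) => _ [t /= t0 <-].
have := qlip (x + t *: e) (t *: e); rewrite addrK cone_homog0 //.
by rewrite ler_norml => /andP[].
Qed.

Lemma asym_le x t : 0 <= t -> asym x <= q (x + t *: e) - t * q e.
Proof. by move=> t0; apply: ge_inf; [have [] := asym_has_inf x|exists t]. Qed.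

Lemma asym_ge x c : (forall t, 0 <= t -> c <= q (x + t *: e) - t * q e) -> c <= asym x.
Proof.
move=> h; apply: lb_le_inf; first by have [] := asym_has_inf x.
by move=> _ [t /= t0 <-]; exact: h.
Qed.

Lemma asym_le_self x : asym x <= q x.
Proof. by have := asym_le x (lexx 0); rewrite scale0r mul0r addr0 subr0. Qed.

Lemma asym_translate_le x s : asym (x + s *: e) <= asym x + s * q e.
Proof.
rewrite -lerBlDr; apply: asym_ge => t t0.
(* From [x + s e] this nonnegative parameter leads to [x + (t + |s|) e], and subadditivity pays
   [|s| q e] for the excess over [t]. *)
have s0 : 0 <= t + (`|s| - s) by rewrite addr_ge0 // subr_ge0 ler_norm.
have := asym_le (x + s *: e) s0.
rewrite -addrA -scalerDl (_ : s + (t + (`|s| - s)) = t + `|s|); last by ring.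
have := cone_subadd (x + t *: e) (DZ `|s| De).
rewrite -addrA -scalerDl cone_homog0 //; lra.
Qed.

Lemma asym_translate x s : asym (x + s *: e) = asym x + s * q e.
Proof.
apply/eqP; rewrite eq_le asym_translate_le /=.
have := asym_translate_le (x + s *: e) (- s).
by rewrite -addrA -scalerDl subrr scale0r addr0; lra.
Qed.

Lemma asym_homog_le a x : 0 < a -> asym (a *: x) <= a * asym x.
Proof.
move=> a0; rewrite -ler_pdivrMl //; apply: asym_ge => t t0.
rewrite ler_pdivrMl //.
have := asym_le (a *: x) (mulr_ge0 (ltW a0) t0).
by rewrite -scalerA -scalerDr (cone_homog qC) // -[a * t * _]mulrA -mulrBr.
Qed.

Lemma cone_convex_asym : cone_convex asym.
Proof.
have [C C0 qlip] := cone_lip qC.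
split.
- have h x y : asym x - asym y <= C * dn (x - y).
    rewrite lerBlDl -lerBlDr; apply: asym_ge => t t0.
    have := asym_le x t0; have := qlip (x + t *: e) (y + t *: e).
    rewrite opprD addrACA subrr addr0 => /(le_trans (ler_norm _)); lra.
  exists C => // u v; rewrite ler_norml lerNl opprB h andbT.
  by rewrite dnorm_sym h.
- move=> a x a0; apply/eqP; rewrite eq_le asym_homog_le //=.
  rewrite -ler_pdivlMl // -{1}[x](scalerK (lt0r_neq0 a0)).
  by rewrite asym_homog_le // invr_gt0.
- move=> y e' De'.
  have shuffle (a b c f : W) : a + (b + c) + f = a + f + b + c.
    by rewrite -!addrA; congr (_ + _); rewrite addrA addrC.
  (* The two infima on the right have separate parameters: the left side is taken at [t + t'], and
     the missing [t'] or [t] is added by subadditivity. *)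
  have mid t t' : 0 <= t -> 0 <= t' -> asym y *+ 2 <=
      (q (y + e' + t *: e) - t * q e) + (q (y - e' + t' *: e) - t' * q e).
    move=> t0 t'0; have := asym_le y (addr_ge0 t0 t'0).
    have := cone_mid qC (y + (t + t') *: e) De'.
    have -> : y + (t + t') *: e + e' = y + e' + t *: e + t' *: e.
      by rewrite scalerDl shuffle.
    have -> : y + (t + t') *: e - e' = y - e' + t' *: e + t *: e.
      by rewrite [t + t']addrC scalerDl shuffle.
    have := cone_subadd (y + e' + t *: e) (DZ t' De).
    have := cone_subadd (y - e' + t' *: e) (DZ t De).
    rewrite !cone_homog0 //; lra.
  rewrite -lerBlDr; apply: asym_ge => t t0.
  rewrite lerBlDl -lerBlDr; apply: asym_ge => t' t'0.
  by have := mid t t' t0 t'0; lra.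
Qed.

End one.

(* Nonnegativity on the span: passing to the asymptotic function in the
   direction [e] makes [q] linear along [e], one spanning direction at a time. *)
Lemma cone_convex_span (l : seq W) q v : {in l, forall e, D e} -> cone_convex q ->
  v \in span l -> 0 <= q v + q (- v).
Proof.
elim: l q v => [|e l IHl] q v lD qC.
  by rewrite span_nil memv0 => /eqP->; rewrite oppr0 cone0 // addr0.
rewrite span_cons => /memv_addP[_ /vlineP[s ->] [u ul ->]].
have De : D e by apply: lD; rewrite mem_head.
have lD' : {in l, forall e, D e} by move=> x xl; apply: lD; rewrite inE xl orbT.
(* [asym] lies below [q], and its increments [s * q e] and [- s * q e] at [v] and [- v] cancel in
   the sum. *)
have := IHl _ u lD' (cone_convex_asym qC De) ul.
have := asym_le_self qC e (s *: e + u); have := asym_le_self qC e (- (s *: e + u)).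
rewrite opprD -scaleNr ![_ *: e + _]addrC !asym_translate //; lra.
Qed.

End kirchheim_kristensen.

(** * Means over the unit cube *)

Section mean_theory.
Variables (R : realType) (d : nat).
Local Notation E := 'rV[R]_d.
Local Notation mu := (lebesgue_rV R d).
Local Notation I := (cube (0 : E) 1).

Lemma integrable_unit_cube (F : E -> R) : bdd_measurable F -> mu.-integrable I (EFin \o F).
Proof. by move=> bF; exact: integrable_cube. Qed.

Lemma meanD (F G : E -> R) : bdd_measurable F -> bdd_measurable G ->
  mean (fun x => F x + G x) = mean F + mean G.
Proof.
move=> bF bG; rewrite /mean RintegralD //; try exact: integrable_unit_cube.
exact: measurable_cube.
Qed.

Lemma meanZ (a : R) (F : E -> R) : bdd_measurable F -> mean (fun x => a * F x) = a * mean F.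
Proof.
move=> bF; rewrite /mean RintegralZl //; first exact: measurable_cube.
exact: integrable_unit_cube.
Qed.

Lemma mean_cst (c : R) : mean (fun _ : E => c) = c.
Proof. by rewrite /mean Rintegral_cube_cst // expr1n mulr1. Qed.

Lemma le_mean (F G : E -> R) : bdd_measurable F -> bdd_measurable G ->
  (forall x, F x <= G x) -> mean F <= mean G.
Proof.
move=> bF bG FG; apply: le_Rintegral => //; try exact: integrable_unit_cube.
exact: measurable_cube.
Qed.

Lemma mean_ge0 (F : E -> R) : (forall x, 0 <= F x) -> 0 <= mean F.
Proof. by move=> F0; exact: Rintegral_ge0. Qed.

Lemma integral_unit_cube (F : E -> R) :
  (\int[mu]_(x in I) (F x)%:E = \int[mu]_x (F x * \1_I x)%:E)%E.
Proof.
rewrite integral_mkcond; apply: eq_integral => x _.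
by rewrite /patch indicE; case: ifP => xI; rewrite ?mulr1 ?mulr0.
Qed.

Lemma meanE (F : E -> R) : mean F = fine (\int[mu]_x (F x * \1_I x)%:E)%E.
Proof. by rewrite /mean /Rintegral integral_unit_cube. Qed.

Section fubini.
Variable G : E * E -> R.
Hypotheses (mG : measurable_fun setT G) (bG : exists B, forall p, `|G p| <= B).

(** The indicators turn means over the unit cube into integrals over the whole space, where Fubini
    applies. *)
Let g (p : E * E) : \bar R := (G p * \1_I p.2 * \1_I p.1)%:E.

Let integrable_g : (mu \x mu)%E.-integrable setT g.
Proof.
have mII : measurable (I `*` I) by apply: measurableX; exact: measurable_cube.
have gE : g = (EFin \o G) \_ (I `*` I).
  apply/funext => -[x s]; rewrite /g /patch /= !indicE in_setX /=.
  by case: (x \in I); case: (s \in I); rewrite /= ?mulr1 ?mulr0 ?mul0r.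
rewrite gE; apply: (integrable_mkcond _ mII).1.
apply: measurable_bounded_integrable => //.
- rewrite [X in (X < _)%E](_ : _ = (mu I * mu I)%E); last first.
    by apply: product_measure1E; exact: measurable_cube.
  by rewrite measure_cube // expr1n mule1 ltry.
- exact: measurable_funTS.
- have [B GB] := bG; exists B; split; first exact: num_real.
  by move=> M BM x _; apply: le_trans (GB x) (ltW BM).
Qed.

Let bdd_sec1 x : bdd_measurable (fun s => G (x, s)).
Proof.
split; first by exact: (measurableT_comp mG (measurable_pair1 x)).
by have [B GB] := bG; exists B => s.
Qed.

Let bdd_sec2 s : bdd_measurable (fun x => G (x, s)).
Proof.
split; first by exact: (measurableT_comp mG (measurable_pair2 s)).
by have [B GB] := bG; exists B => x.
Qed.

Let mean_fin (F : E -> R) : bdd_measurable F ->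
  (\int[mu]_x (F x * \1_I x)%:E = (mean F)%:E)%E.
Proof.
move=> bF; rewrite /mean /Rintegral fineK ?integral_unit_cube //.
rewrite -integral_unit_cube; apply: integrable_fin_num; first exact: measurable_cube.
exact: integrable_unit_cube.
Qed.

Let inner1 x : (\int[mu]_s g (x, s) = (mean (fun s => G (x, s)) * \1_I x)%:E)%E.
Proof.
rewrite /g /= indicE; case: (x \in I).
  rewrite mulr1 -mean_fin //.
  by apply: eq_integral => s _; rewrite mulr1.
by rewrite mulr0; under eq_integral do rewrite mulr0; exact: integral0.
Qed.

Let inner2 s : (\int[mu]_x g (x, s) = (mean (fun x => G (x, s)) * \1_I s)%:E)%E.
Proof.
rewrite /g /= [X in (_ * X)%:E]indicE; case sI: (s \in I).
  rewrite mulr1 -mean_fin //.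
  by apply: eq_integral => x _; rewrite indicE sI mulr1.
rewrite mulr0; under eq_integral do rewrite [\1_I s]indicE sI mulr0 mul0r.
exact: integral0.
Qed.

Lemma mean_fubini : mean (fun x => mean (fun s => G (x, s))) =
  mean (fun s => mean (fun x => G (x, s))).
Proof.
rewrite !meanE; congr fine.
under eq_integral do rewrite -inner1.
by under [RHS]eq_integral do rewrite -inner2; exact: Fubini integrable_g.
Qed.

Lemma integrable_mean : mu.-integrable I (EFin \o (fun x => mean (fun s => G (x, s)))).
Proof.
have mI : measurable I by exact: measurable_cube.
apply: (integrable_mkcond _ mI).2.
have := integrable_fubini_F integrable_g.
congr (_.-integrable _ _); apply/funext => x; rewrite /fubini_F inner1 /patch indicE.
by case: (x \in I); rewrite ?mulr1 ?mulr0.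
Qed.

End fubini.

(** Averaged over the shift [s], the left side is exactly the two-scale mean, by Fubini and
    translation invariance, for every [n]. So some shift is no worse than the average; the slack
    [delta] lets weak inequalities between means conclude. *)
Lemma shift_average (G : E * E -> R) (n : nat) (delta : R) :
  measurable_fun setT G -> (exists B, forall p, `|G p| <= B) ->
  (forall x, zperiodic (fun z => G (x, z))) -> 0 < delta ->
  exists s : E, mean (fun x => G (x, n%:R *: x + s)) <=
    mean (fun x => mean (fun z => G (x, z))) + delta.
Proof.
move=> mG [B GB] pG delta0; apply: contrapT => /forallNP noS.
pose G' (p : E * E) := G (p.2, n%:R *: p.2 + p.1).
have mG' : measurable_fun setT G'.
  apply: (measurableT_comp mG); apply/measurable_fun_pairP; split; first exact: measurable_snd.
  apply: measurable_fun_rVP => i /=.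
  rewrite (_ : (fun t : E * E => _) =
      (fun t => n%:R * t.2 ord0 i + t.1 ord0 i)); last by apply/funext => t; rewrite !mxE.
  apply: measurable_funD.
    apply: measurable_funM => //.
    exact: (measurableT_comp (measurable_coord i) measurable_snd).
  exact: (measurableT_comp (measurable_coord i) measurable_fst).
have bG' : exists B, forall p, `|G' p| <= B by exists B => p; exact: GB.
set J := mean (fun x => mean (fun z => G (x, z))) in noS.
have JE : J = mean (fun s => mean (fun x => G' (s, x))).
  rewrite (mean_fubini mG' bG'); congr (mean _); apply/funext => x.
  have bGx : bdd_measurable (fun z => G (x, z)).
    by split; [exact: (measurableT_comp mG (measurable_pair1 x))|exists B].
  rewrite -(mean_translate (n%:R *: x) bGx (pG x)).
  by congr mean; apply/funext => s; rewrite /G' /= addrC.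
suff : J + delta <= J by rewrite gerDl leNgt delta0.
rewrite {2}JE -(mean_cst (J + delta)); apply: le_Rintegral.
- exact: measurable_cube.
- by apply: integrable_unit_cube; exact: bdd_measurable_cst.
- exact: integrable_mean.
- by move=> s _; have /negP := noS s; rewrite -ltNge => /ltW.
Qed.

Lemma cvg_mean0 (F : nat -> E -> R) (B : R) (Z : set E) : measurable Z -> mu (Z `&` I) = 0%E ->
  (forall n, measurable_fun setT (F n)) -> (forall n x, `|F n x| <= B) ->
  (forall x, ~ Z x -> F n x @[n --> \oo] --> (0 : R)) ->
  mean (F n) @[n --> \oo] --> (0 : R).
Proof.
move=> mZ Z0 mF FB Fcvg.
have mI : measurable I by exact: measurable_cube.
have iB : mu.-integrable I (EFin \o (fun=> B)).
  by apply: integrable_unit_cube; exact: bdd_measurable_cst.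
have [|||||_ _] := @dominated_convergence _ _ _ mu I mI (fun n x => (F n x)%:E)
    (fun=> 0%E) (EFin \o (fun=> B)).
- by move=> n; apply/measurable_EFinP; exact: measurable_funTS.
- exact: measurable_cst.
- exists (Z `&` I); split=> [|//|x /= /not_implyP[Ix xn]]; first exact: measurableI.
  split=> //; apply: contrapT => Zx; apply: xn.
  by apply/fine_cvgP; split; [exact: nearW|exact: Fcvg].
- exact: iB.
- by apply: aeW => x n _; rewrite lee_fin.
rewrite integral0 => h.
by have /fine_cvg := h.
Qed.

End mean_theory.

(** * Means of modes and null sets of sines *)

Section measurability.
Variables (R : realType) (d : nat).
Local Notation E := 'rV[R]_d.
Local Notation mu := (lebesgue_rV R d).

Lemma continuous_measurable_rV n (f : 'rV[R]_n -> R) : continuous f ->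
  measurable_fun setT f.
Proof.
move=> fC; apply: (measurability _ (RGenOpens.measurableE R)) => _ [_ [a [b ->]] <-].
rewrite setTI; apply: open_measurable_rV.
by apply: open_comp; [move=> x _; exact: fC|exact: interval_open].
Qed.

Lemma measurable_mode q c : measurable_fun setT (mode q c : E -> R).
Proof. by apply: continuous_measurable_rV; exact: continuous_mode. Qed.

Lemma bdd_measurable_mode q c : bdd_measurable (mode q c : E -> R).
Proof. by split; [exact: measurable_mode|exists 1 => x; exact: normr_mode]. Qed.

Lemma mean_sum (J : Type) (r : seq J) (F : J -> E -> R) :
  (forall j, bdd_measurable (F j)) ->
  bdd_measurable (fun x => \sum_(j <- r) F j x) /\
  mean (fun x => \sum_(j <- r) F j x) = \sum_(j <- r) mean (F j).
Proof.
move=> bF; elim: r => [|j r [IH1 IH2]].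
  under eq_fun do rewrite big_nil.
  by split; [exact: bdd_measurable_cst|rewrite big_nil mean_cst].
under eq_fun do rewrite big_cons.
split; first exact: bdd_measurableD.
by rewrite meanD // IH2 big_cons.
Qed.

Lemma dotz_self_gt0 (q : 'rV[int]_d) : q != 0 -> 0 < dotz q (zvec R q).
Proof.
move=> q0; have /existsP[i qi] : [exists i, q ord0 i != 0].
  apply: contraNT q0 => /existsPn h; apply/eqP/rowP => i; rewrite mxE.
  by apply/eqP; have := h i; rewrite negbK.
rewrite /dotz (bigD1 i) //= ltr_wpDr //.
  by apply: sumr_ge0 => j _; rewrite mxE -expr2 sqr_ge0.
by rewrite mxE -expr2 lt_def sqr_ge0 andbT sqrf_eq0 intr_eq0.
Qed.

Lemma exists_shift (q : 'rV[int]_d) (t : R) : q != 0 -> exists s : E, dotz q s = t.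
Proof.
move=> q0; exists ((t / dotz q (zvec R q)) *: zvec R q).
by rewrite dotzZr divfK // gt_eqF // dotz_self_gt0.
Qed.

(** Translation by half a period changes the sign but not the mean. *)
Lemma mean_mode0 q c : q != 0 -> mean (mode q c : E -> R) = 0.
Proof.
move=> q0; have [s qs] := exists_shift 2^-1 q0.
have := mean_translate s (bdd_measurable_mode q c) (@mode_zperiodic _ _ q c).
have -> : (fun x : E => mode q c (x + s)) = (fun x => - 1 * mode q c x).
  apply/funext => x; rewrite /mode dotzDr qs mulrDr mulN1r.
  have -> : pi *+ 2 * 2^-1 = pi :> R by field.
  by rewrite addrAC cosDpi.
rewrite meanZ; last exact: bdd_measurable_mode.
lra.
Qed.

Definition sinz q (x : E) : R := sin (pi *+ 2 * dotz q x).

Lemma sinz_mode q x : sinz q x = mode q (- (pi / 2)) x.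
Proof. by rewrite /mode cosBpihalf. Qed.

Lemma measurable_sinz q : measurable_fun setT (sinz q).
Proof.
rewrite (_ : sinz q = mode q (- (pi / 2))); first exact: measurable_mode.
by apply/funext => x; rewrite sinz_mode.
Qed.

Definition sinz0 q : set E := sinz q @^-1` [set 0].

Lemma measurable_sinz0 q : measurable (sinz0 q).
Proof.
by rewrite /sinz0 -[X in measurable X]setTI; apply: measurable_sinz.
Qed.

(* The translates of the zero set by [i / 2n] of a half period, [i < n], are
   disjoint and have the same measure. *)
Lemma sinz0_null q : q != 0 -> mu (sinz0 q `&` cube 0 1) = 0%E.
Proof.
move=> q0; pose F : E -> R := \1_(sinz0 q).
have bF : bdd_measurable F by apply: bdd_measurable_indic; exact: measurable_sinz0.
have pF : zperiodic F.
  move=> z x; rewrite /F !indicE; congr ((nat_of_bool _)%:R).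
  apply/idP/idP; rewrite !inE /sinz0 /= !sinz_mode;
    by rewrite mode_zperiodic.
suff F0 : mean F = 0.
  have mZI : measurable (sinz0 q `&` cube 0 1).
    by apply: measurableI; [exact: measurable_sinz0|exact: measurable_cube].
  move: F0; rewrite /mean /Rintegral /F.
  rewrite integral_indic; [|exact: measurable_cube|exact: measurable_sinz0].
  move/eqP; rewrite fine_eq0; first by move/eqP.
  rewrite ge0_fin_numE //; apply: le_lt_trans (_ : mu (cube 0 1) < _)%E.
    by apply: le_measure; rewrite ?inE //; exact: measurable_cube.
  by rewrite measure_cube // ltry.
have m0 : 0 <= mean F by apply: mean_ge0 => x; rewrite /F indicE ler0n.
have nF n : n%:R * mean F <= 1.
  case: n => [|n]; first by rewrite mul0r.
  have /choice[s sP] : forall i : 'I_n.+1, exists s : E, dotz q s = i%:R / (n.+1%:R *+ 2).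
    by move=> i; exact: exists_shift.
  have bFs i : bdd_measurable (fun x => F (x + s i)).
    case: bF => mF [B FB]; split; last by exists B.
    apply: (measurableT_comp mF).
    have := measurable_affine 1 (s i); congr measurable_fun.
    by apply/funext => x; rewrite scale1r.
  have [bS mS] := mean_sum (index_enum 'I_n.+1) bFs.
  have -> : n.+1%:R * mean F = mean (fun x => \sum_i F (x + s i)).
    rewrite mS (eq_bigr (fun=> mean F)) => [|i _]; last first.
      exact: mean_translate.
    by rewrite sumr_const card_ord mulr_natl.
  rewrite -(mean_cst d (1 : R)); apply: le_mean => // [|x].
    exact: bdd_measurable_cst.
  have [/existsP[i Fi]|/existsPn noi] := boolP [exists i, F (x + s i) != 0]; last first.
    rewrite big1 // => i _; apply/eqP.
    by have := noi i; rewrite negbK.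
  rewrite (bigD1 i) //= big1 => [|j ji].
    by rewrite addr0 /F indicE; case: (_ \in _).
  apply/eqP; apply: contraNT ji => Fj.
  have zero l : F (x + s l) != 0 ->
      sin (pi *+ 2 * dotz q x + pi *+ 2 * (l%:R / (n.+1%:R *+ 2))) = 0.
    rewrite /F indicE pnatr_eq0 eqb0 negbK inE /sinz0 /= /sinz.
    by rewrite dotzDr sP mulrDr.
  have lt_absurd (l l' : 'I_n.+1) : F (x + s l) != 0 -> F (x + s l') != 0 ->
      ~~ (l < l')%N.
    move=> /zero zl /zero zl'; apply/negP => ll'.
    have n0 : 0 < n.+1%:R :> R by [].
    (* The difference of the two phases lies strictly between 0 and [pi], whereas the sine of a
       difference of two zeros of the sine vanishes. *)
    have : 0 < sin (pi *+ 2 * (l'%:R / (n.+1%:R *+ 2)) - pi *+ 2 * (l%:R / (n.+1%:R *+ 2)) : R).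
      apply: sin_gt0_pi.
      have -> : pi *+ 2 * (l'%:R / (n.+1%:R *+ 2)) - pi *+ 2 * (l%:R / (n.+1%:R *+ 2)) =
        pi * ((l'%:R - l%:R) / n.+1%:R) :> R by field.
      have p0 := pi_gt0 R.
      rewrite mulr_gt0 ?divr_gt0 ?subr_gt0 ?ltr_nat //=.
      rewrite -[ltRHS]mulr1 ltr_pM2l // ltr_pdivrMr // mul1r.
      by rewrite ltrBlDr -natrD ltr_nat ltn_addr // ltn_ord.
    set a := pi *+ 2 * dotz q x in zl zl'.
    set b := pi *+ 2 * _ in zl'; set c := pi *+ 2 * _ in zl.
    have -> : b - c = (a + b) - (a + c) by ring.
    by rewrite sinB zl zl' mul0r mulr0 subrr ltxx.
  rewrite -val_eqE /= eqn_leq; apply/andP; split; rewrite leqNgt;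
    exact: lt_absurd.
apply/eqP; rewrite eq_le m0 andbT leNgt; apply/negP => mgt0.
have := nF (Num.bound (1 / mean F)).+1; rewrite leNgt => /negP; apply.
rewrite -ltr_pdivrMr //; apply: lt_trans (archi_boundP _) _ => //.
  by rewrite divr_ge0.
by rewrite ltr_nat.
Qed.

End measurability.

(** * Oscillating A-free fields *)

Section scalar_trig.
Variables (R : realType) (d : nat).
Local Notation E := 'rV[R]_d.

(** [S] will be everything or the multiples of one [q]; in the latter case a kernel vector at [q]
    stays one at each frequency of [g]. For products, [S] must contain sums and differences, since a
    product of cosines has both frequencies. *)
Definition tfun (S : set 'rV[int]_d) (g : E -> R) :=
  exists2 s : trig d R^o, g = teval s & {in s, forall m, S m.1.1}.

Variable S : set 'rV[int]_d.
Hypotheses (S0 : S 0) (SD : forall p q, S p -> S q -> S (p + q) /\ S (q - p)).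

Lemma tfun_mode q c : S q -> tfun S (mode q c).
Proof.
move=> Sq; exists [:: (q, c, 1 : R^o)]; last by move=> m; rewrite inE => /eqP ->.
by apply/funext => x; rewrite teval_cons teval_nil addr0 [RHS]mulr1.
Qed.

Lemma tfunD f g : tfun S f -> tfun S g -> tfun S (fun x => f x + g x).
Proof.
move=> [s -> sS] [t -> tS]; exists (s ++ t); first by apply/funext => x; rewrite teval_cat.
by move=> m; rewrite mem_cat => /orP[/sS|/tS].
Qed.

Lemma tfunZ a g : tfun S g -> tfun S (fun x => a * g x).
Proof.
move=> [s -> sS]; exists (tscale a s); first by apply/funext => x; rewrite teval_scale.
by move=> _ /mapP[m /sS ? ->].
Qed.

Lemma tfun_cst a : tfun S (fun=> a).
Proof.
have := tfunZ a (tfun_mode 0 S0); congr (tfun _ _); apply/funext => x.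
by rewrite /mode dotz0l mulr0 addr0 cos0 mulr1.
Qed.

Lemma tfun_ind (P : (E -> R) -> Prop) : P (fun=> 0) ->
  (forall q c a g, S q -> P g -> P (fun x => a * mode q c x + g x)) ->
  forall g, tfun S g -> P g.
Proof.
move=> P0 PS _ [s -> sS]; elim: s sS => [|[[q c] a] s IHs] sS.
  by rewrite (_ : teval [::] = fun=> 0) //; apply/funext => x; rewrite teval_nil.
rewrite (_ : teval _ = fun x => a * mode q c x + teval s x).
  apply: PS; first exact: (sS (q, c, a) (mem_head _ _)).
  by apply: IHs => m ms; apply: sS; rewrite inE ms orbT.
by apply/funext => x; rewrite teval_cons /= [_ *: _]mulrC.
Qed.

Lemma tfunM f g : tfun S f -> tfun S g -> tfun S (fun x => f x * g x).
Proof.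
move=> tf; elim/tfun_ind: g / => [|q c a g Sq tfg].
  by have := tfun_cst 0; congr (tfun _ _); apply/funext => x; rewrite mulr0.
have tm : tfun S (fun x => f x * (a * mode q c x)).
  elim/tfun_ind: f / tf {tfg} => [|p b r f Sp tfm].
    by have := tfun_cst 0; congr (tfun _ _); apply/funext => x; rewrite mul0r.
  have [Spq Sqp] := SD Sp Sq; rewrite addrC in Spq.
  have := tfunD (tfunZ (r * a * 2^-1) (tfunD (tfun_mode (c + b) Spq) (tfun_mode (c - b) Sqp))) tfm.
  congr (tfun _ _); apply/funext => x.
  by rewrite -[in LHS]mulrA -modeM; ring.
have := tfunD tm tfg; congr (tfun _ _); apply/funext => x; ring.
Qed.

Lemma tfunX f n : tfun S f -> tfun S (fun x => f x ^+ n).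
Proof.
move=> tf; elim: n => [|n IHn]; first exact: tfun_cst.
by under eq_fun do rewrite exprS; exact: tfunM.
Qed.

Lemma bdd_measurable_tfun g : tfun S g -> bdd_measurable g.
Proof.
elim/tfun_ind: g / => [|q c a g _ bg]; first exact: bdd_measurable_cst.
apply: bdd_measurableD => //; apply: bdd_measurableM; first exact: bdd_measurable_cst.
exact: bdd_measurable_mode.
Qed.

Lemma tfunT g : tfun S g -> tfun setT g.
Proof. by move=> [s -> _]; exists s. Qed.

End scalar_trig.

Section bdd_field.
Variables (R : realType) (d : nat) (W : vectType R) (dotW : {dot W for idfun}).
Local Notation E := 'rV[R]_d.
Local Notation dn := (dnorm dotW).

Definition bdd_field (w : E -> W) :=
  measurable_fun setT (v2r \o w) /\ exists B, forall x, dn (w x) <= B.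

Lemma bdd_field_teval (s : trig d W) : bdd_field (teval s).
Proof.
split.
  apply: measurable_fun_rVP => i; apply: continuous_measurable_rV => x.
  apply: (@continuous_comp _ _ _ (v2r \o teval s) (fun v => v ord0 i)).
    exact: continuous_teval.
  exact: coord_continuous.
exists (\sum_(m <- s) dn m.2) => x; apply: le_trans (dnorm_sum _ _ _) _.
apply: ler_sum => m _; rewrite dnormZ ler_piMl ?dnorm_ge0 //.
exact: normr_mode.
Qed.

Lemma continuous_lip F : lip dotW F -> continuous (F \o r2v : 'rV[R]_(dim W) -> R).
Proof.
move=> [C C0 FC] x; apply: (@cvgrPdist_lt _ _ _ (nbhs x) (nbhs_filter x) _ _).2 => e e0 /=.
pose D := C * dconst dotW + 1.
have D0 : 0 < D by rewrite ltr_wpDl // mulr_ge0 // dconst_ge0.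
have near_x : \forall y \near x, `|x - y| < e / D.
  by have := nbhsx_ballx x (e / D) (divr_gt0 e0 D0); rewrite mx_norm_ball.
near=> y; apply: le_lt_trans (FC _ _) _.
have xy : `|x - y| < e / D by near: y.
rewrite -linearB; apply: le_lt_trans (_ : D * `|x - y| < _).
  apply: le_trans (_ : C * (dconst dotW * `|x - y|) <= _).
    by apply: ler_wpM2l => //; apply: le_trans (dnorm_le_v2r _ _) _; rewrite r2vK.
  by rewrite mulrA ler_wpM2r // /D lerDl.
by rewrite mulrC -ltr_pdivlMr.
Unshelve. all: by end_near. Qed.

Lemma measurable_lip F : lip dotW F -> measurable_fun setT (F \o r2v : 'rV[R]_(dim W) -> R).
Proof. by move=> lF; apply: continuous_measurable_rV; exact: continuous_lip. Qed.

Lemma lip_bound F : lip dotW F -> exists2 C, 0 <= C & forall u, `|F u| <= `|F 0| + C * dn u.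
Proof.
move=> [C C0 FC]; exists C => // u.
have := FC u 0; rewrite subr0 => h.
by rewrite -{1}(subrK (F 0) (F u)) addrC; apply: le_trans (ler_normD _ _) _; rewrite lerD2l.
Qed.

Lemma measurable_lip_comp T' (T : measurableType T') F (w : T -> W) : lip dotW F ->
  measurable_fun setT (v2r \o w) -> measurable_fun setT (F \o w).
Proof.
move=> lF mw; have := measurableT_comp (measurable_lip lF) mw.
by congr measurable_fun; apply/funext => x /=; rewrite v2rK.
Qed.

Lemma bdd_measurable_lip F w : lip dotW F -> bdd_field w -> bdd_measurable (F \o w).
Proof.
move=> lF [mw [B wB]]; split; first exact: measurable_lip_comp.
have [C C0 FC] := lip_bound lF; exists (`|F 0| + C * B) => x.
by apply: le_trans (FC _) _; rewrite lerD2l ler_wpM2l.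
Qed.

End bdd_field.

Section osc.
Variables (R : realType) (d k : nat) (W X : vectType R) (dotW : {dot W for idfun}).
Variable A : multiindex d k -> 'Hom(W, X).
Local Notation E := 'rV[R]_d.
Local Notation dn := (dnorm dotW).

Definition osc_modes (s : trig d W) := {in s, forall m,
  m.1.1 != 0 /\ m.2 \in lker (symbol A (zvec R m.1.1))}.

Definition osc (w : E -> W) := exists2 s, w = teval s & osc_modes s.

Lemma osc_ind (P : (E -> W) -> Prop) : P (fun=> 0) ->
  (forall q c a w, q != 0 -> a \in lker (symbol A (zvec R q)) -> osc w -> P w ->
    P (fun x => mode q c x *: a + w x)) ->
  forall w, osc w -> P w.
Proof.
move=> P0 PS _ [s -> os]; elim: s os => [|[[q c] a] s IHs] os.
  by rewrite (_ : teval [::] = fun=> 0) //; apply/funext => x; rewrite teval_nil.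
have [q0 qa] := os (q, c, a) (mem_head _ _).
have os' : osc_modes s by move=> m ms; apply: os; rewrite inE ms orbT.
rewrite (_ : teval _ = fun x => mode q c x *: a + teval s x).
  by apply: PS => //; [exists s|exact: IHs].
by apply/funext => x; rewrite teval_cons.
Qed.

Lemma osc0 : osc (fun=> 0).
Proof. by exists [::] => //; apply/funext => x; rewrite teval_nil. Qed.

Lemma osc_mode q c a : q != 0 -> a \in lker (symbol A (zvec R q)) ->
  osc (fun x => mode q c x *: a).
Proof.
move=> q0 qa; exists [:: (q, c, a)].
  by apply/funext => x; rewrite teval_cons teval_nil addr0.
by move=> m; rewrite inE => /eqP ->.
Qed.

Lemma oscD w w' : osc w -> osc w' -> osc (fun x => w x + w' x).
Proof.
move=> [s -> os] [t -> ot]; exists (s ++ t).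
  by apply/funext => x; rewrite teval_cat.
by move=> m; rewrite mem_cat => /orP[/os|/ot].
Qed.

Lemma oscZ a w : osc w -> osc (fun x => a *: w x).
Proof.
move=> [s -> os]; exists (tscale a s).
  by apply/funext => x; rewrite teval_scale.
by move=> _ /mapP[m /os[m0 mA] ->] /=; split => //; rewrite rpredZ.
Qed.

Lemma symbolZ t (xi : E) : symbol A (t *: xi) = t ^+ k *: symbol A xi.
Proof.
rewrite /symbol scaler_sumr; apply: eq_bigr => alpha /eqP lenk.
rewrite scalerA; congr (_ *: _).
under eq_bigr do rewrite mxE exprMn.
by rewrite big_split /= -expr_sum -/(mi_length alpha) lenk.
Qed.

Lemma lker_symbolZ t (xi : E) a : a \in lker (symbol A xi) -> a \in lker (symbol A (t *: xi)).
Proof.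
by rewrite !memv_ker symbolZ scale_lfunE => /eqP ->; rewrite scaler0.
Qed.

Lemma zvecMn q n : zvec R (q *+ n) = n%:R *: zvec R q :> E.
Proof. by apply/rowP => i; rewrite !mxE mulmxnE rmorphMn /= mulr_natl. Qed.

Lemma zvecD p q : zvec R (p + q) = zvec R p + zvec R q :> E.
Proof. by apply/rowP => i; rewrite !mxE intrD. Qed.

Lemma zvec_eq0 q : (zvec R q == 0 :> E) = (q == 0).
Proof.
apply/eqP/eqP => [/rowP q0|->]; last by apply/rowP => i; rewrite !mxE.
by apply/rowP => i; have := q0 i; rewrite !mxE => /eqP; rewrite intr_eq0 => /eqP.
Qed.

Lemma osc_affine n y w : (0 < n)%N -> osc w -> osc (fun x => w (n%:R *: x + y)).
Proof.
move=> n0 [s -> os]; exists (taffine n y s).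
  by apply/funext => x; rewrite teval_affine.
move=> _ /mapP[m /os[m0 mA] ->] /=; split; last by rewrite zvecMn lker_symbolZ.
by rewrite -zvec_eq0 zvecMn scaler_eq0 negb_or pnatr_eq0 -lt0n n0 zvec_eq0.
Qed.

Lemma osc_bdd_field w : osc w -> bdd_field dotW w.
Proof. by move=> [s -> _]; exact: bdd_field_teval. Qed.

Lemma osc_zperiodic w : osc w -> zperiodic w.
Proof. by move=> [s -> _]; exact: teval_zperiodic. Qed.

Lemma osc_smooth U w : osc w -> smooth_on U w.
Proof. by move=> [s -> _]; exact: smooth_teval. Qed.

Lemma osc_Afree w x : osc w -> diff_op A w x = 0.
Proof. by move=> [s -> os]; apply: diff_op_teval => m /os[]. Qed.

Lemma osc_mean0 u w : osc w -> mean (fun x => dotW u (w x)) = 0.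
Proof.
elim/osc_ind: w / => [|q c a w q0 _ ow IHw].
  by under eq_fun do rewrite dot0r; rewrite mean_cst.
under eq_fun do rewrite dotDr dotZr mulrC.
have bm : bdd_measurable (fun x : E => dotW u a * mode q c x).
  by apply: bdd_measurableM; [exact: bdd_measurable_cst|exact: bdd_measurable_mode].
have lu : lip dotW (dotW u).
  exists (dn u) => [|v v']; first exact: dnorm_ge0.
  by rewrite -linearBr; exact: normr_dot_le.
rewrite meanD //; last by apply: (bdd_measurable_lip lu); exact: osc_bdd_field.
by rewrite meanZ ?mean_mode0 ?mulr0 ?IHw ?addr0 //; exact: bdd_measurable_mode.
Qed.

Hypothesis crA : constant_rank A.

(** Used twice: with constant [z] for the frequencies [q *+ N + p], and with rounding errors [z N]
    for integer approximations of [N xi]. *)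
Lemma near_lattice (xi : E) (z : nat -> E) (B : R) (P : set E) :
  (forall N, `|z N| <= B) -> (\forall y \near xi, P y) ->
  exists N0, forall N, (N0 <= N)%N -> P (xi + N%:R^-1 *: z N).
Proof.
move=> zB /nbhs_ballP[e /= e0 eP]; exists (Num.bound (`|B| / e)).+1 => N hN.
apply: eP; rewrite mx_norm_ball /ball_ /= opprD addrA subrr add0r normrN normrZ.
have N0 : 0 < N%:R :> R by rewrite ltr0n (leq_trans _ hN).
rewrite ger0_norm ?invr_ge0 // ltr_pdivrMl //.
apply: le_lt_trans (zB N) (le_lt_trans (ler_norm _) _); rewrite -ltr_pdivrMr //.
apply: lt_le_trans (archi_boundP _) _; first by rewrite divr_ge0 // ltW.
by rewrite ler_nat ltnW.
Qed.

Lemma near_neq0 (xi : E) : xi != 0 -> \forall y \near xi, y != 0.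
Proof.
rewrite -normr_gt0 => xi_gt0.
have := nbhsx_ballx xi _ xi_gt0; rewrite mx_norm_ball.
by apply: filterS => y; apply: contraTneq => ->; rewrite /ball_ /= subr0 ltxx.
Qed.

(** The kernel depends on the direction only, and [N q + p = N (q + p / N)] with [q + p / N] close
    to [q]. *)
Lemma lattice_kernel q p a (eps : R) : q != 0 -> a \in lker (symbol A (zvec R q)) ->
  0 < eps -> exists N0, forall N, (N0 <= N)%N -> q *+ N + p != 0 /\
    exists2 a', a' \in lker (symbol A (zvec R (q *+ N + p))) & dn (a' - a) <= eps.
Proof.
move=> q0 qa eps0; have zq0 : zvec R q != 0 :> E by rewrite zvec_eq0.
have near_q := near_neq0 zq0.
have := @ker_symbol_near R d k W X A dotW (zvec R q) a eps crA zq0 qa eps0.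
have zp (_ : nat) : `|zvec R p : E| <= `|zvec R p : E| by [].
move=> /(near_lattice zp)[N1 N1P]; have [N2 N2P] := near_lattice zp near_q.
exists (maxn (maxn N1 N2) 1) => N; rewrite !geq_max => /andP[/andP[h1 h2] h3].
have NE : zvec R (q *+ N + p) = N%:R *: (zvec R q + N%:R^-1 *: zvec R p) :> E.
  rewrite scalerDr scalerA divff ?scale1r ?zvecD ?zvecMn //.
  by rewrite pnatr_eq0 -lt0n.
have n0 := N2P N h2.
split; first by rewrite -zvec_eq0 NE scaler_eq0 negb_or n0 pnatr_eq0 -lt0n h3.
have [a' a'k a'a] := N1P N h1 n0.
by exists a' => //; rewrite NE lker_symbolZ.
Qed.

(** Periodic fields only have integer frequencies: [N xi] is rounded down coordinatewise, which
    changes the direction by [O(1 / N)], and the kernel vector is moved along. *)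
Lemma wave_cone_approx e (eps : R) : wave_cone A e -> 0 < eps ->
  exists q e', [/\ q != 0, e' \in lker (symbol A (zvec R q)) & dn (e' - e) <= eps].
Proof.
move=> [xi xi0 exi] eps0.
pose fl (N : nat) : 'rV[int]_d := \row_i Num.floor (N%:R * xi ord0 i).
pose z N := zvec R (fl N) - N%:R *: xi.
have zB N : `|z N| <= 1.
  rewrite [leLHS]/Num.norm /= mx_normrE; apply: bigmax_le => // -[i j] _.
  rewrite ord1 !mxE ler_norml.
  have := floor_le (N%:R * xi ord0 j); have := floorD1_gt (N%:R * xi ord0 j).
  by rewrite intrD => ? ?; apply/andP; split; lra.
have [N1 N1P] := near_lattice zB (ker_symbol_near dotW crA xi0 exi eps0).
have [N2 N2P] := near_lattice zB (near_neq0 xi0).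
pose N := maxn (maxn N1 N2) 1.
have /andP[/andP[h1 h2] h3] : (N1 <= N)%N && (N2 <= N)%N && (0 < N)%N.
  by rewrite /N !leq_max !leqnn /= !orbT.
have N0 : N%:R != 0 :> R by rewrite pnatr_eq0 -lt0n.
have NE : zvec R (fl N) = N%:R *: (xi + N%:R^-1 *: z N) :> E.
  by rewrite scalerDr scalerA divff // scale1r addrC subrK.
have n0 := N2P N h2; have [e' e'k e'e] := N1P N h1 n0.
exists (fl N), e'; split => //; last by rewrite NE lker_symbolZ.
by rewrite -zvec_eq0 NE scaler_eq0 negb_or n0 N0.
Qed.

(* [g x *: w (N x + y)] only has modes [N q + p] with [q] a mode of [w] and [p]
   a bounded frequency, so for large [N] its amplitudes are almost in the right
   kernels. *)
Lemma osc_correct (g : E -> R) (w : E -> W) (delta : R) : tfun setT g -> osc w -> 0 < delta ->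
  exists N0, forall N, (N0 <= N)%N -> forall y, exists2 w', osc w' &
    forall x, dn (w' x - g x *: w (N%:R *: x + y)) <= delta.
Proof.
move=> tg ow; elim/osc_ind: w / ow delta => [|q c a w q0 qa ow IHw] delta delta0.
  exists 0%N => N _ y; exists (fun=> 0) => [|x]; first exact: osc0.
  by rewrite scaler0 subr0 dnorm0 ltW.
have [N1 IHw1] := IHw _ (divr_gt0 delta0 (ltr0n R 2)).
suff [N2 N2P] : exists N0, forall N, (N0 <= N)%N -> forall y, exists2 w', osc w' &
    forall x, dn (w' x - g x *: (mode q c (N%:R *: x + y) *: a)) <= delta / 2.
  exists (maxn N1 N2) => N; rewrite geq_max => /andP[h1 h2] y.
  have [w1 ow1 w1E] := IHw1 N h1 y; have [w2 ow2 w2E] := N2P N h2 y.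
  exists (fun x => w2 x + w1 x) => [|x]; first exact: oscD.
  rewrite scalerDr opprD addrACA; apply: le_trans (dnormD _ _ _) _.
  by rewrite [leRHS](splitr delta) lerD.
move: (delta / 2) (divr_gt0 delta0 (ltr0n R 2)) => {IHw IHw1 N1 delta0}delta1.
elim/tfun_ind: g / tg delta1 {delta} => [|p b r g _ IHg] delta delta0.
  exists 0%N => N _ y; exists (fun=> 0) => [|x]; first exact: osc0.
  by rewrite scale0r subr0 dnorm0 ltW.
have delta20 : 0 < delta / 2 by exact: divr_gt0.
have [N1 N1P] := IHg _ delta20.
(* The product of two cosines yields two modes with factor [r / 2]; correcting each amplitude by
   this much costs at most [delta / 2] in total. *)
have e0 : 0 < delta / 2 / (`|r| + 1) by rewrite divr_gt0 // ltr_wpDl.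
have [N2 N2P] := lattice_kernel p q0 qa e0.
have [N3 N3P] := lattice_kernel (- p) q0 qa e0.
exists (maxn N1 (maxn N2 N3)) => N; rewrite !geq_max => /and3P[h1 h2 h3] y.
have [w1 ow1 w1E] := N1P N h1 y.
have [n2 [a2 a2k a2E]] := N2P N h2; have [n3 [a3 a3k a3E]] := N3P N h3.
(* [y] only enters the phase, so the threshold on [N] is uniform in [y]. This matters because the
   shift is selected after [N]. *)
pose c' := c + pi *+ 2 * dotz q y.
pose m2 : E -> R := mode (q *+ N + p) (c' + b); pose m3 : E -> R := mode (q *+ N - p) (c' - b).
exists (fun x => (r / 2) *: (m2 x *: a2 + m3 x *: a3) + w1 x).
  by apply: oscD => //; apply: oscZ; apply: oscD; exact: osc_mode.
move=> x; have -> : (r * mode p b x + g x) *: (mode q c (N%:R *: x + y) *: a) =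
    (r / 2) *: (m2 x *: a + m3 x *: a) + g x *: (mode q c (N%:R *: x + y) *: a).
  rewrite scalerDl; congr (_ + _); rewrite mode_affine -scalerDl !scalerA.
  by congr (_ *: _); rewrite -mulrA modeM mulrA.
rewrite opprD addrACA; apply: le_trans (dnormD _ _ _) _.
rewrite [leRHS](splitr delta) lerD // -scalerBr dnormZ.
set e := delta / 2 / (`|r| + 1) in e0 a2E a3E.
have m2E : dn (m2 x *: a2 + m3 x *: a3 - (m2 x *: a + m3 x *: a)) <= e *+ 2.
  rewrite opprD addrACA -!scalerBr mulr2n; apply: le_trans (dnormD _ _ _) _.
  by rewrite !dnormZ; apply: lerD; rewrite -[leRHS]mul1r ler_pM ?dnorm_ge0 ?normr_mode.
apply: le_trans (ler_wpM2l (normr_ge0 _) m2E) _.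
rewrite normrM [`|2^-1|]ger0_norm ?invr_ge0 //.
have -> : delta / 2 = (`|r| + 1) * e by rewrite /e [RHS]mulrC divfK // gt_eqF // ltr_wpDl.
have -> : `|r| / 2 * (e *+ 2) = `|r| * e by field.
by rewrite ler_pM2r // lerDl.
Qed.

End osc.

(** * Two-scale superposition *)

Section superposition.
Variables (R : realType) (d k : nat) (W X : vectType R) (dotW : {dot W for idfun}).
Variable A : multiindex d k -> 'Hom(W, X).
Hypothesis crA : constant_rank A.
Local Notation E := 'rV[R]_d.
Local Notation mu := (lebesgue_rV R d).
Local Notation dn := (dnorm dotW).
Local Notation osc := (osc A).

Section two_scale.
Variables (F : W -> R) (w0 w1 w2 : E -> W) (g1 g2 : E -> R).
Hypotheses (lF : lip dotW F) (bw0 : bdd_field dotW w0) (bw1 : bdd_field dotW w1)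
  (bw2 : bdd_field dotW w2) (bg1 : bdd_measurable g1) (bg2 : bdd_measurable g2).

(** The first variable is slow, the second fast. Lamination uses all three terms, concentration only
    the middle one. *)
Definition two_scale (p : E * E) : W := w0 p.1 + g1 p.1 *: w1 p.2 + g2 p.1 *: w2 p.2.

Lemma measurable_two_scale : measurable_fun setT (F \o two_scale).
Proof.
apply: measurable_lip_comp lF _; apply: measurable_fun_rVP => i.
rewrite (_ : (fun t => _) = (fun p : E * E => (v2r \o w0) p.1 ord0 i +
    g1 p.1 * (v2r \o w1) p.2 ord0 i + g2 p.1 * (v2r \o w2) p.2 ord0 i)); last first.
  by apply/funext => p; rewrite /= !linearD !linearZ !mxE.
have mc (w : E -> W) : bdd_field dotW w ->
    measurable_fun setT (fun x => (v2r \o w) x ord0 i).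
  by move=> [mw _]; exact: (measurableT_comp (measurable_coord i) mw).
have m1 (h : E -> R) : measurable_fun setT h -> measurable_fun setT (fun p : E * E => h p.1).
  by move=> mh; exact: (measurableT_comp mh measurable_fst).
have m2 (h : E -> R) : measurable_fun setT h -> measurable_fun setT (fun p : E * E => h p.2).
  by move=> mh; exact: (measurableT_comp mh measurable_snd).
have [mg1 _] := bg1; have [mg2 _] := bg2.
apply: measurable_funD; first apply: measurable_funD.
- exact: (m1 _ (mc _ bw0)).
- by apply: measurable_funM; [exact: m1|exact: (m2 _ (mc _ bw1))].
- by apply: measurable_funM; [exact: m1|exact: (m2 _ (mc _ bw2))].
Qed.

Lemma bounded_two_scale : exists B, forall p, `|(F \o two_scale) p| <= B.
Proof.
have [C C0 FC] := lip_bound lF.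
have [_ [B0 w0B]] := bw0; have [_ [B1 w1B]] := bw1; have [_ [B2 w2B]] := bw2.
have [_ [D1 g1D]] := bg1; have [_ [D2 g2D]] := bg2.
exists (`|F 0| + C * (B0 + D1 * B1 + D2 * B2)) => p.
apply: le_trans (FC _) _; rewrite lerD2l ler_wpM2l //.
apply: le_trans (dnormD _ _ _) _; apply: lerD; last first.
  by rewrite dnormZ ler_pM ?dnorm_ge0.
apply: le_trans (dnormD _ _ _) _; apply: lerD => //.
by rewrite dnormZ ler_pM ?dnorm_ge0.
Qed.

End two_scale.

(** [N] is fixed by [osc_correct], then the shift by [shift_average]. The pointwise bound records
    what the mean of [F] alone would lose; it later bounds the mean norm of the field. *)
Lemma superpose (F : W -> R) (w0 w1 w2 : E -> W) (g1 g2 : E -> R) (delta : R) :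
  lip dotW F -> osc w0 -> osc w1 -> osc w2 -> tfun setT g1 -> tfun setT g2 -> 0 < delta ->
  exists w', [/\ osc w',
    mean (F \o w') <=
      mean (fun x => mean (fun z => F (two_scale w0 w1 w2 g1 g2 (x, z)))) + delta &
    exists (N : nat) s, forall x, dn (w' x) <=
      dn (two_scale w0 w1 w2 g1 g2 (x, N%:R *: x + s)) + delta].
Proof.
move=> lF ow0 ow1 ow2 tg1 tg2 delta0.
have [C C0 FC] := lF.
(* The two corrections move the field by at most [2 e], so [F] changes by at most
   [2 C e <= delta / 2]; the other half goes to the choice of the shift. *)
pose e := delta / (4 * (C + 1)).
have C1 : 0 < C + 1 by rewrite ltr_wpDl.
have e0 : 0 < e by rewrite divr_gt0 // mulr_gt0.
have eE : e * (4 * (C + 1)) = delta by rewrite /e divfK // gt_eqF // mulr_gt0.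
have [N1 N1P] := osc_correct dotW crA tg1 ow1 e0.
have [N2 N2P] := osc_correct dotW crA tg2 ow2 e0.
pose N := maxn N1 N2.
have bw0 := osc_bdd_field dotW ow0; have bw1 := osc_bdd_field dotW ow1.
have bw2 := osc_bdd_field dotW ow2.
have bg1 := bdd_measurable_tfun tg1; have bg2 := bdd_measurable_tfun tg2.
pose H := two_scale w0 w1 w2 g1 g2.
have mH : measurable_fun setT (F \o H) by exact: measurable_two_scale.
have bH : exists B, forall p, `|(F \o H) p| <= B by exact: bounded_two_scale.
have pH x : zperiodic (fun z => (F \o H) (x, z)).
  by move=> z y; rewrite /H /two_scale /= !(osc_zperiodic ow1) !(osc_zperiodic ow2).
have [s sP] := shift_average N mH bH pH (divr_gt0 delta0 (ltr0n R 2)).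
have [w1' ow1' w1E] := N1P N (leq_maxl _ _) s.
have [w2' ow2' w2E] := N2P N (leq_maxr _ _) s.
pose w' x := w0 x + w1' x + w2' x.
have ow' : osc w' by apply: oscD => //; exact: oscD.
have w'E x : dn (w' x - H (x, N%:R *: x + s)) <= e + e.
  have -> : w' x - H (x, N%:R *: x + s) = (w1' x - g1 x *: w1 (N%:R *: x + s)) +
      (w2' x - g2 x *: w2 (N%:R *: x + s)).
    rewrite /w' /H /two_scale /= !opprD.
    rewrite [LHS]addrACA; congr (_ + _).
    by rewrite addrACA subrr add0r.
  by apply: le_trans (dnormD _ _ _) _; exact: lerD.
exists w'; split => //.
  have bF' : bdd_measurable (fun x => (F \o H) (x, N%:R *: x + s)).
    split; last by have [B HB] := bH; exists B => x.
    have mp : measurable_fun setT (fun x : E => (x, N%:R *: x + s)).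
      apply/measurable_fun_pairP; split; first exact: measurable_id.
      exact: measurable_affine.
    exact: (measurableT_comp mH mp).
  apply: le_trans (_ : mean (fun x => (F \o H) (x, N%:R *: x + s) + delta / 2) <= _).
    apply: le_mean => [||x].
    - exact: (bdd_measurable_lip lF (osc_bdd_field dotW ow')).
    - by apply: bdd_measurableD => //; exact: bdd_measurable_cst.
    rewrite -lerBlDl; apply: le_trans (ler_norm _) _ => /=; apply: le_trans (FC _ _) _.
    apply: le_trans (ler_wpM2l C0 (w'E x)) _.
    have : 0 <= C * e by rewrite mulr_ge0 // ltW.
    by rewrite -eE; nra.
  rewrite meanD // ?mean_cst; last exact: bdd_measurable_cst.
  by rewrite {2}(splitr delta) addrA lerD2r.
exists N, s => x; rewrite -{1}(subrK (H (x, N%:R *: x + s)) (w' x)) addrC.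
apply: le_trans (dnormD _ _ _) _; rewrite lerD2l; apply: le_trans (w'E x) _.
have : 0 <= C * e by rewrite mulr_ge0 // ltW.
by rewrite -eE; nra.
Qed.

End superposition.

(** * Scalar profiles with frequencies on one line *)

Section profile.
Variables (R : realType) (d : nat).
Local Notation E := 'rV[R]_d.
Local Notation mu := (lebesgue_rV R d).
Variable q : 'rV[int]_d.
Hypothesis q0 : q != 0.

Definition multiples : set 'rV[int]_d := [set p | exists l : int, p = q *~ l].

Lemma multiples0 : multiples 0.
Proof. by exists 0; rewrite mulr0z. Qed.

Lemma multiplesD p p' : multiples p -> multiples p' -> multiples (p + p') /\ multiples (p' - p).
Proof.
move=> [l ->] [l' ->]; split; first by exists (l + l'); rewrite mulrzDr.
by exists (l' - l); rewrite mulrzBr.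
Qed.

Lemma tfun_sinz : tfun multiples (sinz q : E -> R).
Proof.
have -> : sinz q = mode q (- (pi / 2)) :> (E -> R).
  by apply/funext => x; rewrite sinz_mode.
by apply: tfun_mode; exists 1; rewrite mulr1z.
Qed.

(* A polynomial approximation of the sign function: [x |-> (3x - x^3)/2] is odd,
   maps [-1, 1] to itself and pushes it to the endpoints. *)
Definition smoothstep (x : R) : R := 2^-1 * (3 * x + - 1 * (x * (x * x))).

Definition profile n (x : E) : R := iter n smoothstep (sinz q x).

(** The squared cosine, equal to 1 exactly on the null set [sinz0 q]. The form [1 + - 1 * _] is the
    one that the closure lemmas of [tfun] produce. *)
Definition bump (x : E) : R := 1 + - 1 * (sinz q x * sinz q x).

Lemma tfun_profile n : tfun multiples (profile n).
Proof.
elim: n => [|n IHn]; first exact: tfun_sinz.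
have tM := tfunM multiples0 multiplesD.
apply: tfunZ; apply: tfunD; apply: tfunZ; first exact: IHn.
exact: (tM _ _ _ IHn (tM _ _ _ IHn IHn)).
Qed.

Lemma tfun_bump : tfun multiples bump.
Proof.
apply: tfunD; first exact: (tfun_cst multiples0).
by apply: tfunZ; apply: (tfunM multiples0 multiplesD); exact: tfun_sinz.
Qed.

Lemma profile_anti n x s : dotz q s = 2^-1 -> profile n (x + s) = - profile n x.
Proof.
move=> qs; elim: n => [|n IHn].
  rewrite /profile /= /sinz dotzDr qs mulrDr.
  have -> : pi *+ 2 * 2^-1 = pi :> R by field.
  exact: sinDpi.
by rewrite /profile /= -/(profile n _) IHn /smoothstep -/(profile n x); ring.
Qed.

Lemma bump_ge0 x : 0 <= bump x.
Proof.
have := sin_geN1 (pi *+ 2 * dotz q x); have := sin_le1 (pi *+ 2 * dotz q x).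
by rewrite /bump /sinz; nra.
Qed.

Lemma bump_le1 x : bump x <= 1.
Proof. by rewrite /bump mulN1r lerBlDr lerDl -expr2 sqr_ge0. Qed.

Lemma profile_bound n x : -1 <= profile n x <= 1.
Proof.
elim: n => [|n /andP[h1 h2]]; first by rewrite sin_geN1 sin_le1.
rewrite /profile /= -/(profile n x) /smoothstep.
move: (profile n x) h1 h2 => h h1 h2.
have f1 : 0 <= (1 - h) ^+ 2 * (2 + h) by rewrite mulr_ge0 ?sqr_ge0 //; lra.
have f2 : 0 <= (1 + h) ^+ 2 * (2 - h) by rewrite mulr_ge0 ?sqr_ge0 //; lra.
by apply/andP; split; lra.
Qed.

(** One smoothstep turns the gap [v] into [v^2 (3 + v) / 4 <= v^2]. Bounding one factor by [bump]
    and the other by the induction hypothesis gains one power, hence the two invariants. *)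
Lemma profile_gap n x : 1 - profile n x ^+ 2 <= bump x ^+ n.+1.
Proof.
suff : 1 - profile n x ^+ 2 <= bump x ^+ n.+1 /\ 1 - profile n x ^+ 2 <= bump x by case.
elim: n => [|n [IH1 IH2]].
  by rewrite expr1 /bump /profile /= expr2; split; lra.
have [h1 h2] := andP (profile_bound n x).
have b0 := bump_ge0 x; have b1 := bump_le1 x.
have vE : 1 - profile n.+1 x ^+ 2 =
    (1 - profile n x ^+ 2) ^+ 2 * (3 + (1 - profile n x ^+ 2)) / 4.
  by rewrite /profile /= -/(profile n x) /smoothstep; field.
have v0 : 0 <= 1 - profile n x ^+ 2 by nra.
move: vE; set v := 1 - profile n x ^+ 2 in IH1 IH2 v0 * => ->.
have v1 : v <= 1 by exact: le_trans IH2 b1.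
have le_v2 : v ^+ 2 * (3 + v) / 4 <= v * v by nra.
split; apply: le_trans le_v2 _; last by nra.
by rewrite exprS ler_pM.
Qed.

Lemma mean_profile0 n : mean (profile n) = 0.
Proof.
have bp : bdd_measurable (profile n) by apply: bdd_measurable_tfun (tfun_profile n).
have [s qs] := exists_shift (2^-1 : R) q0.
have pp : zperiodic (profile n) by have [t -> _] := tfun_profile n; exact: teval_zperiodic.
have := mean_translate s bp pp.
have -> : (fun x => profile n (x + s)) = (fun x => -1 * profile n x).
  by apply/funext => x; rewrite profile_anti // mulN1r.
rewrite meanZ //; lra.
Qed.

Lemma bdd_measurable_bumpX n : bdd_measurable (fun x => bump x ^+ n).
Proof. exact: bdd_measurable_tfun (tfunX multiples0 multiplesD n tfun_bump). Qed.

Lemma bump_lt1 x : ~ sinz0 q x -> bump x < 1.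
Proof.
move=> /eqP s0; rewrite /bump mulN1r ltrBlDr ltrDl -expr2.
by rewrite lt_def sqr_ge0 sqrf_eq0 s0.
Qed.

Lemma cvg_mean_bumpX : mean (fun x => bump x ^+ n) @[n --> \oo] --> (0 : R).
Proof.
apply: (@cvg_mean0 R d (fun n x => bump x ^+ n) 1 (sinz0 q)).
- exact: measurable_sinz0.
- exact: sinz0_null.
- by move=> n; case: (bdd_measurable_bumpX n).
- by move=> n x; rewrite normrX exprn_ile1 // ger0_norm ?bump_ge0 ?bump_le1.
- move=> x xZ; apply: cvg_expr; rewrite ger0_norm ?bump_ge0 //.
  exact: bump_lt1.
Qed.

End profile.

(** * Lamination and the envelope *)

Ltac bdd := repeat first [assumption | exact: bdd_measurable_cst
  | apply: bdd_measurableD | apply: bdd_measurableM].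

Section envelope.
Variables (R : realType) (d k : nat) (W X : vectType R) (dotW : {dot W for idfun}).
Variable A : multiindex d k -> 'Hom(W, X).
Hypothesis crA : constant_rank A.
Local Notation E := 'rV[R]_d.
Local Notation mu := (lebesgue_rV R d).
Local Notation dn := (dnorm dotW).
Local Notation osc := (osc A).
Local Notation lip := (lip dotW).

(* An antiperiodic scalar function has no constant mode. *)
Lemma osc_profile (q : 'rV[int]_d) e n : q != 0 -> e \in lker (symbol A (zvec R q)) ->
  osc (fun x => profile q n x *: e).
Proof.
move=> q0 qe; have [s qs] := exists_shift (2^-1 : R) q0.
(* For the antiperiodic [profile] this difference is twice the function, and for any [g] the zero
   frequency cancels in it. *)
suff h (g : E -> R) : tfun (multiples q) g -> osc (fun x => (g x - g (x + s)) *: e).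
  have := oscZ 2^-1 (h _ (tfun_profile R q n)); congr osc; apply/funext => x.
  by rewrite profile_anti // scalerA; congr (_ *: _); field.
elim/tfun_ind: g / => [|p c a g [l pl] IHg].
  have := osc0 A; congr osc; apply/funext => x.
  by rewrite subrr scale0r.
have [p0|p0] := eqVneq p 0.
  have := IHg; congr osc; apply/funext => x.
  by rewrite p0 /mode !dotz0l; congr (_ *: _); ring.
have pe : e \in lker (symbol A (zvec R p)).
  have -> : zvec R p = l%:~R *: zvec R q :> E.
    by rewrite pl /zvec raddfMz scaler_int.
  exact: lker_symbolZ.
have o1 := oscZ a (osc_mode c p0 pe).
have o2 := oscZ (- a) (osc_mode (c + pi *+ 2 * dotz p s) p0 pe).
have := oscD (oscD o1 o2) IHg; congr osc; apply/funext => x.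
rewrite !scalerA -!scalerDl; congr (_ *: _).
have -> : mode p (c + pi *+ 2 * dotz p s) x = mode p c (x + s).
  by rewrite /mode dotzDr; congr cos; ring.
ring.
Qed.

Section lamination.
Variables (F : W -> R) (C : R).
Hypotheses (C0 : 0 <= C) (FC : forall u v, `|F u - F v| <= C * dn (u - v)).

Let lF : lip F. Proof. by exists C. Qed.

(** The point is within [(1 - h) B] of [e + u] and within [(1 + h) B] of [- e + v]; with the weights
    [(1 + h) / 2] and [(1 - h) / 2] the two errors add up to [C B (1 - h^2)]. *)
Lemma lamination_bound (h B : R) (e u v : W) : -1 <= h <= 1 ->
  dn e + dn u + dn v <= B ->
  F (h *: e + ((1 + h) / 2) *: u + ((1 - h) / 2) *: v) <=
  (1 + h) / 2 * F (e + u) + (1 - h) / 2 * F (- e + v) + C * B * (1 - h ^+ 2).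
Proof.
move=> /andP[h1 h2] eB; set y := _ + _ *: v.
have p0 : 0 <= (1 + h) / 2 by lra.
have m0 : 0 <= (1 - h) / 2 by lra.
have du := dnorm_ge0 dotW u; have dv := dnorm_ge0 dotW v; have de := dnorm_ge0 dotW e.
have d1 : dn (y - (e + u)) <= (1 - h) * B.
  have -> : y - (e + u) = (h - 1) *: e + ((h - 1) / 2) *: u + ((1 - h) / 2) *: v.
    rewrite /y opprD addrAC addrACA; congr (_ + _ + _).
      by rewrite scalerBl scale1r.
    by rewrite -[- u]scaleN1r -scalerDl; congr (_ *: _); field.
  apply: le_trans (dnormD _ _ _) _; apply: le_trans (lerD (dnormD _ _ _) (lexx _)) _.
  rewrite !dnormZ [`|(1 - h) / 2|]ger0_norm // ler0_norm; last by lra.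
  by rewrite ler0_norm; [nra|lra].
have d2 : dn (y - (- e + v)) <= (1 + h) * B.
  have -> : y - (- e + v) = (h + 1) *: e + ((1 + h) / 2) *: u + (- ((1 + h) / 2)) *: v.
    rewrite /y opprD opprK addrACA [_ + _ *: u + e]addrAC; congr (_ + _ + _).
      by rewrite scalerDl scale1r.
    by rewrite -[- v]scaleN1r -scalerDl; congr (_ *: _); field.
  apply: le_trans (dnormD _ _ _) _; apply: le_trans (lerD (dnormD _ _ _) (lexx _)) _.
  rewrite !dnormZ normrN [`|(1 + h) / 2|]ger0_norm // ger0_norm; last by lra.
  by nra.
have f1 : F y <= F (e + u) + C * ((1 - h) * B).
  rewrite -lerBlDl; apply: le_trans (ler_norm _) _; apply: le_trans (FC _ _) _.
  exact: ler_wpM2l.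
have f2 : F y <= F (- e + v) + C * ((1 + h) * B).
  rewrite -lerBlDl; apply: le_trans (ler_norm _) _; apply: le_trans (FC _ _) _.
  exact: ler_wpM2l.
have := lerD (ler_wpM2l p0 f1) (ler_wpM2l m0 f2).
have -> : (1 + h) / 2 * F y + (1 - h) / 2 * F y = F y by field.
move=> le_y; apply: le_trans le_y _; rewrite le_eqVlt; apply/orP; left; apply/eqP.
by field.
Qed.

(** The profile [h] is near 1 and near -1 on two halves of the cube: [h e] passes between the two
    values, [w1] is switched on where [h] is near 1 and [w2] where it is near -1. *)
Lemma laminate (q : 'rV[int]_d) e w1 w2 (delta : R) : q != 0 ->
  e \in lker (symbol A (zvec R q)) -> osc w1 -> osc w2 -> 0 < delta ->
  exists2 w, osc w & mean (F \o w) <=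
    2^-1 * mean (fun x => F (e + w1 x)) + 2^-1 * mean (fun x => F (- e + w2 x)) + delta.
Proof.
move=> q0 qe ow1 ow2 delta0.
have bw1 := osc_bdd_field dotW ow1; have bw2 := osc_bdd_field dotW ow2.
have [_ [B1 w1B]] := bw1; have [_ [B2 w2B]] := bw2.
pose B := `|dn e + B1 + B2|.
have [n nP] : exists n, C * B * mean (fun x : E => 1 - profile q n x ^+ 2) <= delta / 2.
  have CB : 0 <= C * B by rewrite mulr_ge0 ?normr_ge0.
  have D0 : 0 < 2 * (C * B + 1) by rewrite mulr_gt0 // ltr_wpDl.
  have cv : mean (fun x : E => bump q x ^+ n) @[n --> \oo] --> (0 : R).
    exact: cvg_mean_bumpX.
  have /cvgrPdist_lt/(_ _ (divr_gt0 delta0 D0))[N _ NP] := cv.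
  exists N; have := NP N.+1 (leqnSn N).
  rewrite sub0r normrN => /(le_lt_trans (ler_norm _)) small.
  apply: le_trans (_ : C * B * mean (fun x : E => bump q x ^+ N.+1) <= _).
    apply: ler_wpM2l => //; apply: le_mean; last exact: profile_gap.
      apply: bdd_measurableB; first exact: bdd_measurable_cst.
      exact: bdd_measurable_tfun (tfunX (multiples0 q) (@multiplesD _ q) 2 (tfun_profile R q N)).
    exact: bdd_measurable_bumpX.
  have m0 : 0 <= mean (fun x : E => bump q x ^+ N.+1).
    by apply: mean_ge0 => x; rewrite exprn_ge0 // bump_ge0.
  move: small; rewrite ltr_pdivlMr ?mulr_gt0 ?ltr_wpDl // ler_pdivlMr //; nra.
pose h := profile q n : E -> R.
have th : tfun setT h by exact: tfunT (tfun_profile R q n).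
have setT0 : @setT 'rV[int]_d 0 by [].
have setTD (p p' : 'rV[int]_d) : setT p -> setT p' -> setT (p + p') /\ setT (p' - p) by [].
have tg (a : R) : tfun setT (fun x => (1 + a * h x) / 2).
  have := tfunZ 2^-1 (tfunD (tfun_cst setT0 1) (tfunZ a th)).
  by congr (tfun _ _); apply/funext => x; rewrite mulrC.
pose g1 x := (1 + h x) / 2; pose g2 x := (1 - h x) / 2.
have tg1 : tfun setT g1.
  by have := tg 1; congr (tfun _ _); apply/funext => x; rewrite mul1r.
have tg2 : tfun setT g2.
  by have := tg (- 1); congr (tfun _ _); apply/funext => x; rewrite mulN1r.
have ow0 := osc_profile n q0 qe.
have [w [ow wF _]] := superpose crA lF ow0 ow1 ow2 tg1 tg2 (divr_gt0 delta0 (ltr0n R 2)).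
exists w => //; apply: le_trans wF _; rewrite [in leRHS](splitr delta) addrA lerD2r.
have bw0 := osc_bdd_field dotW ow0.
have bg1 := bdd_measurable_tfun tg1; have bg2 := bdd_measurable_tfun tg2.
have bF1 : bdd_measurable (fun x => F (e + w1 x)).
  exact: (bdd_measurable_lip (lip_shift e lF) bw1).
have bF2 : bdd_measurable (fun x => F (- e + w2 x)).
  exact: (bdd_measurable_lip (lip_shift (- e) lF) bw2).
set M1 := mean (fun x => F (e + w1 x)); set M2 := mean (fun x => F (- e + w2 x)).
have bgap : bdd_measurable (fun x => 1 - h x ^+ 2).
  apply: bdd_measurableB; first exact: bdd_measurable_cst.
  exact: bdd_measurable_tfun (tfunX setT0 setTD 2 th).
(* The mean of [lamination_bound] in the fast variable. Since [h] has mean zero, both weights have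
   mean [2^-1] in the slow one. *)
pose rhs x := g1 x * M1 + g2 x * M2 + C * B * (1 - h x ^+ 2).
have brhs : bdd_measurable rhs.
  apply: bdd_measurableD; first apply: bdd_measurableD.
  - by apply: bdd_measurableM => //; exact: bdd_measurable_cst.
  - by apply: bdd_measurableM => //; exact: bdd_measurable_cst.
  - by apply: bdd_measurableM => //; exact: bdd_measurable_cst.
have inner x : mean (fun z => F (two_scale (fun x => profile q n x *: e) w1 w2 g1 g2 (x, z))) <= rhs x.
  have -> : rhs x = mean (fun z => g1 x * F (e + w1 z) + g2 x * F (- e + w2 z) +
      C * B * (1 - h x ^+ 2)).
    rewrite !meanD ?meanZ ?mean_cst //; try (exact: bdd_measurable_cst);
      by bdd.
  apply: le_mean => [||z].
  - split.
      exact: (measurableT_comp (measurable_two_scale lF bw0 bw1 bw2 bg1 bg2)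
        (measurable_pair1 x)).
    have [B' HB'] := bounded_two_scale lF bw0 bw1 bw2 bg1 bg2.
    by exists B' => z; exact: HB'.
  - by bdd.
  rewrite /two_scale /=; apply: lamination_bound; first exact: profile_bound.
  apply: le_trans (ler_norm _); rewrite lerD // lerD2l; exact: w1B.
apply: (@le_trans _ _ (mean rhs)).
  apply: le_Rintegral.
  - exact: measurable_cube.
  - exact: (integrable_mean (measurable_two_scale lF bw0 bw1 bw2 bg1 bg2)
      (bounded_two_scale lF bw0 bw1 bw2 bg1 bg2)).
  - exact: integrable_unit_cube.
  - by move=> x _; exact: inner.
have mg1 : mean g1 = 2^-1.
  have -> : g1 = (fun x => 2^-1 * (1 + h x)) by apply/funext => x; rewrite mulrC.
  have bh := bdd_measurable_tfun th.
  rewrite meanZ; last by apply: bdd_measurableD => //; exact: bdd_measurable_cst.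
  rewrite meanD //; last exact: bdd_measurable_cst.
  by rewrite mean_cst mean_profile0 // addr0 mulr1.
have mg2 : mean g2 = 2^-1.
  have -> : g2 = (fun x => 1 + - 1 * g1 x) by apply/funext => x; rewrite /g1 /g2; field.
  rewrite meanD; [|exact: bdd_measurable_cst|]; last first.
    by apply: bdd_measurableM => //; exact: bdd_measurable_cst.
  by rewrite mean_cst meanZ // mg1; field.
have -> : rhs = (fun x => M1 * g1 x + M2 * g2 x + C * B * (1 - h x ^+ 2)).
  by apply/funext => x; rewrite /rhs ![_ * M1]mulrC ![_ * M2]mulrC.
rewrite !meanD ?meanZ //; try by bdd.
by rewrite mg1 mg2 [M1 * _]mulrC [M2 * _]mulrC lerD2l.
Qed.

End lamination.

Variable L : {vspace W}.
Local Notation dist := (dist_to dotW L).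

Definition gap_fun (c : R) (v : W) : R := dist v + - c * dn v.

Lemma lip_gap c : lip (gap_fun c).
Proof. by apply: lipD; [exact: lip_dist|apply: lipZ; exact: lip_dnorm]. Qed.

Lemma gap_funZ c t v : 0 < t -> gap_fun c (t *: v) = t * gap_fun c v.
Proof. by move=> t0; rewrite /gap_fun distZ // dnormZ gtr0_norm //; ring. Qed.

Section nonneg.
Variable c : R.
Hypothesis gap_ge0 : forall w, osc w -> 0 <= mean (gap_fun c \o w).
Local Notation f := (gap_fun c).

Definition envelope (y : W) : R := inf [set mean (fun x => f (y + w x)) | w in osc].

Let bf y w : osc w -> bdd_measurable (fun x => f (y + w x)).
Proof. by move=> ow; exact: (bdd_measurable_lip (lip_shift y (lip_gap c)) (osc_bdd_field dotW ow)). Qed.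

Lemma mean_gap_shift : exists2 C, 0 <= C & forall y y' w, osc w ->
  mean (fun x => f (y + w x)) <= mean (fun x => f (y' + w x)) + C * dn (y - y').
Proof.
have [C C0 fC] := lip_gap c; exists C => // y y' w ow.
rewrite -(mean_cst d (C * _)) -meanD; [|exact: bf|exact: bdd_measurable_cst].
apply: le_mean => [||x]; [exact: bf|by apply: bdd_measurableD; [exact: bf|exact: bdd_measurable_cst]|].
rewrite -lerBlDl; apply: le_trans (ler_norm _) _; apply: le_trans (fC _ _) _.
by rewrite opprD addrACA subrr addr0.
Qed.

(** Boundedness below is inherited from [y = 0], where the means are nonnegative, through the
    Lipschitz bound. *)
Lemma envelope_has_inf y : has_inf [set mean (fun x => f (y + w x)) | w in osc].
Proof.
split; first by eexists; exists (fun=> 0) => //; exact: osc0.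
have [C C0 fC] := mean_gap_shift; exists (- (C * dn (0 - y))) => _ [w ow <-].
rewrite lerNl -subr_ge0 opprK addrC.
apply: le_trans (fC 0 y w ow); have := gap_ge0 ow; congr (_ <= mean _).
by apply/funext => x; rewrite /= add0r.
Qed.

Lemma envelope_le y w : osc w -> envelope y <= mean (fun x => f (y + w x)).
Proof. by move=> ow; apply: ge_inf; [have [] := envelope_has_inf y|exists w]. Qed.

Lemma envelope_ge y a : (forall w, osc w -> a <= mean (fun x => f (y + w x))) -> a <= envelope y.
Proof.
move=> h; apply: lb_le_inf; first by have [] := envelope_has_inf y.
by move=> _ [w ow <-]; exact: h.
Qed.

Lemma envelope_le_self y : envelope y <= f y.
Proof.
apply: le_trans (envelope_le y (osc0 A)) _.
by under eq_fun do rewrite addr0; rewrite mean_cst.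
Qed.

Lemma envelope_homog_le t y : 0 < t -> envelope (t *: y) <= t * envelope y.
Proof.
move=> t0; rewrite -ler_pdivrMl //; apply: envelope_ge => w ow.
rewrite ler_pdivrMl // -meanZ; last exact: bf.
apply: le_trans (envelope_le _ (oscZ t ow)) _.
by under eq_fun do rewrite -scalerDr gap_funZ //.
Qed.

Lemma cone_convex_envelope : cone_convex dotW (wave_cone A) envelope.
Proof.
have [C C0 fC] := mean_gap_shift.
split.
- have h x y : envelope x - envelope y <= C * dn (x - y).
    rewrite lerBlDl -lerBlDr; apply: envelope_ge => w ow.
    by rewrite lerBlDr; apply: le_trans (envelope_le x ow) (fC _ _ _ ow).
  exists C => // u v; rewrite ler_norml lerNl opprB h andbT.
  by rewrite dnorm_sym h.
- move=> t y t0; apply/eqP; rewrite eq_le envelope_homog_le //=.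
  rewrite -ler_pdivlMl // -{1}[y](scalerK (lt0r_neq0 t0)).
  by rewrite envelope_homog_le // invr_gt0.
- move=> y e eL.
  have mid w1 w2 : osc w1 -> osc w2 -> envelope y *+ 2 <=
      mean (fun x => f (y + e + w1 x)) + mean (fun x => f (y - e + w2 x)).
    move=> ow1 ow2; apply/ler_addgt0Pr => eta eta0.
    (* Replacing [e] by [e'] costs [C * del] in each of the two means and [laminate] costs [del];
       after doubling, the total is [2 (C + 1) del = eta]. *)
    pose del := eta / (2 * (C + 1)).
    have C1 : 0 < 2 * (C + 1) by rewrite mulr_gt0 // ltr_wpDl.
    have del0 : 0 < del by exact: divr_gt0.
    have delE : del * (2 * (C + 1)) = eta by rewrite /del divfK // gt_eqF.
    have [q [e' [q0 qe' e'e]]] := wave_cone_approx dotW crA eL del0.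
    have [D D0 fD] := lip_shift y (lip_gap c).
    have [w ow wE] := laminate D0 fD q0 qe' ow1 ow2 del0.
    have := envelope_le y ow; have := fC (y + e') (y + e) _ ow1.
    have := fC (y - e') (y - e) _ ow2.
    have -> : y - e' - (y - e) = - (e' - e).
      by rewrite !opprB addrC addrA subrK.
    have -> : y + e' - (y + e) = e' - e.
      by rewrite opprD addrACA subrr add0r.
    rewrite dnormN => h2 h1 h0.
    have Ce : C * dn (e' - e) <= C * del by exact: ler_wpM2l.
    have wE' : mean (fun x => f (y + w x)) <= 2^-1 * mean (fun x => f (y + e' + w1 x)) +
        2^-1 * mean (fun x => f (y - e' + w2 x)) + del.
      apply: le_trans wE _; rewrite lerD2r.
      by apply: lerD; rewrite le_eqVlt; apply/orP; left; apply/eqP;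
        congr (_ * mean _); apply/funext => x; rewrite addrA.
    by rewrite mulr2n; nra.
  rewrite -lerBlDr; apply: envelope_ge => w1 ow1.
  rewrite lerBlDl -lerBlDr; apply: envelope_ge => w2 ow2.
  by have := mid w1 w2 ow1 ow2; lra.
Qed.

End nonneg.

Lemma wave_coneZ t e : wave_cone A e -> wave_cone A (t *: e).
Proof. by move=> [xi xi0 exi]; exists xi => //; rewrite rpredZ. Qed.

Lemma exists_gap_neg (c : R) v : 0 < c -> v \in L -> v != 0 -> span_of (wave_cone A) v ->
  exists2 w, osc w & mean (gap_fun c \o w) < 0.
Proof.
move=> c0 vL v0 [l lD vl]; apply: contrapT => noW.
have gap_ge0 w : osc w -> 0 <= mean (gap_fun c \o w).
  by move=> ow; rewrite leNgt; apply/negP => w0; apply: noW; exists w.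
have := cone_convex_span (@wave_coneZ) lD (cone_convex_envelope gap_ge0) vl.
have := envelope_le_self gap_ge0 v; have := envelope_le_self gap_ge0 (- v).
rewrite /gap_fun dnormN !dist_eq0 ?rpredN // !add0r.
have : 0 < c * dn v by rewrite mulr_gt0 // dnorm_gt0.
lra.
Qed.

End envelope.

(** * Concentration *)

Section amplitude.
Variables (R : realType) (d : nat).
Local Notation E := 'rV[R]_d.
Local Notation mu := (lebesgue_rV R d).
Variable q : 'rV[int]_d.
Hypothesis q0 : q != 0.

(** [bump] exceeds [r] on a small cube at the origin, and [m] is the volume of that cube: the means
    of the powers decay more slowly than any geometric sequence. *)
Lemma mean_bumpX_ge (r : R) : 0 <= r -> r < 1 ->
  exists2 m, 0 < m & forall n, r ^+ n * m <= mean (fun x : E => bump q x ^+ n).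
Proof.
move=> r0 r1.
have bC : continuous (bump q : E -> R).
  have sC : continuous (sinz q : E -> R).
    rewrite (_ : sinz q = mode q (- (pi / 2))); first exact: continuous_mode.
    by apply/funext => x; rewrite sinz_mode.
  apply: continuous_addR; first exact: continuous_cstR.
  apply: continuous_mulR; first exact: continuous_cstR.
  exact: continuous_mulR.
have b0 : bump q (0 : E) = 1.
  by rewrite /bump /sinz -(scale0r 0) dotzZr mul0r mulr0 sin0 mulr0 mulr0 addr0.
have /nbhs_ballP[e /= e0 eb] : \forall x \near (0 : E), r < bump q x.
  have := bC 0; rewrite /continuous_at b0 => /cvgr_gt; exact.
pose l := Num.min (e / 2) 1.
have l0 : 0 < l by rewrite lt_min divr_gt0 ?ltr01.
have l1 : l <= 1 by rewrite ge_min lexx orbT.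
have le : l < e by rewrite gt_min ltr_pdivrMr // ltr_pMr // ltr1n.
have cb x : cube 0 l x -> r <= bump q x.
  move=> xl; apply/ltW/eb; rewrite mx_norm_ball /ball_ /= sub0r normrN.
  apply: le_lt_trans le; rewrite [leLHS]/Num.norm /= mx_normrE.
  apply: bigmax_le => [|[i j] _]; first exact: ltW.
  rewrite /= (ord1 i); have := xl j; rewrite !mxE add0r => /andP[x1 x2].
  by rewrite gtr0_norm.
exists (l ^+ d) => [|n]; first exact: exprn_gt0.
have mC := measurable_cube (0 : E) l.
have bi := bdd_measurable_indic mC.
have -> : l ^+ d = mean (\1_(cube (0 : E) l)).
  rewrite /mean /Rintegral integral_indic //; last exact: measurable_cube.
  rewrite setIidl; first by rewrite [X in fine X](measure_cube 0 (ltW l0)).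
  move=> x xl i; have := xl i; rewrite !mxE !add0r => /andP[-> x2].
  exact: le_trans x2 l1.
rewrite -meanZ //; apply: le_mean => [||x].
- by apply: bdd_measurableM => //; exact: bdd_measurable_cst.
- exact: bdd_measurable_bumpX.
rewrite indicE; case: (boolP (x \in _)) => [|_]; last by rewrite mulr0 exprn_ge0 ?bump_ge0.
rewrite inE mulr1 => /cb rb; apply: lerXn2r => //.
by rewrite nnegrE bump_ge0.
Qed.

(** Normalized powers of [bump] tend to 0 off a null set while keeping mean 1; truncation at [lam]
    makes dominated convergence applicable. *)
Lemma concentrated_amplitude (B lam eta : R) : 0 <= B -> 0 < lam -> 0 < eta ->
  exists g : E -> R, [/\ tfun setT g, forall x, 0 <= g x, mean g = 1 &
    mean (fun x => Num.min (g x * B) lam) <= eta].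
Proof.
move=> B0 lam0 eta0.
have setT0 : @setT 'rV[int]_d 0 by [].
pose M n := mean (fun x : E => bump q x ^+ n).
have M0 n : 0 < M n.
  have h0 : 0 <= 2^-1 :> R by rewrite invr_ge0.
  have h1 : 2^-1 < 1 :> R by lra.
  have [m m0 mP] := mean_bumpX_ge h0 h1.
  by apply: lt_le_trans (mP n); rewrite mulr_gt0 // exprn_gt0 // invr_gt0.
pose g n (x : E) := (M n)^-1 * bump q x ^+ n.
have tg n : tfun setT (g n).
  by apply: tfunZ; exact: tfunT (tfunX (multiples0 q) (@multiplesD _ q) n (tfun_bump R q)).
have g0 n x : 0 <= g n x.
  by rewrite mulr_ge0 ?exprn_ge0 ?bump_ge0 // invr_ge0 ltW.
pose F n x := Num.min (g n x * B) lam.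
have F0 n x : 0 <= F n x by rewrite le_min mulr_ge0 // ltW.
have Fcvg : mean (F n) @[n --> \oo] --> (0 : R).
  apply: (@cvg_mean0 R d F lam (sinz0 q)).
  - exact: measurable_sinz0.
  - exact: sinz0_null.
  - move=> n; apply: measurable_minr; last exact: measurable_cst.
    apply: measurable_funM; last exact: measurable_cst.
    by case: (bdd_measurable_tfun (tg n)).
  - by move=> n x; rewrite ger0_norm // ge_min lexx orbT.
  move=> x xZ; have b1 := bump_lt1 xZ; have b0 := bump_ge0 q x.
  (* Any [r] strictly between [bump q x] and 1 works: the normalization is at least [r^n m], so the
     amplitude at [x] is at most [(bump q x / r)^n / m]. *)
  pose r := (1 + bump q x) / 2.
  have r1 : r < 1 by rewrite /r; lra.
  have rb : bump q x < r by rewrite /r; lra.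
  have r0 : 0 < r by exact: le_lt_trans rb.
  have [m m0 mP] := mean_bumpX_ge (ltW r0) r1.
  apply: (@squeeze_cvgr _ _ _ _ (fun=> 0) (fun n => (B / m) * (bump q x / r) ^+ n)).
  - apply: nearW => n; rewrite F0 /=; apply: le_trans (_ : g n x * B <= _).
      by rewrite ge_min lexx.
    have -> : B / m * (bump q x / r) ^+ n = (r ^+ n * m)^-1 * bump q x ^+ n * B.
      by rewrite expr_div_n invfM; ring.
    rewrite /g ler_wpM2r // ler_wpM2r ?exprn_ge0 //.
    by rewrite lef_pV2 ?posrE ?mulr_gt0 ?exprn_gt0.
  - exact: cvg_cst.
  - rewrite -[X in _ --> X](mulr0 (B / m)); apply: cvgM; first exact: cvg_cst.
    apply: cvg_expr; rewrite (ger0_norm (divr_ge0 b0 (ltW r0))).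
    by rewrite ltr_pdivrMr // mul1r.
have /cvgrPdist_lt/(_ _ eta0)[N _ NP] := Fcvg.
exists (g N); split => //.
  rewrite /g meanZ; last exact: bdd_measurable_bumpX.
  by rewrite -/(M N) mulVf // gt_eqF.
have := NP N (leqnn N); rewrite sub0r normrN => /(le_lt_trans (ler_norm _)).
exact: ltW.
Qed.

End amplitude.

Section concentration.
Variables (R : realType) (d k : nat) (W X : vectType R) (dotW : {dot W for idfun}).
Variables (A : multiindex d k -> 'Hom(W, X)) (L : {vspace W}).
Hypothesis crA : constant_rank A.
Local Notation E := 'rV[R]_d.
Local Notation dn := (dnorm dotW).
Local Notation osc := (osc A).
Local Notation dist := (dist_to dotW L).

Lemma osc_bdd_dnorm w : osc w -> bdd_measurable (dn \o w).
Proof. by move=> ow; exact: (bdd_measurable_lip (lip_dnorm dotW) (osc_bdd_field dotW ow)). Qed.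

Lemma osc_bdd_dist w : osc w -> bdd_measurable (dist \o w).
Proof. by move=> ow; exact: (bdd_measurable_lip (lip_dist dotW L) (osc_bdd_field dotW ow)). Qed.

Lemma osc_bdd_min lam w : osc w -> bdd_measurable (fun x => Num.min (dn (w x)) lam).
Proof.
by move=> ow; exact: (bdd_measurable_lip (lip_min lam (lip_dnorm dotW)) (osc_bdd_field dotW ow)).
Qed.

(** If [dist - eps * dn + Num.min dn lam] has negative mean, then the mean distance and the mean
    truncated norm are both below [eps] times the mean norm; dividing by the mean norm finishes. *)
Lemma exists_concentrated (v : W) (eps : R) : v \in L -> v != 0 -> span_of (wave_cone A) v ->
  0 < eps -> exists w : E -> W, [/\ osc w, mean (dn \o w) = 1, mean (dist \o w) <= eps &
    mean (fun x => Num.min (dn (w x)) eps^-1) <= eps].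
Proof.
move=> vL v0 vA eps0.
have [q q0] : exists q : 'rV[int]_d, q != 0.
  have [l lA vl] := vA; case: l lA vl => [|e l] lA vl.
    by move: vl v0; rewrite span_nil memv0 => ->.
  have eA := lA e (mem_head _ _).
  by have [q [e' [q0 _ _]]] := wave_cone_approx dotW crA eA ltr01; exists q.
have [w ow wneg] := exists_gap_neg dotW crA eps0 vL v0 vA.
have [_ [B wB]] := osc_bdd_field dotW ow.
have B0 : 0 <= B by exact: le_trans (dnorm_ge0 _ _) (wB 0).
pose a := - mean (gap_fun dotW L eps \o w).
have a0 : 0 < a by rewrite oppr_gt0.
(* The final division is by a mean norm [m <= B + 1], so a truncation at [lam] becomes one at level
   at least [eps^-1]. *)
pose lam := (B + 1) / eps.
have lam0 : 0 < lam by rewrite divr_gt0 // ltr_wpDl.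
have a4 : 0 < a / 4 by rewrite divr_gt0.
have [g [tg g0 mg gmin]] := concentrated_amplitude q0 B0 lam0 a4.
pose F u := gap_fun dotW L eps u + Num.min (dn u) lam.
have lF : lip dotW F.
  by apply: lipD; [exact: lip_gap|apply: lip_min; exact: lip_dnorm].
have del0 : 0 < Num.min (a / 4) 1 by rewrite lt_min a4 ltr01.
have setT0 : @setT 'rV[int]_d 0 by [].
have t0 : tfun setT (fun _ : E => 0 : R) by exact: tfun_cst.
have [w' [ow' w'F [N [s w'B]]]] := superpose crA lF (osc0 A) ow (osc0 A) tg t0 del0.
have tsE x z : two_scale (fun=> 0) w (fun=> 0) g (fun=> 0) (x, z) = g x *: w z.
  by rewrite /two_scale /= add0r scaler0 addr0.
have bg := bdd_measurable_tfun tg.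
have bmin : bdd_measurable (fun x => Num.min (g x * B) lam).
  have [mg' [D gD]] := bg; split.
    apply: measurable_minr; last exact: measurable_cst.
    by apply: measurable_funM => //; exact: measurable_cst.
  exists lam => x; have h : 0 <= Num.min (g x * B) lam by rewrite le_min mulr_ge0 //= ltW.
  by rewrite (ger0_norm h) ge_min lexx orbT.
have bgap : bdd_measurable (gap_fun dotW L eps \o w).
  exact: (bdd_measurable_lip (lip_gap dotW L eps) (osc_bdd_field dotW ow)).
have w'neg : mean (F \o w') < 0.
  apply: le_lt_trans w'F _.
  (* By homogeneity the fast mean of the gap function of [g x *: w z] is [- a * g x]. As [g] has
     mean 1, the total is at most [- a + a / 4 + a / 4]. *)
  apply: le_lt_trans (_ : mean (fun x => - a * g x + Num.min (g x * B) lam) + a / 4 < _).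
    apply: lerD; last by rewrite ge_min lexx.
    apply: le_Rintegral.
    - exact: measurable_cube.
    - have bw := osc_bdd_field dotW ow; have b0 := osc_bdd_field dotW (osc0 A).
      have bz := bdd_measurable_tfun t0.
      exact: (integrable_mean (measurable_two_scale lF b0 bw b0 bg bz)
        (bounded_two_scale lF b0 bw b0 bg bz)).
    - apply: integrable_unit_cube; apply: bdd_measurableD => //; apply: bdd_measurableM => //; exact: bdd_measurable_cst.
    move=> x _; under eq_fun do rewrite tsE.
    have -> : - a * g x + Num.min (g x * B) lam =
        mean (fun z => g x * (gap_fun dotW L eps \o w) z + Num.min (g x * B) lam).
      rewrite meanD ?meanZ ?mean_cst //; last exact: bdd_measurable_cst.
        by rewrite /a opprK mulrC.
      by bdd.
    apply: le_mean => [||z].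
    - apply: (bdd_measurable_lip lF (w := fun z => g x *: w z)).
      exact: (osc_bdd_field dotW (oscZ (g x) ow)).
    - by bdd.
    rewrite /F /=; apply: lerD.
      (* [gap_funZ] is for positive factors only. *)
      have [->|gx0] := eqVneq (g x) 0.
        rewrite scale0r mul0r /gap_fun dnorm0 mulr0 addr0.
        by rewrite dist_eq0 // mem0v.
      by rewrite gap_funZ // lt_def gx0 g0.
    rewrite dnormZ ger0_norm // le_min !ge_min lexx orbT andbT.
    by rewrite ler_wpM2l.
  rewrite meanD ?meanZ //; last by bdd.
  rewrite mg mulr1; move: gmin a0; lra.
have bd' := osc_bdd_dist ow'; have bn' := osc_bdd_dnorm ow'; have bm' := osc_bdd_min lam ow'.
pose m := mean (dn \o w').
have FE : mean (F \o w') = mean (dist \o w') - eps * m + mean (fun x => Num.min (dn (w' x)) lam).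
  rewrite /F /gap_fun.
  have -> : (fun u => dist u + - eps * dn u + Num.min (dn u) lam) \o w' =
      (fun x => (dist \o w') x + - eps * (dn \o w') x + Num.min (dn (w' x)) lam) by [].
  rewrite meanD //; last by bdd.
  by rewrite meanD ?meanZ ?mulNr //; bdd.
have d0 : 0 <= mean (dist \o w') by apply: mean_ge0 => x; exact: dist_ge0.
have n0 : 0 <= mean (fun x => Num.min (dn (w' x)) lam).
  by apply: mean_ge0 => x; rewrite le_min dnorm_ge0 ltW.
have m0 : 0 < m.
  by rewrite -(pmulr_rgt0 _ eps0); move: w'neg; rewrite FE; lra.
(* This comes from the pointwise bound of [superpose]: [dn (w' x)] is at most [g x * B + 1], and [g]
   has mean 1. *)
have mB : m <= B + 1.
  apply: le_trans (_ : mean (fun x => B * g x + 1) <= _).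
    apply: le_mean => // [|x]; first by bdd.
    apply: le_trans (w'B x) _; rewrite tsE; apply: lerD; last by rewrite ge_min lexx orbT.
    by rewrite dnormZ ger0_norm // mulrC ler_wpM2r.
  by rewrite meanD ?meanZ ?mean_cst ?mg ?mulr1 //; bdd.
exists (fun x => m^-1 *: w' x).
have ow'' := oscZ m^-1 ow'.
have m'0 : 0 < m^-1 by rewrite invr_gt0.
split => //.
- have -> : dn \o (fun x => m^-1 *: w' x) = (fun x => m^-1 * (dn \o w') x).
    by apply/funext => x; rewrite /= dnormZ gtr0_norm.
  by rewrite meanZ // mulVf // gt_eqF.
- have -> : dist \o (fun x => m^-1 *: w' x) = (fun x => m^-1 * (dist \o w') x).
    by apply/funext => x; rewrite /= distZ.
  by rewrite meanZ // ler_pdivrMl // mulrC; move: w'neg; rewrite FE; lra.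
apply: le_trans (_ : mean (fun x => m^-1 * Num.min (dn (w' x)) lam) <= _).
  apply: le_mean => [||x]; first exact: osc_bdd_min.
    by bdd.
  rewrite dnormZ gtr0_norm // (minr_pMr _ _ (ltW m'0)) le_min !ge_min lexx /=.
  by apply/orP; right; rewrite ler_pdivlMl // /lam ler_pM2r // invr_gt0.
by rewrite meanZ // ler_pdivrMl // mulrC; move: w'neg; rewrite FE; lra.
Qed.

End concentration.

(** * Dyadic scales, compact cubes and test fields *)

Section dyadic.
Variable R : realType.

Lemma half_gt0 n : 0 < 2^-1 ^+ n :> R.
Proof. by rewrite exprn_gt0 // invr_gt0. Qed.

Lemma cvg_half : (fun n => 2^-1 ^+ n : R) @ \oo --> (0 : R).
Proof. by apply: cvg_expr; rewrite ger0_norm ?invr_ge0 //; lra. Qed.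

Lemma half_small (e : R) : 0 < e -> exists N, forall j, (N <= j)%N -> 2^-1 ^+ j < e.
Proof.
move=> e0; have /cvgrPdist_lt/(_ _ e0)[N _ NP] := cvg_half.
by exists N => j /NP; rewrite /= sub0r normrN ger0_norm.
Qed.

End dyadic.

Section euclidean.
Variables (R : realType) (d : nat).
Local Notation E := 'rV[R]_d.
Local Notation mu := (lebesgue_rV R d).

Lemma le_Rintegral_subset (F : E -> R) D D' : measurable D -> measurable D' ->
  D `<=` D' -> (mu D' < +oo)%E -> bdd_measurable F -> (forall x, 0 <= F x) ->
  \int[mu]_(x in D) F x <= \int[mu]_(x in D') F x.
Proof.
move=> mD mD' DD' D'oo bF F0.
have Doo : (mu D < +oo)%E by apply: le_lt_trans D'oo; apply: le_measure; rewrite ?inE.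
apply: fine_le.
- by apply: integrable_fin_num => //; exact: integrable_bdd.
- by apply: integrable_fin_num => //; exact: integrable_bdd.
- apply: ge0_subset_integral => //; last by move=> x _; rewrite lee_fin.
  by apply/measurable_EFinP; apply: measurable_funTS; case: bF.
Qed.

Lemma Rintegral_support (F : E -> R) D D' : D `<=` D' ->
  (forall x, D' x -> ~ D x -> F x = 0) ->
  \int[mu]_(x in D') F x = \int[mu]_(x in D) F x.
Proof.
move=> DD' F0; rewrite [LHS]Rintegral_mkcond [RHS]Rintegral_mkcond; congr Rintegral; apply/funext => x.
rewrite /patch; case: ifPn => xD'; case: ifPn => xD //.
  by apply: F0; [rewrite inE in xD'|rewrite notin_setE in xD].
by rewrite notin_setE in xD'; rewrite inE in xD; have := xD' (DD' _ xD).
Qed.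

Definition cbox (a : E) (l : R) : set E := [set x | forall i, a ord0 i <= x ord0 i <= a ord0 i + l].

Lemma compact_cbox a l : compact (cbox a l).
Proof.
have := @rV_compact R d (fun i => `[a ord0 i, a ord0 i + l]%classic)
  (fun i => @segment_compact R _ _).
congr compact; apply/seteqP; split=> x xl i; have := xl i; by rewrite /= in_itv.
Qed.

Lemma cube_cbox a l : cube a l `<=` cbox a l.
Proof. by move=> x xl i; have := xl i; rewrite !mxE => /andP[/ltW -> ->]. Qed.

Lemma cbox_norm a l x : 0 <= l -> cbox a l x -> `|a - x| <= l.
Proof.
move=> l0 xl; rewrite [leLHS]/Num.norm /= mx_normrE.
apply: bigmax_le => // -[i j] _; rewrite (ord1 i) /= !mxE distrC ler_norml.
by have := xl j => /andP[? ?]; apply/andP; split; lra.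
Qed.

Lemma cbox_in_open (U : set E) x : open U -> U x ->
  exists m : nat, cbox x (2^-1 ^+ m) `<=` U.
Proof.
move=> oU Ux; have /nbhs_ballP[e /= e0 eU] : nbhs x U by exact: open_nbhs_nbhs.
have [m mP] := half_small e0.
exists m => y yx; apply: eU; rewrite mx_norm_ball /ball_ /=.
exact: le_lt_trans (cbox_norm (ltW (half_gt0 R m)) yx) (mP m (leqnn m)).
Qed.

Lemma uniform_continuity n (f : E -> 'rV[R]_n) K (e : R) : continuous f -> compact K -> 0 < e ->
  exists N, forall j, (N <= j)%N -> forall x y, K x -> `|x - y| <= 2^-1 ^+ j ->
    `|f x - f y| < e.
Proof.
move=> fC /compact_near_coveringP cK e0.
have [x Kx|N _ NP] := cK nat \oo (fun j x => forall y, `|x - y| <= 2^-1 ^+ j -> `|f x - f y| < e) _.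
  have e2 : 0 < e / 2 by rewrite divr_gt0.
  have /nbhs_ballP[r /= r0 rP] : \forall y \near x, ball (f x) (e / 2) (f y).
    by apply: (fC x); exact: nbhsx_ballx.
  have r2 : 0 < r / 2 by rewrite divr_gt0.
  have [N NP] := half_small r2.
  exists (ball x (r / 2), [set j | (N <= j)%N]).
    by split; [exact: nbhsx_ballx|exists N].
  move=> [z j] [/= zx Nj] y zy.
  have xz : `|x - z| < r / 2 by move: zx; rewrite mx_norm_ball.
  have jr := NP j Nj.
  have fz : `|f x - f z| < e / 2.
    have := rP z; rewrite !mx_norm_ball /ball_ /=; apply.
    by apply: lt_trans xz _; lra.
  have fy : `|f x - f y| < e / 2.
    have := rP y; rewrite !mx_norm_ball /ball_ /=; apply.
    rewrite -(subrK z x) -addrA; apply: le_lt_trans (ler_normD _ _) _; lra.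
  rewrite -(subrK (f x) (f z)) -addrA; apply: le_lt_trans (ler_normD _ _) _.
  by rewrite distrC; lra.
by exists N => j Nj x y Kx xy; exact: (NP j Nj x Kx y xy).
Qed.

End euclidean.

Section dot_fields.
Variables (R : realType) (d : nat) (W : vectType R) (dotW : {dot W for idfun}).
Local Notation E := 'rV[R]_d.
Local Notation mu := (lebesgue_rV R d).
Local Notation dn := (dnorm dotW).

Lemma measurable_dot (D : set E) (f g : E -> W) : measurable_fun D (v2r \o f) ->
  measurable_fun D (v2r \o g) -> measurable_fun D (fun x => dotW (f x) (g x)).
Proof.
move=> mf mg.
have -> : (fun x => dotW (f x) (g x)) = (fun x => \sum_i \sum_j
    ((v2r \o f) x ord0 i * (v2r \o g) x ord0 j) *
    dotW (r2v (delta_mx ord0 i)) (r2v (delta_mx ord0 j))).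
  have vE (v : W) : v = \sum_i v2r v ord0 i *: (r2v (delta_mx ord0 i) : W).
    rewrite -[LHS]v2rK [X in r2v X = _]row_sum_delta linear_sum.
    by apply: eq_bigr => i _; rewrite linearZ.
  apply/funext => x /=; move: (f x) (g x) => u v.
  rewrite [in LHS](vE u) linear_sumlz; apply: eq_bigr => i _.
  rewrite [LHS](dotZl dotW) [in LHS](vE v) linear_sumr mulr_sumr; apply: eq_bigr => j _.
  by rewrite [X in _ * X](dotZr dotW) mulrA.
have mc (h : E -> W) i : measurable_fun D (v2r \o h) ->
    measurable_fun D (fun x => (v2r \o h) x ord0 i).
  by move=> mh; apply: (measurableT_comp (measurable_coord i) mh).
apply: measurable_sum => i; apply: measurable_sum => j.
apply: measurable_funM; last exact: measurable_cst.
by apply: measurable_funM; exact: mc.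
Qed.

Lemma bdd_measurable_dot (f g : E -> W) : bdd_field dotW f -> bdd_field dotW g ->
  bdd_measurable (fun x => dotW (f x) (g x)).
Proof.
move=> [mf [B fB]] [mg [C gC]]; split; first exact: measurable_dot.
exists (B * C) => x; apply: le_trans (normr_dot_le _ _ _) _.
by rewrite ler_pM ?dnorm_ge0.
Qed.

Lemma bdd_field_support (f : E -> W) : (forall x, V_continuous_at f x) ->
  (exists K, compact K /\ forall x, ~ K x -> f x = 0) -> bdd_field dotW f.
Proof.
move=> fC [K [cK fK]]; split.
  apply: measurable_fun_rVP => i; apply: continuous_measurable_rV => x.
  apply: (@continuous_comp _ _ _ (v2r \o f) (fun v => v ord0 i)); first exact: fC.
  exact: coord_continuous.
have : compact ((v2r \o f) @` K).
  by apply: continuous_compact => //; apply: continuous_subspaceT => x; exact: fC.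
move=> /compact_bounded[M [_ MP]].
have M1 : M < `|M| + 1 by rewrite ltr_pwDr // ler_norm.
exists (dconst dotW * (`|M| + 1)) => x.
have [Kx|nKx] := pselect (K x); last first.
  by rewrite fK // dnorm0 mulr_ge0 ?dconst_ge0 // addr_ge0.
apply: le_trans (dnorm_le_v2r _ _) _; rewrite ler_wpM2l ?dconst_ge0 //.
by apply: (MP _ M1); exists x.
Qed.

End dot_fields.

(** * The concentrating sequence *)

Section sequence.
Variables (R : realType) (d k : nat) (W X : vectType R) (dotW : {dot W for idfun}).
Variables (A : multiindex d k -> 'Hom(W, X)) (L : {vspace W}).
Local Notation E := 'rV[R]_d.
Local Notation mu := (lebesgue_rV R d).
Local Notation dn := (dnorm dotW).
Local Notation osc := (osc A).
Local Notation dist := (dist_to dotW L).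

(** Only [conc_bound] relates different indices: [eps l] is tiny compared with the inverse sup norms
    of the earlier fields. *)
Record concentrating (eps : nat -> R) (G : nat -> E -> W) : Prop := Concentrating {
  conc_osc : forall j, osc (G j);
  conc_eps0 : forall j, 0 < eps j;
  conc_eps : forall j, eps j <= 2^-1 ^+ j;
  conc_norm : forall j, mean (dn \o G j) = 1;
  conc_dist : forall j, mean (dist \o G j) <= eps j;
  conc_min : forall j, mean (fun x => Num.min (dn (G j x)) (eps j)^-1) <= eps j;
  conc_bound : forall j l, (j < l)%N -> forall x, dn (G j x) * eps l <= 2^-1 ^+ l }.

Lemma exists_sequence (v : W) : constant_rank A -> v \in L -> v != 0 ->
  span_of (wave_cone A) v -> exists eps G, concentrating eps G.
Proof.
move=> crA vL v0 vA.
have /choice[H HP] (eps : R) : exists H : (E -> W) * R, 0 < eps ->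
    [/\ osc H.1, mean (dn \o H.1) = 1, mean (dist \o H.1) <= eps,
     mean (fun x => Num.min (dn (H.1 x)) eps^-1) <= eps & forall x, dn (H.1 x) <= H.2].
  (* A default value for nonpositive [eps], so that the choice function is total. *)
  have [eps0|/negP neps] := pselect (0 < eps); last by exists (fun=> 0, 0) => h; rewrite h in neps.
  have [w [ow w1 w2 w3]] := exists_concentrated dotW crA vL v0 vA eps0.
  by have [_ [B wB]] := osc_bdd_field dotW ow; exists (w, B).
(* The state is [eps n] with a number [S n >= 1] dominating the sup bounds of the fields chosen so
   far; the next [eps] is [2^-1 ^+ n / S n']. *)
pose st := fix st (n : nat) : R * R := if n is n'.+1 then
  let e := 2^-1 ^+ n / (st n').2 in (e, (st n').2 + `|(H e).2|)
  else (1, 1 + `|(H 1).2|).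
pose eps n := (st n).1; pose S n := (st n).2.
have epsS n : eps n.+1 = 2^-1 ^+ n.+1 / S n by [].
have SS n : S n.+1 = S n + `|(H (eps n.+1)).2| by [].
have S1 n : 1 <= S n.
  elim: n => [|n IHn]; first by rewrite /S /= lerDl.
  by rewrite SS; apply: le_trans IHn _; rewrite lerDl.
have SB n : (H (eps n)).2 <= S n.
  case: n => [|n]; apply: le_trans (ler_norm _) _; first by rewrite /S /= lerDr.
  by rewrite SS lerDr (le_trans _ (S1 n)).
have Smono n l : (n <= l)%N -> S n <= S l.
  elim: l => [|l IHl]; first by rewrite leqn0 => /eqP ->.
  rewrite leq_eqVlt ltnS => /predU1P[-> //|/IHl] /le_trans; apply.
  by rewrite SS lerDl.
have eps0 n : 0 < eps n.
  by case: n => [|n]; rewrite ?epsS ?divr_gt0 ?half_gt0 // (lt_le_trans _ (S1 n)).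
have eps_le n : eps n <= 2^-1 ^+ n.
  case: n => [|n]; first by rewrite expr0.
  by rewrite epsS ler_pdivrMr ?(lt_le_trans ltr01 (S1 n)) // ler_peMr ?S1 // ltW.
have HP' n := HP (eps n) (eps0 n).
exists eps, (fun n => (H (eps n)).1); split=> //; try by move=> j; case: (HP' j).
move=> j [//|l] jl x.
have [_ _ _ _ HB] := HP' j.
rewrite epsS mulrCA -[leRHS]mulr1 ler_pM2l ?half_gt0 // ler_pdivrMr ?(lt_le_trans ltr01 (S1 l)) //.
by rewrite mul1r; apply: le_trans (HB x) (le_trans (SB j) (Smono _ _ _)).
Qed.

Variables (eps : nat -> R) (G : nat -> E -> W).
Hypothesis GC : concentrating eps G.

Definition rescaled j (x : E) : W := G j ((2 ^ j)%:R *: x).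

Local Notation w := rescaled.

Lemma osc_rescaled j : osc (w j).
Proof.
have := osc_affine 0 (expn_gt0 2 j : (0 < 2 ^ j)%N) (conc_osc GC j).
by congr osc; apply/funext => x; rewrite addr0.
Qed.

Lemma Rintegral_rescaled (F : E -> R) j a l n : (2 ^ j)%:R * l = n%:R -> bdd_measurable F ->
  zperiodic F -> \int[mu]_(x in cube a l) F ((2 ^ j)%:R *: x) = l ^+ d * mean F.
Proof.
move=> ln bF pF; rewrite -(@Rintegral_cube_scale R d F _ l n a 0 _ ln bF pF).
  by congr Rintegral; apply/funext => x; rewrite addr0.
by rewrite ltr0n expn_gt0.
Qed.

Lemma dyadic_scale j m : (m <= j)%N -> (2 ^ j)%:R * 2^-1 ^+ m = (2 ^ (j - m))%:R :> R.
Proof.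
move=> mj; by rewrite !natrX exprVn -{1}(subnK mj) exprD mulfK // expf_neq0.
Qed.

Lemma period_cell (j : nat) : (2 ^ j)%:R * 2^-1 ^+ j = 1%:R :> R.
Proof. by rewrite dyadic_scale // subnn. Qed.

Lemma bdd_measurable_norm j : bdd_measurable (fun x => dn (w j x)).
Proof. exact: (osc_bdd_dnorm dotW (osc_rescaled j)). Qed.

Lemma bdd_measurable_dist j : bdd_measurable (fun x => dist (w j x)).
Proof. exact: (osc_bdd_dist dotW L (osc_rescaled j)). Qed.

Lemma bdd_measurable_min j lam : bdd_measurable (fun x => Num.min (dn (w j x)) lam).
Proof. exact: (osc_bdd_min dotW lam (osc_rescaled j)). Qed.

Section aligned.
Variables (j n : nat) (a : E) (l : R).
Hypothesis ln : (2 ^ j)%:R * l = n%:R.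

Lemma Rintegral_norm : \int[mu]_(x in cube a l) dn (w j x) = l ^+ d.
Proof.
rewrite (Rintegral_rescaled (F := dn \o G j) a ln) ?(conc_norm GC) ?mulr1 //.
  exact: osc_bdd_dnorm (conc_osc GC j).
by move=> z x; rewrite /= (osc_zperiodic (conc_osc GC j)).
Qed.

Lemma Rintegral_dist : 0 <= l -> \int[mu]_(x in cube a l) dist (w j x) <= l ^+ d * eps j.
Proof.
move=> l0; rewrite (Rintegral_rescaled (F := dist \o G j) a ln).
- by rewrite ler_wpM2l ?exprn_ge0 // (conc_dist GC).
- exact: osc_bdd_dist (conc_osc GC j).
- by move=> z x; rewrite /= (osc_zperiodic (conc_osc GC j)).
Qed.

Lemma Rintegral_min : 0 <= l ->
  \int[mu]_(x in cube a l) Num.min (dn (w j x)) (eps j)^-1 <= l ^+ d * eps j.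
Proof.
move=> l0; rewrite (Rintegral_rescaled (F := fun x => Num.min (dn (G j x)) (eps j)^-1) a ln).
- by rewrite ler_wpM2l ?exprn_ge0 // (conc_min GC).
- exact: osc_bdd_min (conc_osc GC j).
- by move=> z x; rewrite /= (osc_zperiodic (conc_osc GC j)).
Qed.

Lemma Rintegral_dot u : \int[mu]_(x in cube a l) dotW u (w j x) = 0.
Proof.
rewrite (Rintegral_rescaled (F := fun x => dotW u (G j x)) a ln).
- by rewrite (osc_mean0 dotW u (conc_osc GC j)) mulr0.
- have lu : lip dotW (dotW u).
    exists (dn u) => [|v v']; first exact: dnorm_ge0.
    by rewrite -linearBr; exact: normr_dot_le.
  exact: (bdd_measurable_lip lu (osc_bdd_field dotW (conc_osc GC j))).
- by move=> z x; rewrite (osc_zperiodic (conc_osc GC j)).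
Qed.

End aligned.

(** On cubes made of whole periods it carries a fraction at least [1 - eps j] of the mass, on a
    fraction at most [eps j ^+ 2] of the volume. *)
Definition peak j : set E := [set x | (eps j)^-1 < dn (w j x)].

Lemma measurable_peak j : measurable (peak j).
Proof.
have [mw _] := bdd_measurable_norm j.
rewrite (_ : peak j = (fun x => dn (w j x)) @^-1` `](eps j)^-1, +oo[%classic).
  by rewrite -[X in measurable X]setTI; exact: mw.
by apply/seteqP; split=> x; rewrite /peak /= in_itv /= andbT.
Qed.

(** Markov's inequality for the truncated norm, which equals [(eps j)^-1] on the peak and has
    integral at most [l ^+ d * eps j]. *)
Lemma measure_peak j n a l : 0 <= l -> (2 ^ j)%:R * l = n%:R ->
  (mu (cube a l `&` peak j) <= (l ^+ d * eps j ^+ 2)%:E)%E.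
Proof.
move=> l0 ln; have mC := measurable_cube a l.
have mP := measurable_peak j.
have bi := bdd_measurable_indic mP.
have e0 := conc_eps0 GC j.
have le1 : \int[mu]_(x in cube a l) ((eps j)^-1 * \1_(peak j) x) <= l ^+ d * eps j.
  apply: le_trans (Rintegral_min a ln l0); apply: le_Rintegral => //.
  - apply: integrable_cube => //; apply: bdd_measurableM => //; exact: bdd_measurable_cst.
  - by apply: integrable_cube => //; exact: bdd_measurable_min.
  move=> x _; rewrite indicE; case: (boolP (x \in _)) => [|_].
    by rewrite inE /peak /= mulr1 le_min lexx andbT => /ltW.
  by rewrite mulr0 le_min dnorm_ge0 invr_ge0 ltW.
move: le1; rewrite RintegralZl //; last exact: integrable_cube.
rewrite ler_pdivrMl // /Rintegral integral_indic // setIC => le1.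
have fin : mu (cube a l `&` peak j) \is a fin_num.
  rewrite ge0_fin_numE //; apply: le_lt_trans (_ : mu (cube a l) < _)%E.
    by apply: le_measure; rewrite ?inE //; exact: measurableI.
  by rewrite measure_cube // ltry.
rewrite -(fineK fin) lee_fin; apply: le_trans le1 _.
by rewrite le_eqVlt; apply/orP; left; apply/eqP; ring.
Qed.

End sequence.

(** * Peaks, tails and the test function *)

Section conclusions.
Variables (R : realType) (d k : nat) (W X : vectType R) (dotW : {dot W for idfun}).
Variables (A : multiindex d k -> 'Hom(W, X)) (L : {vspace W}).
Local Notation E := 'rV[R]_d.
Local Notation mu := (lebesgue_rV R d).
Local Notation dn := (dnorm dotW).
Local Notation dist := (dist_to dotW L).
Variables (eps : nat -> R) (G : nat -> E -> W).
Hypothesis GC : concentrating dotW A L eps G.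
Local Notation w := (rescaled G).
Local Notation peak := (peak dotW eps G).

Lemma eps_le1 j : eps j <= 1.
Proof.
apply: le_trans (conc_eps GC j) _; apply: exprn_ile1; first by rewrite invr_ge0.
by lra.
Qed.

Lemma Rintegral_setI_indic (F : E -> R) (D P : set E) :
  \int[mu]_(x in D `&` P) F x = \int[mu]_(x in D) (F x * \1_P x).
Proof.
rewrite Rintegral_mkcondr; apply: eq_Rintegral => x _.
by rewrite /patch indicE; case: ifP => _; rewrite ?mulr1 ?mulr0.
Qed.

Lemma norm_le_peak j x : dn (w j x) <= dn (w j x) * \1_(peak j) x + Num.min (dn (w j x)) (eps j)^-1.
Proof.
have e0 : 0 < (eps j)^-1 by rewrite invr_gt0 (conc_eps0 GC).
rewrite indicE; case: (boolP (x \in _)) => [_|].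
  by rewrite mulr1 lerDl le_min dnorm_ge0 ltW.
rewrite notin_setE /peak /= => /negP; rewrite -leNgt => h.
by rewrite mulr0 add0r le_min lexx.
Qed.

Lemma Rintegral_peak j n a l : 0 <= l -> (2 ^ j)%:R * l = n%:R ->
  l ^+ d * (1 - eps j) <= \int[mu]_(x in cube a l) (dn (w j x) * \1_(peak j) x).
Proof.
move=> l0 ln; have bn := bdd_measurable_norm GC j.
have bm := bdd_measurable_min GC j (eps j)^-1.
have bp : bdd_measurable (fun x => dn (w j x) * \1_(peak j) x).
  by apply: bdd_measurableM => //; apply: bdd_measurable_indic; exact: measurable_peak GC j.
have mC := measurable_cube a l.
have : \int[mu]_(x in cube a l) dn (w j x) <= \int[mu]_(x in cube a l)
    (dn (w j x) * \1_(peak j) x + Num.min (dn (w j x)) (eps j)^-1).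
  apply: le_Rintegral => //; [exact: integrable_cube| |by move=> x _; exact: norm_le_peak].
  by apply: integrable_cube => //; exact: bdd_measurableD.
rewrite RintegralD //; [|exact: integrable_cube|exact: integrable_cube].
rewrite (Rintegral_norm GC a ln).
have := Rintegral_min GC a ln l0.
set I1 := \int[mu]_(x in _) Num.min _ _; set I2 := \int[mu]_(x in _) (_ * _).
by rewrite mulrBr mulr1; lra.
Qed.

(** In a dyadic cube inside [U] the peaks have measure tending to zero, yet each keeps almost the
    full mass [V]. *)
Lemma not_equi_integrable (U : set E) : open U -> U !=set0 ->
  ~ locally_equi_integrable U (fun j x => dn (w j x)).
Proof.
move=> oU [x0 Ux0] eqU.
have [m mU] := cbox_in_open oU Ux0.
pose l : R := 2^-1 ^+ m; pose V := l ^+ d.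
have l0 : 0 < l by exact: half_gt0.
have V0 : 0 < V by exact: exprn_gt0.
have V4 : 0 < V / 4 by exact: divr_gt0.
have [delta delta0 deltaP] := eqU _ (@compact_cbox R d x0 l) mU _ V4.
have dV0 : 0 < delta / V by exact: divr_gt0.
have [N NP] := half_small dV0.
(* [j >= 2] gives [eps j <= 4^-1], so the peak carries at least [3 V / 4], against the threshold
   [V / 4]. *)
pose j := maxn (maxn N m) 2.
have jN : (N <= j)%N by rewrite /j !leq_max leqnn.
have jm : (m <= j)%N by rewrite /j !leq_max leqnn !orbT.
have j2 : (2 <= j)%N by rewrite /j leq_maxr.
have ej4 : eps j <= 4^-1.
  apply: le_trans (conc_eps GC j) _; rewrite -(subnK j2) exprD.
  have -> : 4^-1 = 1 * 2^-1 ^+ 2 :> R by field.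
  rewrite ler_pM ?exprn_ge0 ?invr_ge0 // exprn_ile1 ?invr_ge0 //; lra.
have e0 := conc_eps0 GC j.
have ln := dyadic_scale R jm.
have mC := measurable_cube x0 l; have mP := measurable_peak GC j.
have mE : measurable (cube x0 l `&` peak j) by exact: measurableI.
have Esub : cube x0 l `&` peak j `<=` cbox x0 l.
  by move=> x [/cube_cbox].
have Edelta : (mu (cube x0 l `&` peak j) <= delta%:E)%E.
  apply: le_trans (measure_peak GC x0 (ltW l0) ln) _; rewrite lee_fin -/V.
  rewrite mulrC -ler_pdivlMr //; apply: le_trans (ltW (NP j jN)).
  apply: le_trans (conc_eps GC j); by rewrite expr2 ler_piMl ?eps_le1 ?(ltW e0).
have := deltaP _ mE Esub Edelta j.
have bn := bdd_measurable_norm GC j.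
have Eoo : (mu (cube x0 l `&` peak j) < +oo)%E by apply: le_lt_trans Edelta (ltry _).
have fin := integrable_fin_num mE (integrable_bdd bn mE Eoo).
under eq_integral do rewrite ger0_norm ?dnorm_ge0 //.
rewrite -(fineK fin) lee_fin.
have := Rintegral_peak x0 (ltW l0) ln; rewrite -Rintegral_setI_indic /Rintegral -/V.
move=> h1 h2; have := le_trans h1 h2.
by nra.
Qed.

Definition tail j : set E := \bigcup_n peak (j + n).+1.

Lemma measurable_tail j : measurable (tail j).
Proof. by apply: bigcupT_measurable => n; exact: measurable_peak GC _. Qed.

Lemma peak_tail i j x : (i < j)%N -> peak j x -> tail i x.
Proof. by move=> ij jx; exists (j - i.+1)%N => //; rewrite -addSn subnKC. Qed.

(** [conc_bound] is pointwise; it passes to the supremum, which is one bound valid for all [l]. *)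
Lemma rescaled_bound j : exists2 b, forall x, dn (w j x) <= b &
  forall l, (j < l)%N -> b * eps l <= 2^-1 ^+ l.
Proof.
have ub l : (j < l)%N -> ubound (range (fun x => dn (w j x))) (2^-1 ^+ l / eps l).
  by move=> jl _ [x _ <-]; rewrite ler_pdivlMr ?(conc_eps0 GC) // (conc_bound GC).
have hs : has_sup (range (fun x => dn (w j x))).
  by split; [exists (dn (w j 0)), 0|exists (2^-1 ^+ j.+1 / eps j.+1); exact: ub].
exists (sup (range (fun x => dn (w j x)))) => [x|l jl].
  by apply: ub_le_sup; [case: hs|exists x].
rewrite -ler_pdivlMr ?(conc_eps0 GC) //.
by apply: sup_le_ub; [case: hs|exact: ub].
Qed.

(** The peaks after [j] have total measure at most the sum of [V * eps l ^+ 2]. Each term times the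
    sup bound [b] is at most [V * 2^-l], and these sum to [V * 2^-j]. *)
Lemma Rintegral_tail j m a : (m <= j)%N ->
  \int[mu]_(x in cube a (2^-1 ^+ m)) (dn (w j x) * \1_(tail j) x) <=
  (2^-1 ^+ m) ^+ d * 2^-1 ^+ j.
Proof.
move=> mj; set l : R := 2^-1 ^+ m; pose V := l ^+ d.
have l0 : 0 < l by exact: half_gt0.
have V0 : 0 < V by exact: exprn_gt0.
have [b wb bl] := rescaled_bound j.
have b0 : 0 <= b by apply: le_trans (wb 0); exact: dnorm_ge0.
have mC := measurable_cube a l; have mT := measurable_tail j.
have bi := bdd_measurable_indic mT.
have bn := bdd_measurable_norm GC j.
apply: (@le_trans _ _ (\int[mu]_(x in cube a l) (b * \1_(tail j) x))).
  apply: le_Rintegral => //.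
  - by apply: integrable_cube (ltW l0); exact: bdd_measurableM.
  - apply: integrable_cube (ltW l0); apply: bdd_measurableM => //; exact: bdd_measurable_cst.
  - by move=> x _; apply: ler_wpM2r (wb x); rewrite indicE.
rewrite RintegralZl //; last by apply: integrable_cube (ltW l0).
rewrite /Rintegral integral_indic // setIC -/V.
have [->|bn0] := eqVneq b 0; first by rewrite mul0r mulr_ge0 // ltW // half_gt0.
have bgt0 : 0 < b by rewrite lt_def bn0.
rewrite mulrC -ler_pdivlMr //.
suff : (mu (cube a l `&` tail j) <= (V * 2^-1 ^+ j / b)%:E)%E.
  move=> h; rewrite -lee_fin fineK // ge0_fin_numE //.
  exact: le_lt_trans h (ltry _).
apply: le_trans (_ : \sum_(n <oo) mu (cube a l `&` peak (j + n).+1) <= _)%E.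
  apply: measure_sigma_subadditive.
  - by move=> n; apply: measurableI => //; exact: measurable_peak GC _.
  - exact: measurableI.
  - by move=> x [xa [n _ xn]]; exists n.
have geo := @cvg_geometric_eseries_half R (V / b) j.
apply: le_trans (_ : \sum_(n <oo) ((V / b) / (2 ^ (n + j.+1))%:R)%:E <= _)%E; last first.
  rewrite (cvg_lim _ geo) // lee_fin -exprVn.
  by rewrite le_eqVlt; apply/orP; left; apply/eqP; ring.
apply: lee_nneseries => [n _ _|n _]; first exact: measure_ge0.
have mn : (m <= (j + n).+1)%N by apply: leq_trans mj _; rewrite -addnS leq_addr.
apply: le_trans (measure_peak GC a (ltW l0) (dyadic_scale R mn)) _.
have -> : (n + j.+1)%N = (j + n).+1 by rewrite addnS addnC.
rewrite lee_fin -/V -mulrA ler_wpM2l ?(ltW V0) // natrX -exprVn [leRHS]mulrC.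
have ble : b * eps (j + n).+1 <= 2^-1 ^+ (j + n).+1 by apply: bl; rewrite ltnS leq_addr.
rewrite ler_pdivlMr // expr2 -mulrA [eps _ * b]mulrC; apply: le_trans ble.
by rewrite ler_piMl ?eps_le1 // mulr_ge0 // ltW // (conc_eps0 GC).
Qed.

(** Multiplying [v] by this factor normalizes it as soon as [dn v >= 1]; the maximum keeps the
    factor Lipschitz, hence measurable along fields. *)
Definition unit_clip (v : W) : R := (Num.max (dn v) 1)^-1.

Lemma lip_unit_clip : lip dotW unit_clip.
Proof.
have h u v : unit_clip u - unit_clip v <= dn (u - v).
  rewrite /unit_clip; set p := Num.max (dn u) 1; set q := Num.max (dn v) 1.
  have p1 : 1 <= p by rewrite le_max lexx orbT.
  have q1 : 1 <= q by rewrite le_max lexx orbT.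
  have p0 : 0 < p by exact: lt_le_trans p1.
  have q0 : 0 < q by exact: lt_le_trans q1.
  have qp : q - p <= dn (u - v).
    have := dnormD dotW (v - u) u; rewrite subrK dnorm_sym => h.
    have n0 := dnorm_ge0 dotW (u - v).
    have vq : dn v <= dn (u - v) + p.
      by apply: le_trans h _; rewrite lerD2l le_max lexx.
    by rewrite lerBlDr ge_max vq /=; lra.
  have -> : p^-1 - q^-1 = (q - p) / (p * q) by field; rewrite !gt_eqF.
  rewrite ler_pdivrMr ?mulr_gt0 //; apply: le_trans qp _.
  by rewrite ler_peMr ?dnorm_ge0 // -[leLHS]mulr1 ler_pM.
exists 1 => // u v; rewrite mul1r ler_norml lerNl opprB h andbT.
by rewrite dnorm_sym h.
Qed.

Lemma unit_clip_norm v : dn (unit_clip v *: v) <= 1.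
Proof.
have p0 : 0 < Num.max (dn v) 1 by rewrite lt_max ltr01 orbT.
rewrite dnormZ gtr0_norm ?invr_gt0 // mulrC ler_pdivrMr // mul1r.
by rewrite le_max lexx.
Qed.

Lemma unit_clip_dot v : 1 <= dn v -> dotW (unit_clip v *: v) v = dn v.
Proof.
move=> v1; rewrite dotZl -sqr_dnorm /unit_clip.
have -> : Num.max (dn v) 1 = dn v by apply/max_idPl.
by rewrite expr2 mulKf // gt_eqF // (lt_le_trans _ v1).
Qed.

Section test_function.
Variables (m : nat) (a : E).
Local Notation C := (cube a (2^-1 ^+ m)).

(* [test_fun] follows the direction of [w j] at the last [j] for which the point
   is in a peak.  By [conc_bound], [w j] has little mass on the later peaks, so
   it pairs with [test_fun] almost as with its own direction. *)
Definition last_peak j : set E := C `&` (peak j `\` tail j).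

Definition test_fun (x : E) : W :=
  if pselect (exists j, last_peak j x) is left h
  then unit_clip (w (sval (cid h)) x) *: w (sval (cid h)) x else 0.

Lemma measurable_last_peak j : measurable (last_peak j).
Proof.
apply: measurableI; first exact: measurable_cube.
by apply: measurableD; [exact: measurable_peak GC j|exact: measurable_tail].
Qed.

Lemma test_funE j x : last_peak j x -> test_fun x = unit_clip (w j x) *: w j x.
Proof.
move=> jx; rewrite /test_fun; case: pselect => [h|]; last by case; exists j.
case: (cid h) => i ix /=.
suff -> : i = j by [].
move: ix jx => [_ [ix iT]] [_ [jx jT]].
have [ij|ji|//] := ltngtP i j.
  by case: iT; exact: peak_tail ij jx.
by case: jT; exact: peak_tail ji ix.
Qed.

Lemma test_fun0 x : ~ (exists j, last_peak j x) -> test_fun x = 0.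
Proof. by move=> nx; rewrite /test_fun; case: pselect. Qed.

Lemma test_fun_norm x : dn (test_fun x) <= 1.
Proof.
have [[j jx]|/test_fun0 ->] := pselect (exists j, last_peak j x); last by rewrite dnorm0.
by rewrite (test_funE jx) unit_clip_norm.
Qed.

Lemma measurable_test_fun : measurable_fun setT (v2r \o test_fun).
Proof.
have mD : measurable (\bigcup_j last_peak j).
  by apply: bigcupT_measurable => j; exact: measurable_last_peak.
rewrite -(setvU (\bigcup_j last_peak j)).
apply/measurable_funU => //; first exact: measurableC.
split.
  apply: (eq_measurable_fun (cst (v2r (0 : W)))); last exact: measurable_cst.
  move=> x; rewrite inE => nx; rewrite /= test_fun0 // => -[j jx].
  by apply: nx; exists j.
apply/measurable_fun_bigcup => j; first exact: measurable_last_peak.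
apply: (eq_measurable_fun (fun x => v2r (unit_clip (w j x) *: w j x))).
  by move=> x; rewrite inE => jx; rewrite /= (test_funE jx).
apply: measurable_funTS; apply: measurable_fun_rVP => i.
have [mw _] := osc_bdd_field dotW (osc_rescaled GC j).
have -> : (fun t => v2r (unit_clip (w j t) *: w j t) ord0 i) =
    (fun t => (unit_clip \o w j) t * (v2r \o w j) t ord0 i).
  by apply/funext => t; rewrite linearZ mxE.
apply: measurable_funM; first exact: (measurable_lip_comp lip_unit_clip mw).
exact: (measurableT_comp (measurable_coord i) mw).
Qed.

(** On the tail the pairing is only known to be at least [- n], and the factor 2 absorbs this
    together with a possible peak term. On the rest of the peak it equals [n]. Elsewhere
    [n <= (eps j)^-1], so the minimum is [n] and pays. *)
Lemma test_fun_dot j x : C x -> dn (w j x) * \1_(peak j) x -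
  (dn (w j x) * \1_(tail j) x) * 2 - Num.min (dn (w j x)) (eps j)^-1 <=
  dotW (test_fun x) (w j x).
Proof.
move=> Cx; set n := dn (w j x).
have n0 : 0 <= n by exact: dnorm_ge0.
have e0 : 0 < (eps j)^-1 by rewrite invr_gt0 (conc_eps0 GC).
have e1 : 1 <= (eps j)^-1 by rewrite invf_ge1 ?eps_le1 // (conc_eps0 GC).
have dot_ge : - n <= dotW (test_fun x) (w j x).
  have := normr_dot_le dotW (test_fun x) (w j x); rewrite ler_norml => /andP[+ _].
  apply: le_trans; rewrite lerN2 -[leRHS]mul1r ler_wpM2r //; exact: test_fun_norm.
have min0 : 0 <= Num.min n (eps j)^-1 by rewrite le_min n0 ltW.
rewrite !indicE.
have [Tx|nTx] := boolP (x \in tail j).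
  rewrite mulr1; have [_|_] := boolP (x \in peak j); rewrite ?mulr1 ?mulr0; lra.
rewrite notin_setE in nTx.
have [px|npx] := boolP (x \in peak j).
  rewrite inE in px; rewrite mulr1 mulr0 mul0r subr0.
  have jx : last_peak j x by [].
  rewrite (test_funE jx) unit_clip_dot; first by rewrite -/n; lra.
  exact: le_trans e1 (ltW px).
rewrite !mulr0 mul0r subr0 sub0r.
rewrite notin_setE /peak /= in npx; move/negP: npx; rewrite -leNgt -/n => nle.
by rewrite (min_idPl nle).
Qed.

(** Of the four units of [2^-1 ^+ j], one is the mass missing from the peak, two come from the tail
    and one from the minimum. *)
Lemma Rintegral_test_fun j : (m <= j)%N ->
  (2^-1 ^+ m) ^+ d * (1 - 4 * 2^-1 ^+ j) <= \int[mu]_(x in C) dotW (test_fun x) (w j x).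
Proof.
move=> mj; pose l : R := 2^-1 ^+ m; pose V := l ^+ d.
have l0 : 0 < l by exact: half_gt0.
have V0 : 0 < V by exact: exprn_gt0.
have ln := dyadic_scale R mj.
have bn := bdd_measurable_norm GC j.
have bp := bdd_measurableM bn (bdd_measurable_indic (measurable_peak GC j)).
have bt := bdd_measurableM bn (bdd_measurable_indic (measurable_tail j)).
have bt2 := bdd_measurableM bt (bdd_measurable_cst d 2).
have bm := bdd_measurable_min GC j (eps j)^-1.
have bdot : bdd_measurable (fun x => dotW (test_fun x) (w j x)).
  apply: (bdd_measurable_dot (dotW := dotW)); last exact: osc_bdd_field (osc_rescaled GC j).
  by split; [exact: measurable_test_fun|exists 1; exact: test_fun_norm].
have mC := measurable_cube a l.
have iC (F : E -> R) : bdd_measurable F -> mu.-integrable (cube a l) (EFin \o F).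
  by move=> bF; exact: integrable_cube (ltW l0).
have bpt := bdd_measurableB bp bt2.
have : \int[mu]_(x in cube a l) (dn (w j x) * \1_(peak j) x -
  (dn (w j x) * \1_(tail j) x) * 2 - Num.min (dn (w j x)) (eps j)^-1) <=
  \int[mu]_(x in cube a l) dotW (test_fun x) (w j x).
  apply: le_Rintegral => //; [exact: iC (bdd_measurableB bpt bm)|exact: iC|].
  by move=> x Cx; exact: test_fun_dot.
apply: le_trans.
rewrite (RintegralB mC (iC _ bpt) (iC _ bm)) (RintegralB mC (iC _ bp) (iC _ bt2)).
rewrite (RintegralZr _ mC (iC _ bt)).
have h1 := Rintegral_peak a (ltW l0) ln.
have h2 := Rintegral_tail a mj.
have h3 := Rintegral_min GC a ln (ltW l0).
have he : V * eps j <= V * 2^-1 ^+ j by rewrite ler_pM2l // (conc_eps GC).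
move: h1 h2 h3; rewrite -/l -/V.
set I1 := \int[mu]_(x in _) _; set I2 := \int[mu]_(x in _) _; set I3 := \int[mu]_(x in _) _.
by rewrite !mulrBr !mulr1 mulrCA; lra.
Qed.

End test_function.

End conclusions.

(** * Behaviour on the domain *)

Section domain.
Variables (R : realType) (d k : nat) (W X : vectType R) (dotW : {dot W for idfun}).
Variables (A : multiindex d k -> 'Hom(W, X)) (L : {vspace W}).
Local Notation E := 'rV[R]_d.
Local Notation mu := (lebesgue_rV R d).
Local Notation dn := (dnorm dotW).
Local Notation dist := (dist_to dotW L).
Variables (eps : nat -> R) (G : nat -> E -> W).
Hypothesis GC : concentrating dotW A L eps G.
Local Notation w := (rescaled G).

Lemma bounded_subset_cube (D : set E) : bounded_set D ->
  exists (a : E) (n : nat), D `<=` cube a n%:R.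
Proof.
move=> [M [_ MP]].
have [N NM] : exists N : nat, M + 1 < N%:R.
  exists (Num.truncn (M + 1)).+1; exact: truncnS_gt.
exists (const_mx (- N%:R)), (N + N)%N => x Dx i; rewrite !mxE.
have M1 : M < M + 1 by rewrite ltrDl.
have := le_lt_trans (le_coord_norm x i) (le_lt_trans (MP _ M1 x Dx) NM).
by rewrite natrD ltr_norml => /andP[-> /ltW]; lra.
Qed.

Lemma grid_cbox (a : E) l n (f : {ffun 'I_d -> 'I_n}) : 0 <= l ->
  cbox a (l * n%:R) (a + grid l f).
Proof.
move=> l0 i; rewrite !mxE lerDl mulr_ge0 // lerD2l ler_wpM2l // ler_nat.
exact: ltnW.
Qed.

Variables (Omega : set E) (a : E) (n : nat).
Hypotheses (oO : open Omega) (OB : Omega `<=` cube a n%:R).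
Local Notation B := (cube a n%:R).

Let mO : measurable Omega.
Proof. exact: open_measurable_rV. Qed.

Let Boo : (mu B < +oo)%E.
Proof. by rewrite measure_cube ?ltry. Qed.

Let Ooo : (mu Omega < +oo)%E.
Proof.
apply: le_lt_trans Boo; apply: le_measure; rewrite ?inE //; exact: measurable_cube.
Qed.

(** The enclosing cube has integer side so that every [w j] completes whole periods on it. *)
Let scaleB j : (2 ^ j)%:R * n%:R = (2 ^ j * n)%:R :> R.
Proof. by rewrite natrM. Qed.

Lemma rescaled_in_L1 j : in_L1 dotW Omega (w j).
Proof.
split; first by apply: measurable_funTS; have [] := osc_bdd_field dotW (osc_rescaled GC j).
by apply: integrable_bdd => //; exact: bdd_measurable_norm GC j.
Qed.

Lemma rescaled_dist_cvg0 : L1_cvg0 Omega (fun j x => dist (w j x)).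
Proof.
have bd j := bdd_measurable_dist GC j.
split=> [j|]; first exact: integrable_bdd.
apply: (@squeeze_cvgr _ _ _ _ (fun=> 0) (fun j => n%:R ^+ d * 2^-1 ^+ j)).
- near=> j; apply/andP; split; first by apply: Rintegral_ge0 => x _.
  under eq_Rintegral do rewrite ger0_norm ?dist_ge0 //.
  apply: le_trans (le_Rintegral_subset mO (measurable_cube _ _) OB Boo (bd j) _) _.
    by move=> x; exact: dist_ge0.
  apply: le_trans (Rintegral_dist GC a (scaleB j) _) _ => //.
  by rewrite ler_wpM2l ?exprn_ge0 // (conc_eps GC).
- exact: cvg_cst.
- by rewrite -(mulr0 (n%:R ^+ d)); apply: cvgMr; exact: cvg_half.
Unshelve. all: by end_near. Qed.

(** On a period cell [w j] integrates to zero against the constant [phi c], so only the oscillation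
    of [phi] on the cell contributes. *)
Lemma Rintegral_dot_cell (phi : E -> W) j (c : E) (e : R) : bdd_field dotW phi -> 0 <= e ->
  (forall x, cube c (2^-1 ^+ j) x -> dn (phi x - phi c) <= e) ->
  `|\int[mu]_(x in cube c (2^-1 ^+ j)) dotW (phi x) (w j x)| <=
  e * \int[mu]_(x in cube c (2^-1 ^+ j)) dn (w j x).
Proof.
move=> bphi e0 phie; set C := cube c _.
have mC : measurable C by exact: measurable_cube.
have l0 : 0 <= 2^-1 ^+ j :> R by exact: ltW (half_gt0 R j).
have bw := osc_bdd_field dotW (osc_rescaled GC j).
have iC F : bdd_measurable F -> mu.-integrable C (EFin \o F).
  by move=> bF; exact: integrable_cube.
have bcst : bdd_field dotW (fun _ : E => phi c).
  by split; [exact: measurable_cst|exists (dn (phi c))].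
have b1 := bdd_measurable_dot bphi bw; have b2 := bdd_measurable_dot bcst bw.
have bn := bdd_measurable_norm GC j.
rewrite -[X in `|X|]subr0 -[X in _ - X](Rintegral_dot GC c (period_cell R j) (phi c)).
rewrite -(RintegralB mC (iC _ b1) (iC _ b2)) -(RintegralZl _ mC (iC _ bn)).
have b3 := bdd_measurableB b1 b2.
apply: le_trans (le_normr_Rintegral mC (iC _ b3)) _.
apply: le_Rintegral => //.
- apply: iC; exact: bdd_measurable_normr.
- apply: iC; apply: bdd_measurableM => //; exact: bdd_measurable_cst.
move=> x Cx; have -> : dotW (phi x) (w j x) - dotW (phi c) (w j x) =
    dotW (phi x - phi c) (w j x).
  by rewrite -(scaleN1r (phi c)) dotDl dotZl mulN1r.
by apply: le_trans (normr_dot_le _ _ _) _; rewrite ler_wpM2r ?dnorm_ge0 // phie.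
Qed.

Lemma rescaled_weakstar : density_weakstar_cvg0 dotW Omega w.
Proof.
move=> phi [phiC [K [cK KO phi0]]].
have bphi : bdd_field dotW phi by apply: bdd_field_support => //; exists K.
apply/cvgrPdist_lt => e e0.
pose c := dconst dotW * n%:R ^+ d + 1.
have c0 : 0 < c by rewrite ltr_wpDl // mulr_ge0 ?dconst_ge0 ?exprn_ge0.
(* The closed cube is taken because the corners of the cells, where [phi] is frozen, need not belong
   to the half-open cube. *)
have [N NP] := @uniform_continuity R d _ (v2r \o phi) (cbox a n%:R) (e / c) phiC
  (@compact_cbox R d a n%:R) (divr_gt0 e0 c0).
exists N => // j /= Nj; rewrite sub0r normrN.
have -> : \int[mu]_(x in Omega) dotW (phi x) (w j x) =
    \int[mu]_(x in B) dotW (phi x) (w j x).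
  apply/esym/Rintegral_support => // x _ nO.
  have -> : phi x = 0 by apply: phi0 => /KO.
  by rewrite dotC dot0r.
pose l : R := 2^-1 ^+ j; have l0 : 0 < l by exact: half_gt0.
have bw := osc_bdd_field dotW (osc_rescaled GC j).
have nl : n%:R = l * (2 ^ j * n)%:R by rewrite natrM mulrA [l * _]mulrC period_cell mul1r.
have e'0 : 0 <= dconst dotW * (e / c) by rewrite mulr_ge0 ?dconst_ge0 ?divr_ge0 // ltW.
apply: (@le_lt_trans _ _ (dconst dotW * (e / c) * n%:R ^+ d)); last first.
  rewrite mulrAC mulrCA -[ltRHS]mulr1 ltr_pM2l // ltr_pdivrMr // mul1r /c.
  by rewrite ltrDl.
rewrite -(Rintegral_norm GC a (scaleB j)) nl.
rewrite (Rintegral_grid a _ l0 (bdd_measurable_dot bphi bw)).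
rewrite (Rintegral_grid a _ l0 (bdd_measurable_norm GC j)) mulr_sumr.
apply: le_trans (ler_norm_sum _ _ _) _; apply: ler_sum => f _.
apply: Rintegral_dot_cell => // x fx.
apply: le_trans (dnorm_le_v2r _ _) _; rewrite ler_wpM2l ?dconst_ge0 // ltW //.
rewrite linearB distrC; apply: (NP j Nj); last exact: cbox_norm (ltW l0) (cube_cbox fx).
by rewrite nl; apply: grid_cbox; exact: ltW.
Qed.

Lemma rescaled_not_weakL1 : Omega !=set0 -> ~ weakL1_cvg0 dotW Omega w.
Proof.
move=> [x0 Ox0] cw; have [m mO'] := cbox_in_open oO Ox0.
pose l : R := 2^-1 ^+ m; pose V := l ^+ d.
have V0 : 0 < V by apply: exprn_gt0; exact: half_gt0.
have phiL : in_Linfty dotW Omega (test_fun dotW eps G m x0).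
  split; first by apply: measurable_funTS; exact: measurable_test_fun GC m x0.
  by exists 1; apply: aeW => x _; exact: test_fun_norm.
have V2 : 0 < V / 2 by exact: divr_gt0.
have /cvgrPdist_lt/(_ _ V2)[N _ NP] := cw _ phiL.
(* [j >= 3] makes [4 * 2^-1 ^+ j] at most [1 / 2], so the pairing with [test_fun] is at least
   [V / 2]. *)
pose j := maxn N (maxn m 3).
have Nj : (N <= j)%N by rewrite leq_maxl.
have mj : (m <= j)%N by rewrite /j !leq_max leqnn orbT.
have j3 : (3 <= j)%N by rewrite /j !leq_max leqnn !orbT.
have half8 : 2^-1 ^+ j <= 8^-1 :> R.
  rewrite -(subnK j3) exprD.
  have -> : 8^-1 = 1 * 2^-1 ^+ 3 :> R by field.
  rewrite ler_pM ?exprn_ge0 ?invr_ge0 // exprn_ile1 ?invr_ge0 //; lra.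
have := NP j Nj; rewrite /= sub0r normrN.
rewrite (@Rintegral_support R d _ (cube x0 l)); first last.
- move=> x _ nC; have -> : test_fun dotW eps G m x0 x = 0.
    by apply: test_fun0 => -[i [Cx _]]; exact: nC.
  by rewrite dotC dot0r.
- by move=> x /cube_cbox/mO'.
rewrite ltNge => /negP; apply; apply: le_trans (ler_norm _).
apply: le_trans (Rintegral_test_fun GC x0 mj); rewrite -/l -/V ler_pM2l //; lra.
Qed.

End domain.

Theorem corollary3p1 (R : realType) (d k : nat) (W X : vectType R)
    (dotW : {dot W for idfun})
    (Omega : set 'rV[R]_d) (A : multiindex d k -> 'Hom(W, X))
    (L : {vspace W}) :
  Omega !=set0 -> open Omega -> bounded_set Omega ->
  lebesgue_rV R d (closure Omega `\` interior Omega) = 0%E ->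
  constant_rank A ->
  L != 0%VS -> [set` L] `<=` span_of (wave_cone A) ->
  (forall xi : 'rV[R]_d, xi != 0 -> (L :&: lker (symbol A xi) = 0)%VS) ->
  exists w : nat -> 'rV[R]_d -> W,
    (forall j, smooth_on Omega (w j)) /\
    (forall j, in_L1 dotW Omega (w j)) /\
    (forall j x, Omega x -> diff_op A (w j) x = 0) /\
    density_weakstar_cvg0 dotW Omega w /\
    L1_cvg0 Omega (fun j x => dist_to dotW L (w j x)) /\
    ~ weakL1_cvg0 dotW Omega w /\
    (forall U : set 'rV[R]_d, open U -> U !=set0 -> U `<=` Omega ->
       ~ locally_equi_integrable U (fun j x => dnorm dotW (w j x))).
Proof.
move=> O0 oO bO _ crA L0 LA _.
have v0 : vpick L != 0 by rewrite vpick0.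
have [eps [G GC]] := exists_sequence dotW crA (memv_pick L)
  v0 (LA _ (memv_pick L)).
have [a [n OB]] := bounded_subset_cube bO.
exists (rescaled G); split; first by move=> j; exact: osc_smooth (osc_rescaled GC j).
split; first by move=> j; exact: (rescaled_in_L1 GC oO OB).
split; first by move=> j x _; exact: osc_Afree (osc_rescaled GC j).
split; first exact: (rescaled_weakstar GC OB).
split; first exact: (rescaled_dist_cvg0 GC oO OB).
split; first exact: (rescaled_not_weakL1 GC oO).
by move=> U oU U0 _; exact: (not_equi_integrable GC).
Qed.
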